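(* For any positive integers $a, b$ and any $\epsilon \in (0, 1/2)$, there is a parameter-preserving $(1 - \epsilon)$-approximate kernel for $K_{a,b}$-free Max $k$-Weight SAT whose output instance has $O\left(\frac{k \log k}{\epsilon}\right) + a \cdot O(b)^{2b} \cdot \frac{k^b}{\epsilon^{3b}}$ variables and $(k/\epsilon)^{O(ab)}$ clauses (the $O(\cdot)$'s hide absolute constants).
   Context: Max $k$-Weight SAT: the input is a CNF formula $\Phi = (\mathcal{V}, \mathcal{C})$, where $\mathcal{V}$ is a set of $n$ Boolean variables and $\mathcal{C}$ is a multiset of $m$ clauses (disjunctions of literals $v$ or $\neg v$), together with a positive integer $k$ (the parameter). A solution is a set $Y \subseteq \mathcal{V}$ with $|Y| \le k$ (the variables set to true; all others false); $\mathrm{val}_\Phi(Y)$ is the number of clauses of $\mathcal{C}$ (counted with multiplicity) satisfied by $Y$, and $\mathrm{OPT}_{\Phi,k} = \max_{|Y| \le k} \mathrm{val}_\Phi(Y)$. A solution $Y$ is $\beta$-approximate if $\mathrm{val}_\Phi(Y) \ge \beta \cdot \mathrm{OPT}_{\Phi,k}$. The incidence graph of $\Phi$ is the bipartite graph with left side $\mathcal{V}$, right side $\mathcal{C}$, and an edge $(v, C)$ iff $v \in C$ or $\neg v \in C$. $K_{a,b}$ is the complete bipartite graph with $a$ left and $b$ right vertices; $K_{a,b}$-free Max $k$-Weight SAT is the restriction to instances whose incidence graph contains no $a$ variables and $b$ clauses that are pairwise all adjacent. An $\alpha$-approximate polynomial-time pre-processing algorithm ($\alpha$-APPA) is a pair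 of polynomial-time algorithms $(\mathcal{A}, \mathcal{B})$: given an instance $(I, k)$, $\mathcal{A}$ outputs an instance $(I', k')$ of the same problem, and given any $\beta$-approximate solution of $(I', k')$ (for any $\beta$), $\mathcal{B}$ outputs an $\alpha\beta$-approximate solution of $(I, k)$. An $\alpha$-approximate kernel is an $\alpha$-APPA whose output size $|I'| + k'$ is bounded by a computable function of $k$. It is parameter-preserving if $k' = k$. *)

(* Defs.v *)
From Stdlib Require Import Reals.
From mathcomp Require Import all_boot.
Delimit Scope R_scope with Re.

Set Implicit Arguments.
Unset Strict Implicit.
Unset Printing Implicit Defensive.

(* A CNF formula on variables 'I_nvars.  A literal is a pair (v, s):
   (v, true) is the positive literal v, (v, false) is the literal ~ v.
   A clause is a sequence of literals; the clause multiset is a sequence. *)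
Record cnf := CNF { nvars : nat; clauses : seq (seq ('I_nvars * bool)) }.

Definition lit_sat (F : cnf) (Y : {set 'I_(nvars F)}) (l : 'I_(nvars F) * bool) : bool :=
  (l.1 \in Y) == l.2.

Definition clause_sat (F : cnf) (Y : {set 'I_(nvars F)}) (C : seq ('I_(nvars F) * bool)) : bool :=
  has (lit_sat Y) C.

Definition sat_val (F : cnf) (Y : {set 'I_(nvars F)}) : nat :=
  count (clause_sat Y) (clauses F).

Definition OPT (F : cnf) (k : nat) : nat :=
  \max_(Y : {set 'I_(nvars F)} | #|Y| <= k) sat_val Y.

Definition approx_sol (F : cnf) (k : nat) (beta : R) (Y : {set 'I_(nvars F)}) : Prop :=
  #|Y| <= k /\ (beta * INR (OPT F k) <= INR (sat_val Y))%Re.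

Definition occurs (F : cnf) (v : 'I_(nvars F)) (C : seq ('I_(nvars F) * bool)) : bool :=
  has (fun l => l.1 == v) C.

(* The incidence graph contains K_{a,b}: a variables and b clauses
   (clauses are indexed by their position, multiset semantics), pairwise adjacent. *)
Definition has_Kab (a b : nat) (F : cnf) : Prop :=
  exists (A : {set 'I_(nvars F)}) (B : {set 'I_(size (clauses F))}),
    #|A| = a /\ #|B| = b /\
    forall v j, v \in A -> j \in B -> occurs v (nth [::] (clauses F) j).

Definition Kab_free (a b : nat) (F : cnf) : Prop := ~ has_Kab a b F.

(* Bit encodings (unary for numbers, as in the FPT convention |I| + k) *)

Definition enc_nat (n : nat) : seq bool := nseq n true ++ [:: false].

Definition enc_seq (ls : seq (seq bool)) : seq bool :=
  enc_nat (size ls) ++ flatten ls.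

Definition enc_lit (n : nat) (l : 'I_n * bool) : seq bool :=
  enc_nat (val l.1) ++ [:: l.2].

Definition enc_cnf (F : cnf) : seq bool :=
  enc_nat (nvars F) ++ enc_seq [seq enc_seq (map (@enc_lit (nvars F)) C) | C <- clauses F].

Definition enc_set (n : nat) (Y : {set 'I_n}) : seq bool :=
  [seq i \in Y | i <- enum 'I_n].

(* States 'I_(tm_states.+1), start state ord0.  Tape alphabet 'I_(tm_syms.+3):
   ord0 is the blank, 1 encodes bit false, 2 encodes bit true.
   delta q a = None means halt; Some (q', b, true/false) writes b, moves
   right/left and goes to q'. *)
Record TM := MkTM {
  tm_states : nat;
  tm_syms : nat;
  tm_delta : 'I_tm_states.+1 -> 'I_tm_syms.+3 ->
             option ('I_tm_states.+1 * 'I_tm_syms.+3 * bool) }.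

Section TMSemantics.
Variable M : TM.
Local Notation Q := 'I_(tm_states M).+1.
Local Notation S := 'I_(tm_syms M).+3.

Definition blank : S := ord0.
Definition sym_of_bit (x : bool) : S := if x then inord 2 else inord 1.

(* configuration: state, tape left of head (reversed), tape from head on *)
Definition config := (Q * seq S * seq S)%type.

Definition init_config (x : seq bool) : config := (ord0, [::], map sym_of_bit x).

Definition step (c : config) : config :=
  let '(q, L, Rt) := c in
  match tm_delta q (head blank Rt) with
  | None => c
  | Some (q', b, true) => (q', b :: L, behead Rt)
  | Some (q', b, false) =>
      match L with
      | [::] => (q', [::], blank :: b :: behead Rt)
      | x :: L' => (q', L', x :: b :: behead Rt)
      end
  end.

Definition halted (c : config) : bool :=
  if tm_delta c.1.1 (head blank c.2) is None then true else false.

Definition outputs (c : config) (y : seq bool) : Prop :=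
  exists j, c.2 = map sym_of_bit y ++ nseq j blank.

Definition runs_within (x : seq bool) (t : nat) (y : seq bool) : Prop :=
  exists i, i <= t /\ halted (iter i step (init_config x)) /\
            outputs (iter i step (init_config x)) y.
End TMSemantics.

Definition poly_time_computable {X : Type} {Y : X -> Type}
  (P : X -> Prop) (encX : X -> seq bool) (encY : forall x, Y x -> seq bool)
  (f : forall x, Y x) : Prop :=
  exists (M : TM) (c d : nat), forall x, P x ->
    runs_within M (encX x) (c * (size (encX x)).+1 ^ d) (encY x (f x)).

(* The reduction algorithm fA maps (I, k) to (fA I k, k) (k' = k).     *)

Definition valid_input (a b : nat) (I : cnf) (k : nat) : Prop :=
  Kab_free a b I /\ 0 < k.

Definition pp_APPA (a b : nat) (alpha : R)
  (fA : cnf -> nat -> cnf)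
  (fB : forall (I : cnf) (k : nat), {set 'I_(nvars (fA I k))} -> {set 'I_(nvars I)})
  : Prop :=
  poly_time_computable (X := (cnf * nat)%type) (Y := fun _ => cnf)
    (fun x => valid_input a b x.1 x.2)
    (fun x => enc_cnf x.1 ++ enc_nat x.2)
    (fun x y => enc_cnf y ++ enc_nat x.2)
    (fun x => fA x.1 x.2)
  /\ poly_time_computable
    (X := {x : cnf * nat & {set 'I_(nvars (fA x.1 x.2))}})
    (Y := fun z => {set 'I_(nvars (projT1 z).1)})
    (fun z => valid_input a b (projT1 z).1 (projT1 z).2 /\ #|projT2 z| <= (projT1 z).2)
    (fun z => enc_cnf (projT1 z).1 ++ enc_nat (projT1 z).2 ++
              enc_cnf (fA (projT1 z).1 (projT1 z).2) ++ enc_nat (projT1 z).2 ++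
              enc_set (projT2 z))
    (fun z Y => enc_set Y)
    (fun z => fB (projT1 z).1 (projT1 z).2 (projT2 z))
  /\ (forall I k, valid_input a b I k -> valid_input a b (fA I k) k)
  /\ (forall (I : cnf) (k : nat) (beta : R) (Y' : {set 'I_(nvars (fA I k))}),
        valid_input a b I k ->
        approx_sol k beta Y' ->
        approx_sol k (alpha * beta) (fB I k Y')).

(* Main.v *)
(** Fix an integer [E] between [5 / eps] and [6 / eps].  The algorithm may depend on [a], [b]
    and [eps], so for [k] below a constant [K0] it keeps the variables of an optimal solution
    found by exhaustive search.  For larger [k] it keeps three groups of variables: those that
    meet a [1 / (k E)] fraction of the clauses with a negative literal; among the others, those
    that occur in most purely positive clauses; and the survivors of a sunflower-like deletion.
    Double counting [b]-sets of clauses bounds the number of variables that meet a given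
    fraction of a clause set.  This bounds the first group, and it shows that some member of
    the second group always has only a [1 / E] fraction of its clauses covered already: hence,
    if the optimum is at least [b k E^2], the missing variables of an optimal solution can be
    exchanged for members of the second group, while the clauses with negative literals are
    hardly affected.  If the optimum is smaller, the deletion is lossless: a large family of
    variables has a subfamily (core) agreeing on a set [A] of clauses such that no other clause
    is shared by many of its members, so that for every solution some member avoids, outside
    [A], all clauses that matter, and can replace the member of smallest degree.

    Restricted to the selected variables, a clause with a negated unselected variable is always
    true and only adds a constant.  By biclique-freeness few of the other clauses contain [a]
    or more variables; if there are too many clauses these are negligible, and the
    multiplicities of the remaining ones, of which few are distinct, are divided by a common
    factor.

    For the running times, programs over a fixed number of stacks of bits are simulated on a
    single tape with one track per stack.  The functions they compute in polynomial time are
    closed under composition, pairing, and iteration with intermediate results of polynomial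
    size, from which the kernelization is built. *)

Require Import Defs.
From Stdlib Require Import Reals Lra FunctionalExtensionality.
From HB Require Import structures.
From mathcomp Require Import all_boot zify.

Set Implicit Arguments.
Unset Strict Implicit.
Unset Printing Implicit Defensive.

(** * Register programs *)

(** The absolute constant in [(k / eps) ^ O(ab)] is what forces the branch for small [k]: a kernel
    with [a * (35 * b * k * E * E) ^ b] variables has a clause bound containing factors like
    [a ^ (2 * a)] and [b ^ (2 * a * b)], whereas for [k = 1] and [eps] near 1/2 only [2 ^ O(ab)]
    clauses are allowed. From [K0 = 140 * a * b * E * E] on, such factors are bounded by powers of
    [k]. The threshold [b * k * E * E] is where counting [b]-sets starts to work: a useful positive
    variable lies in at least [opt / (k * E)] clauses, and a [1 / E] fraction of those must still
    comprise [b] clauses. Below it, at most [2 * opt] clauses matter to a swap, which fixes the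
    growth rate of the core thresholds. The exchange loses [4 * opt / E], the rounding of
    multiplicities another factor [1 - 1 / E]; this is why [E] is at least [5 / eps]. Since [beta]
    is an arbitrary real, the comparison of optima is kept as a cross-multiplied inequality between
    integers, with the case of kernel optimum 0 set apart. *)

Definition store := nat -> seq bool.
Definition upd (s : store) i v : store := fun j => if j == i then v else s j.

Inductive cmd :=
| Skip
| Push of nat & bool
| Seq of cmd & cmd
| Case of nat & cmd & cmd & cmd
| Loop of nat & cmd
| Each of nat & cmd & cmd.

(* [t] is an upper bound of the running time.  [Loop] stops on popping [false] or on an
   empty register, [Each] only on an empty register. *)
Inductive exec : cmd -> store -> nat -> store -> Prop :=
| ex_skip s t : exec Skip s t s
| ex_push i b s t : 0 < t -> exec (Push i b) s t (upd s i (b :: s i))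
| ex_seq c d s s1 s2 t1 t2 t :
    exec c s t1 s1 -> exec d s1 t2 s2 -> t1 + t2 <= t -> exec (Seq c d) s t s2
| ex_case0 i c0 cF cT s t1 t s' : s i = [::] -> exec c0 s t1 s' -> t1 < t ->
    exec (Case i c0 cF cT) s t s'
| ex_caseb i c0 cF cT b r s t1 t s' : s i = b :: r ->
    exec (if b then cT else cF) (upd s i r) t1 s' -> t1 < t ->
    exec (Case i c0 cF cT) s t s'
| ex_loop0 i c s t : s i = [::] -> 0 < t -> exec (Loop i c) s t s
| ex_loopF i c r s t : s i = false :: r -> 0 < t -> exec (Loop i c) s t (upd s i r)
| ex_loopT i c r s t1 s1 t2 s2 t : s i = true :: r ->
    exec c (upd s i r) t1 s1 -> exec (Loop i c) s1 t2 s2 -> t1 + t2 < t ->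
    exec (Loop i c) s t s2
| ex_each0 i cF cT s t : s i = [::] -> 0 < t -> exec (Each i cF cT) s t s
| ex_eachb i cF cT b r s t1 s1 t2 s2 t : s i = b :: r ->
    exec (if b then cT else cF) (upd s i r) t1 s1 -> exec (Each i cF cT) s1 t2 s2 ->
    t1 + t2 < t -> exec (Each i cF cT) s t s2.

Lemma size_upd h s i v :
  (forall j, size (s j) <= h) -> size v <= h -> forall j, size (upd s i v j) <= h.
Proof. by move=> sh vh j; rewrite /upd; case: (j == i). Qed.

(** Only a push lengthens a register, and it costs a unit of time. Bounds on output sizes are read
    off from time bounds in this way. *)
Lemma exec_size c s t s' : exec c s t s' ->
  forall h, (forall i, size (s i) <= h) -> forall i, size (s' i) <= h + t.
Proof.
have P i v (s0 : store) h : s0 i = v -> (forall j, size (s0 j) <= h) ->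
    forall j, size (upd s0 i (behead v) j) <= h.
  by move=> e sh; apply: size_upd => //; rewrite size_behead -e; move: (sh i); lia.
elim=> {c s t s'}.
- by move=> s t h sh i; move: (sh i); lia.
- move=> i b s t t0 h sh; apply: size_upd => [j|]; first by move: (sh j); lia.
  by rewrite /=; move: (sh i); lia.
- by move=> c d s s1 s2 t1 t2 t _ IH1 _ IH2 tt h sh i; move: (IH2 _ (IH1 _ sh) i); lia.
- by move=> i c0 cF cT s t1 t s' _ _ IH tt h sh j; move: (IH _ sh j); lia.
- by move=> i c0 cF cT b r s t1 t s' e _ IH tt h sh j; move: (IH _ (P _ _ _ _ e sh) j) => /=; lia.
- by move=> i c s t _ _ h sh j; move: (sh j); lia.
- by move=> i c r s t e _ h sh j; move: (P _ _ _ _ e sh j) => /=; lia.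
- move=> i c r s t1 s1 t2 s2 t e _ IH1 _ IH2 tt h sh j.
  by move: (IH2 _ (IH1 _ (P _ _ _ _ e sh)) j) => /=; lia.
- by move=> i cF cT s t _ _ h sh j; move: (sh j); lia.
- move=> i cF cT b r s t1 s1 t2 s2 t e _ IH1 _ IH2 tt h sh j.
  by move: (IH2 _ (IH1 _ (P _ _ _ _ e sh)) j) => /=; lia.
Qed.

(** * Compilation of structured programs to finite control *)

Inductive instr (Q : Type) :=
| IPush of nat & bool & Q
| ICase of nat & Q & Q & Q.

Definition imap (Q Q' : Type) (f : Q -> Q') (x : instr Q) : instr Q' :=
  match x with
  | IPush i b q => IPush i b (f q)
  | ICase i q0 qF qT => ICase i (f q0) (f qF) (f qT)
  end.

Lemma imap_comp (Q1 Q2 Q3 : Type) (g : Q2 -> Q3) (f : Q1 -> Q2) h x :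
  (forall q, g (f q) = h q) -> imap g (imap f x) = imap h x.
Proof. by move=> e; case: x => //= *; rewrite !e. Qed.

Definition ireg (Q : Type) (x : instr Q) :=
  match x with IPush i _ _ => i | ICase i _ _ _ => i end.

Lemma ireg_imap (Q Q' : Type) (f : Q -> Q') x : ireg (imap f x) = ireg x.
Proof. by case: x. Qed.

(** Control points of the compiled program; the exit is the extra value [None] of [option (st c)].
    [Skip] has no control point, so an entry may coincide with the exit. *)
Fixpoint st (c : cmd) : finType :=
  match c with
  | Skip => void
  | Push _ _ => unit
  | Seq c d => (st c + st d)%type
  | Case _ c0 cF cT => (unit + (st c0 + (st cF + st cT)))%type
  | Loop _ c => (unit + st c)%type
  | Each _ cF cT => (unit + (st cF + st cT))%type
  end.

Fixpoint entry (c : cmd) : option (st c) :=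
  match c return option (st c) with
  | Skip => None
  | Push _ _ => Some tt
  | Seq c d => if entry c is Some s then Some (inl s) else omap inr (entry d)
  | Case _ c0 cF cT => Some (inl tt)
  | Loop _ c => Some (inl tt)
  | Each _ cF cT => Some (inl tt)
  end.

(** Embeds the control points of a subprogram and redirects its exit to the continuation [e]. *)
Definition ext (A B : Type) (f : A -> B) (e : option B) (o : option A) : option B :=
  if o is Some a then Some (f a) else e.

Fixpoint code (c : cmd) : st c -> instr (option (st c)) :=
  match c return st c -> instr (option (st c)) with
  | Skip => fun x => match x with end
  | Push i b => fun _ => IPush i b None
  | Seq c d => fun x => match x with
     | inl s => imap (ext inl (omap inr (entry d))) (code s)
     | inr s => imap (omap inr) (code s) end
  | Case i c0 cF cT => fun x => match x with
     | inl _ => ICase i (omap (fun s => inr (inl s)) (entry c0))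
          (omap (fun s => inr (inr (inl s))) (entry cF))
          (omap (fun s => inr (inr (inr s))) (entry cT))
     | inr (inl s) => imap (omap (fun s => inr (inl s))) (code s)
     | inr (inr (inl s)) => imap (omap (fun s => inr (inr (inl s)))) (code s)
     | inr (inr (inr s)) => imap (omap (fun s => inr (inr (inr s)))) (code s) end
  | Loop i c => fun x => match x with
     | inl _ => ICase i None None (ext inr (Some (inl tt)) (entry c))
     | inr s => imap (ext inr (Some (inl tt))) (code s) end
  | Each i cF cT => fun x => match x with
     | inl _ => ICase i None (ext (fun s => inr (inl s)) (Some (inl tt)) (entry cF))
                 (ext (fun s => inr (inr s)) (Some (inl tt)) (entry cT))
     | inr (inl s) => imap (ext (fun s => inr (inl s)) (Some (inl tt))) (code s)
     | inr (inr s) => imap (ext (fun s => inr (inr s)) (Some (inl tt))) (code s) end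
  end.

Fixpoint maxreg (c : cmd) : nat :=
  match c with
  | Skip => 0
  | Push i _ => i
  | Seq c d => maxn (maxreg c) (maxreg d)
  | Case i c0 cF cT => maxn i (maxn (maxreg c0) (maxn (maxreg cF) (maxreg cT)))
  | Loop i c => maxn i (maxreg c)
  | Each i cF cT => maxn i (maxn (maxreg cF) (maxreg cT))
  end.

Lemma code_maxreg c (s : st c) : ireg (code s) <= maxreg c.
Proof.
elim: c s => //=.
- by move=> c IH1 d IH2 [s|s]; rewrite ireg_imap; [move: (IH1 s)|move: (IH2 s)]; lia.
- move=> i c0 IH0 cF IHF cT IHT [[]|[s|[s|s]]] /=; rewrite ?ireg_imap; first lia.
  + by move: (IH0 s); lia.
  + by move: (IHF s); lia.
  + by move: (IHT s); lia.
- by move=> i c IH [[]|s] /=; rewrite ?ireg_imap; [lia|move: (IH s); lia].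
- move=> i cF IHF cT IHT [[]|[s|s]] /=; rewrite ?ireg_imap; first lia.
  + by move: (IHF s); lia.
  + by move: (IHT s); lia.
Qed.

Section Automaton.
Variables (Q : Type) (prog : Q -> option (instr Q)).

Definition istep (x : instr Q) (s : store) : Q * store :=
  match x with
  | IPush i b q => (q, upd s i (b :: s i))
  | ICase i q0 qF qT =>
      match s i with
      | [::] => (q0, s)
      | b :: r => (if b then qT else qF, upd s i r)
      end
  end.

Inductive runs : Q * store -> nat -> Q * store -> Prop :=
| runs0 x t : runs x t x
| runsS q s x t y : prog q = Some x -> runs (istep x s) t y -> runs (q, s) t.+1 y.

Lemma runs_le x t t' y : t <= t' -> runs x t y -> runs x t' y.
Proof.
move=> tt r; elim: r t' tt => {x t y} [x t t' _|q s x t y px _ IH [//|t'] tt]; first exact: runs0.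
by apply: runsS px _; apply: IH.
Qed.

Lemma runs_trans x t1 y t2 z t :
  runs x t1 y -> runs y t2 z -> t1 + t2 <= t -> runs x t z.
Proof.
move=> r; elim: r t => {x t1 y} [x t1|q s x t1 y px _ IH] t r2 tt.
  by apply: (runs_le _ r2); lia.
case: t tt => [|t] tt; first lia.
by apply: runsS px _; apply: IH => //; lia.
Qed.

Lemma runs_step q s x t y : prog q = Some x -> runs (istep x s) t.-1 y -> 0 < t ->
  runs (q, s) t y.
Proof. by case: t => // t px r _; apply: runsS px r. Qed.

End Automaton.

(** The induction needs every subprogram to run inside an arbitrary host program: [h] places its
    control points there and sends its exit [None] to wherever the host continues. *)
Lemma exec_runs c s t s' : exec c s t s' ->
  forall (Q : Type) (prog : Q -> option (instr Q)) (h : option (st c) -> Q),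
  (forall x, prog (h (Some x)) = Some (imap h (code x))) ->
  runs prog (h (entry c), s) t (h None, s').
Proof.
elim=> {c s t s'}.
- by move=> s t Q prog h H; apply: runs0.
- move=> i b s t t0 Q prog h H; apply: runs_step (H tt) _ t0 => /=; exact: runs0.
- move=> c d s s1 s2 t1 t2 t _ IH1 _ IH2 le_t Q prog h H.
  pose h1 (o : option (st c)) : Q := h (ext inl (omap inr (entry d)) o).
  pose h2 (o : option (st d)) : Q := h (omap inr o).
  have H1 x : prog (h1 (Some x)) = Some (imap h1 (code x)).
    by rewrite /h1 H /= (@imap_comp _ _ _ _ _ h1).
  have H2 x : prog (h2 (Some x)) = Some (imap h2 (code x)).
    by rewrite /h2 H /= (@imap_comp _ _ _ _ _ h2).
  have := runs_trans (IH1 _ _ _ H1) (IH2 _ _ _ H2) le_t.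
  by rewrite /h1 /h2 /=; case: (entry c).
- move=> i c0 cF cT s t1 t s' e _ IH le_t Q prog h H.
  pose h1 (o : option (st c0)) : Q := h (omap (fun s => inr (inl s)) o).
  have H1 x : prog (h1 (Some x)) = Some (imap h1 (code x)).
    by rewrite /h1 H /= (@imap_comp _ _ _ _ _ h1).
  apply: (runs_step (H (inl tt))); last lia.
  by rewrite /= e; apply: (runs_le _ (IH _ _ _ H1)); lia.
- move=> i c0 cF cT b r s t1 t s' e _ IH le_t Q prog h H.
  apply: (runs_step (H (inl tt))); last lia.
  rewrite /= e; case: b {e} IH => IH.
    pose h1 (o : option (st cT)) : Q := h (omap (fun s => inr (inr (inr s))) o).
    have H1 x : prog (h1 (Some x)) = Some (imap h1 (code x)).
      by rewrite /h1 H /= (@imap_comp _ _ _ _ _ h1).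
    by apply: (runs_le _ (IH _ _ _ H1)); lia.
  pose h1 (o : option (st cF)) : Q := h (omap (fun s => inr (inr (inl s))) o).
  have H1 x : prog (h1 (Some x)) = Some (imap h1 (code x)).
    by rewrite /h1 H /= (@imap_comp _ _ _ _ _ h1).
  by apply: (runs_le _ (IH _ _ _ H1)); lia.
- move=> i c s t e t0 Q prog h H; apply: (runs_step (H (inl tt))) t0.
  by rewrite /= e; exact: runs0.
- move=> i c r s t e t0 Q prog h H; apply: (runs_step (H (inl tt))) t0.
  by rewrite /= e; exact: runs0.
- move=> i c r s t1 s1 t2 s2 t e _ IH1 _ IH2 le_t Q prog h H.
  pose h1 (o : option (st c)) : Q := h (ext inr (Some (inl tt)) o).
  have H1 x : prog (h1 (Some x)) = Some (imap h1 (code x)).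
    by rewrite /h1 H /= (@imap_comp _ _ _ _ _ h1).
  apply: (runs_step (H (inl tt))); last lia.
  by rewrite /= e; apply: runs_trans (IH1 _ _ _ H1) (IH2 _ _ _ H) _; lia.
- move=> i cF cT s t e t0 Q prog h H; apply: (runs_step (H (inl tt))) t0.
  by rewrite /= e; exact: runs0.
- move=> i cF cT b r s t1 s1 t2 s2 t e _ IH1 _ IH2 le_t Q prog h H.
  apply: (runs_step (H (inl tt))); last lia.
  rewrite /= e; case: b {e} IH1 => IH1.
    pose h1 (o : option (st cT)) : Q := h (ext (fun s => inr (inr s)) (Some (inl tt)) o).
    have H1 x : prog (h1 (Some x)) = Some (imap h1 (code x)).
      by rewrite /h1 H /= (@imap_comp _ _ _ _ _ h1).
    by apply: runs_trans (IH1 _ _ _ H1) (IH2 _ _ _ H) _; lia.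
  pose h1 (o : option (st cF)) : Q := h (ext (fun s => inr (inl s)) (Some (inl tt)) o).
  have H1 x : prog (h1 (Some x)) = Some (imap h1 (code x)).
    by rewrite /h1 H /= (@imap_comp _ _ _ _ _ h1).
  by apply: runs_trans (IH1 _ _ _ H1) (IH2 _ _ _ H) _; lia.
Qed.

(** * Simulation of register programs on one tape *)

Section Simulation.
Variable c : cmd.
Let m := maxreg c.
Notation O := (option (st c)).

Definition cell := {ffun 'I_m.+1 -> option bool}.

(* [None] is the marker to the left of the first cell; in a cell, track [i] holds one symbol
   of register [i], whose bottom is in the first cell. *)
Definition sym := option cell.
Definition blank_cell : cell := [ffun => None].
Definition bit_cell (b : bool) : cell := [ffun i => if i == ord0 then Some b else None].
Definition set_track (a : cell) (i : 'I_m.+1) (x : option bool) : cell :=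
  [ffun j => if j == i then x else a j].

(** [Mark] writes the left marker; [Run] travels right along one track to its first free cell;
    [Test] stands one cell to the left of that, on the top symbol or on the marker; [Ret] travels
    back to the marker. [Run None] halts. *)
Inductive phase := Mark | Run of O | Test of st c | Ret of O.
Definition phase_code (q : phase) : unit + (O + (st c + O)) :=
  match q with
  | Mark => inl tt | Run o => inr (inl o)
  | Test s => inr (inr (inl s)) | Ret o => inr (inr (inr o))
  end.
Definition phase_decode (x : unit + (O + (st c + O))) : phase :=
  match x with
  | inl _ => Mark | inr (inl o) => Run o
  | inr (inr (inl s)) => Test s | inr (inr (inr o)) => Ret o
  end.
Lemma phase_codeK : cancel phase_code phase_decode. Proof. by case. Qed.
HB.instance Definition _ := Finite.copy phase (can_type phase_codeK).

(* [None] is the start state. *)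
Definition delta (q : option phase) (x : sym) : option (option phase * sym * bool) :=
  match q with
  | None => Some (Some Mark, x, false)
  | Some Mark => Some (Some (Run (entry c)), None, true)
  | Some (Run None) => None
  | Some (Run (Some s)) =>
      match x, code s with
      | None, _ => None
      | Some a, IPush i b o =>
          if a (inord i) is Some _ then Some (q, x, true)
          else Some (Some (Ret o), Some (set_track a (inord i) (Some b)), false)
      | Some a, ICase i o0 oF oT =>
          if a (inord i) is Some _ then Some (q, x, true)
          else Some (Some (Test s), x, false)
      end
  | Some (Test s) =>
      match code s, x with
      | IPush _ _ _, _ => None
      | ICase _ o0 _ _, None => Some (Some (Run o0), None, true)
      | ICase i _ oF oT, Some a =>
          Some (Some (Ret (if a (inord i) is Some true then oT else oF)),
                Some (set_track a (inord i) None), false)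
      end
  | Some (Ret o) => if x is None then Some (Some (Run o), None, true) else Some (q, x, false)
  end.

Definition enc_state (q : option phase) : 'I_#|{: phase}|.+1 :=
  if q is Some p then lift ord0 (enum_rank p) else ord0.
Definition dec_state (x : 'I_#|{: phase}|.+1) : option phase := omap enum_val (unlift ord0 x).
Lemma enc_stateK : cancel enc_state dec_state.
Proof. by case=> [p|]; rewrite /dec_state /= ?liftK /= ?unlift_none ?enum_rankK. Qed.

(** The values 0, 1 and 2 are prescribed by the input convention; the other symbols only have to be
    distinct, so gaps among their codes do no harm. *)
Definition enc_sym_nat (x : sym) : nat :=
  if x == Some blank_cell then 0 else if x == Some (bit_cell false) then 1
  else if x == Some (bit_cell true) then 2 else (enum_rank x).+3.
Lemma enc_sym_lt x : enc_sym_nat x < #|{: sym}|.+3.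
Proof. by rewrite /enc_sym_nat; do 3 case: ifP => // _; rewrite !ltnS. Qed.
Definition enc_sym (x : sym) : 'I_#|{: sym}|.+3 := Ordinal (enc_sym_lt x).
Lemma enc_sym_inj : injective enc_sym.
Proof.
move=> x y /(congr1 val) /=; rewrite /enc_sym_nat.
do 3 (case: eqP => [->|?]; first by do 3 (case: eqP => [->|?] //=)).
by do 3 (case: eqP => [->|?] //=); move=> [] /ord_inj /enum_rank_inj.
Qed.
Definition dec_sym (y : 'I_#|{: sym}|.+3) : sym := odflt None [pick x | enc_sym x == y].
Lemma enc_symK : cancel enc_sym dec_sym.
Proof.
move=> x; rewrite /dec_sym; case: pickP => [y /eqP /enc_sym_inj //|/(_ x)].
by rewrite eqxx.
Qed.

Definition machine : TM := @MkTM #|{: phase}| #|{: sym}|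
  (fun q x => omap (fun r => (enc_state r.1.1, enc_sym r.1.2, r.2))
                   (delta (dec_state q) (dec_sym x))).

Definition aconfig := (option phase * seq sym * seq sym)%type.
Definition blank0 : sym := Some blank_cell.

Definition move_left (q : option phase) (L R : seq sym) : aconfig :=
  (q, behead L, head blank0 L :: R).

Definition astep (x : aconfig) : aconfig :=
  let '(q, L, R) := x in
  match delta q (head blank0 R) with
  | None => x
  | Some (q', b, true) => (q', b :: L, behead R)
  | Some (q', b, false) => move_left q' L (b :: behead R)
  end.

Definition embed (x : aconfig) : config machine :=
  (enc_state x.1.1, map enc_sym x.1.2, map enc_sym x.2).

Lemma enc_blank : enc_sym blank0 = blank machine.
Proof. by apply: val_inj; rewrite /= /enc_sym_nat eqxx. Qed.

Lemma enc_bit b : enc_sym (Some (bit_cell b)) = sym_of_bit machine b.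
Proof.
apply: val_inj; rewrite /sym_of_bit /= /enc_sym_nat.
have E b' : (Some (bit_cell b') == Some blank_cell) = false.
  by apply/eqP => -[] /ffunP /(_ ord0); rewrite !ffunE eqxx.
have E' : (Some (bit_cell true) == Some (bit_cell false)) = false.
  by apply/eqP => -[] /ffunP /(_ ord0); rewrite !ffunE eqxx.
by rewrite E; case: b; rewrite ?E' eqxx inordK.
Qed.

Lemma step_embed x : step (embed x) = embed (astep x).
Proof.
case: x => [[q L] R]; rewrite /step /astep /embed /=.
have -> : head (blank machine) (map enc_sym R) = enc_sym (head blank0 R).
  by case: R => //=; rewrite enc_blank.
rewrite enc_stateK enc_symK; case: (delta _ _) => [[[q' b] []]|] //=.
  by rewrite behead_map.
case: L => [|x L] /=; rewrite ?behead_map //.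
by rewrite enc_blank.
Qed.

Definition reach (x : aconfig) (n : nat) (y : aconfig) := exists2 i, i <= n & iter i astep x = y.

Lemma reach0 x n : reach x n x. Proof. by exists 0. Qed.
Lemma reach_trans x n y n' z N : reach x n y -> reach y n' z -> n + n' <= N -> reach x N z.
Proof.
move=> [i ii <-] [j jj <-] NN; exists (j + i); first lia.
by rewrite iterD.
Qed.
Lemma reachS x n y : reach (astep x) n y -> reach x n.+1 y.
Proof. by case=> i ii <-; exists i.+1; rewrite // iterSr. Qed.

(** Quantifying over all positions makes the relation independent of how much blank tape on the
    right has been visited. *)
Definition represents (s : store) (R : seq sym) :=
  forall p, nth blank0 R p = Some [ffun i : 'I_m.+1 => onth (rev (s i)) p].

Lemma represents_ext s R R' : represents s R ->
  (forall p, nth blank0 R' p = nth blank0 R p) -> represents s R'.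
Proof. by move=> r e p; rewrite e. Qed.

Lemma return_home o Y R : None \notin Y ->
  reach (move_left (Some (Ret o)) (Y ++ [:: None]) R) (size Y).+1
        (Some (Run o), [:: None], rev Y ++ R).
Proof.
elim: Y R => [|y Y IH] R; first by move=> _; apply: reachS; apply: reach0.
rewrite inE negb_or => /andP [yN YN]; apply: reachS.
case: y yN => // a _; rewrite /= rev_cons cat_rcons.
exact: IH.
Qed.

Lemma walk_right s i L R p : i <= m -> p <= size R ->
  (ireg (code s) = i) ->
  (forall r, r < p -> exists2 a : cell, nth blank0 R r = Some a & a (inord i) <> None) ->
  reach (Some (Run (Some s)), L, R) p (Some (Run (Some s)), rev (take p R) ++ L, drop p R).
Proof.
move=> im; elim: p L R => [|p IH] L R; first by rewrite take0 drop0 => _ _ _; apply: reach0.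
case: R => [//|x R] pR es H; apply: reachS; have [a ex ea] := H 0 isT.
have -> : astep (Some (Run (Some s)), L, x :: R) = (Some (Run (Some s)), x :: L, R).
  rewrite [x]ex /=; case: (code s) es => [j b o|j o0 oF oT] /= ->; by case: (a _) ea.
rewrite rev_cons cat_rcons; apply: IH => // r rp; exact: (H r.+1).
Qed.

Lemma represents_nth s R i p : i <= m -> represents s R ->
  exists2 a : cell, nth blank0 R p = Some a & a (inord i) = onth (rev (s i)) p.
Proof. by move=> im r; exists [ffun i : 'I_m.+1 => onth (rev (s i)) p]; rewrite // ffunE inordK. Qed.

Lemma onth_lt (T : Type) (l : seq T) p : p < size l -> onth l p <> None.
Proof. by elim: l p => [|x l IH] [|p] //= /IH. Qed.

Lemma represents_size s R i : i <= m -> represents s R -> size (s i) <= size R.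
Proof.
move=> im r; case: leqP => // lt; have [a] := represents_nth (size R) im r.
rewrite nth_default // => -[<-]; rewrite ffunE => /esym e.
by case: (@onth_lt _ (rev (s i)) (size R)) => //; rewrite size_rev.
Qed.

Lemma nth_put (T : Type) (x0 y : T) (R : seq T) p r : p <= size R ->
  nth x0 (take p R ++ y :: behead (drop p R)) r = if r == p then y else nth x0 R r.
Proof.
move=> pR; rewrite nth_cat size_takel //.
case: ltngtP => [rp|rp|->]; rewrite ?subnn //; first by rewrite nth_take.
by rewrite -[r - p]prednK ?subn_gt0 //= -drop1 drop_drop nth_drop; congr nth; lia.
Qed.

Lemma onth_rcons (T : Type) (l : seq T) x p :
  onth (rcons l x) p = if p == size l then Some x else onth l p.
Proof. by elim: l p => [|y l IH] [|p] //=; first by rewrite onth0n. Qed.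

Definition home (o : O) (R : seq sym) : aconfig := (Some (Run o), [:: None], R).

Lemma represents_noN s R p : represents s R -> None \notin take p R.
Proof.
move=> r; apply/negP => /(nthP blank0) [q]; rewrite size_take_min => lt.
rewrite nth_take ?r //; lia.
Qed.

Lemma head_drop (T : Type) (x0 : T) p R : head x0 (drop p R) = nth x0 R p.
Proof. by rewrite -nth0 nth_drop addn0. Qed.

Lemma represents_low s R i p : i <= m -> represents s R -> p < size (s i) ->
  exists2 a : cell, nth blank0 R p = Some a & a (inord i) <> None.
Proof.
move=> im rep lt; have [a e1 e2] := represents_nth p im rep.
by exists a => //; rewrite e2; apply: onth_lt; rewrite size_rev.
Qed.

Lemma push_ok x i b o s R :
  code x = IPush i b o -> i <= m -> represents s R ->
  exists2 R', represents (upd s i (b :: s i)) R' &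
    reach (home (Some x) R) (2 * size (s i) + 2) (home o R').
Proof.
move=> ex im rep; set p := size (s i).
have pR : p <= size R := represents_size im rep.
have [a ea ai] := represents_nth p im rep.
exists (take p R ++ Some (set_track a (inord i) (Some b)) :: behead (drop p R)).
  move=> r; rewrite nth_put //; case: eqP => [->|rp].
    congr Some; apply/ffunP => j; rewrite !ffunE /upd.
    case: (j =P inord i) => [->|ji]; first by rewrite inordK // eqxx rev_cons onth_rcons size_rev eqxx.
    have -> : (nat_of_ord j == i) = false by apply/eqP => e; apply: ji; rewrite -e inord_val.
    by have := rep p; rewrite ea => -[->]; rewrite ffunE.
  rewrite rep; congr Some; apply/ffunP => j; rewrite !ffunE /upd; case: eqP => // ->.
  by rewrite rev_cons onth_rcons size_rev (negbTE (introN eqP rp)).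
(* [p] steps to the first free cell of the track, one step to write, and [p + 1] steps back to the
   marker and onto the first cell. *)
apply: (reach_trans (n := p) (n' := p.+2)).
- by apply: (walk_right _ im pR) => [|r rp]; [rewrite ex|exact: represents_low rep rp].
- apply: reachS; rewrite /= head_drop ea ex ai onth_default ?size_rev //.
  have := @return_home o (rev (take p R)) (Some (set_track a (inord i) (Some b)) :: behead (drop p R)).
  rewrite mem_rev revK size_rev size_takel //; apply; exact: represents_noN rep.
- lia.
Qed.

Lemma case_ok x i o0 oF oT s R :
  code x = ICase i o0 oF oT -> i <= m -> represents s R ->
  exists2 R', represents (istep (ICase i o0 oF oT) s).2 R' &
    reach (home (Some x) R) (2 * size (s i) + 3) (home (istep (ICase i o0 oF oT) s).1 R').
Proof.
move=> ex im rep; set p := size (s i).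
have pR : p <= size R := represents_size im rep.
have [a ea ai] := represents_nth p im rep.
have W : reach (home (Some x) R) p (Some (Run (Some x)), rev (take p R) ++ [:: None], drop p R).
  by apply: (walk_right _ im pR) => [|r rp]; [rewrite ex|exact: represents_low rep rp].
have W2 : astep (Some (Run (Some x)), rev (take p R) ++ [:: None], drop p R) =
   move_left (Some (Test x)) (rev (take p R) ++ [:: None]) (Some a :: behead (drop p R)).
  by rewrite /= head_drop ea ex ai onth_default ?size_rev.
have rep1 : represents s (take p R ++ Some a :: behead (drop p R)).
  by apply: represents_ext rep _ => r; rewrite nth_put //; case: eqP => // ->.
case es: (s i) => [|b l]; rewrite /= es /=.
  (* Empty register: the step to the left already meets the marker. *)
  exists (take p R ++ Some a :: behead (drop p R)) => //.
  apply: (reach_trans W (n' := 2)); last lia.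
  apply: reachS; rewrite W2 /p es take0; apply: reachS; rewrite /= ex; exact: reach0.
have lt : size l < size R by move: pR; rewrite /p es.
have [a' ea' ai'] := represents_nth (size l) im rep.
have ab : a' (inord i) = Some b by rewrite ai' es rev_cons onth_rcons size_rev eqxx.
have tp : take p R = rcons (take (size l) R) (Some a').
  by rewrite /p es /= (take_nth blank0 lt) ea'.
pose R1 := take p R ++ Some a :: behead (drop p R).
have R1e : R1 = take (size l) R ++ Some a' :: Some a :: behead (drop p R).
  by rewrite /R1 tp cat_rcons.
pose y : sym := Some (set_track a' (inord i) None).
have e1 : take (size l) R1 = take (size l) R by rewrite R1e take_size_cat // size_takel // ltnW.
have e2 : behead (drop (size l) R1) = Some a :: behead (drop p R).
  by rewrite R1e drop_size_cat // size_takel // ltnW.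
exists (take (size l) R1 ++ y :: behead (drop (size l) R1)).
  move=> r; rewrite nth_put; last by rewrite R1e size_cat size_takel /=; lia.
  case: eqP => [->|rl].
    congr Some; apply/ffunP => j; rewrite !ffunE /upd.
    case: (j =P inord i) => [->|ji].
      by rewrite inordK // eqxx onth_default // size_rev.
    have -> : (nat_of_ord j == i) = false by apply/eqP => e; apply: ji; rewrite -e inord_val.
    by have := rep (size l); rewrite ea' => -[->]; rewrite ffunE.
  rewrite rep1; congr Some; apply/ffunP => j; rewrite !ffunE /upd; case: eqP => // ->.
  by rewrite es rev_cons onth_rcons size_rev (negbTE (introN eqP rl)).
apply: (reach_trans W (n' := (size l).+3)); last by rewrite /p es /=; lia.
apply: reachS; rewrite W2 tp rev_rcons; apply: reachS.
rewrite [astep _]/= ex ab e1 e2 -/y.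
have := @return_home (if b then oT else oF) (rev (take (size l) R)) (y :: Some a :: behead (drop p R)).
rewrite mem_rev revK size_rev size_takel; last exact: ltnW.
by case: b {es ab} => H; apply: H; exact: represents_noN rep.
Qed.

Definition prog (o : O) : option (instr O) := omap (@code c) o.

(** An instruction lengthens a register by at most one, so registers stay below [h + t] and every
    instruction costs at most [2 * (h + t) + 3] steps. *)
Lemma runs_reach x t y : runs prog x t y ->
  forall h R, (forall i, size (x.2 i) <= h) -> represents x.2 R ->
  exists2 R', represents y.2 R' & reach (home x.1 R) (t * (2 * (h + t) + 3)) (home y.1 R').
Proof.
elim=> {x t y} [x t h R _ rep|q s x t y].
  by exists R => //; apply: reach0.
case: q => [q|] //= [<-] {x} _ IH h R hs rep.
have rm := code_maxreg q.
have [R1 rep1 r1] : exists2 R', represents (istep (code q) s).2 R' &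
    reach (home (Some q) R) (2 * h + 3) (home (istep (code q) s).1 R').
  case e: (code q) rm => [i b o|i o0 oF oT] rm.
    have [R' H1 H2] := push_ok e rm rep; exists R' => //.
    by apply: (reach_trans H2 (reach0 _ 0)); move: (hs i); lia.
  have [R' H1 H2] := case_ok e rm rep; exists R' => //.
  by apply: (reach_trans H2 (reach0 _ 0)); move: (hs i); lia.
have hs1 i : size ((istep (code q) s).2 i) <= h.+1.
  case: (code q) => [j b o|j o0 oF oT] /=.
    by apply: size_upd => [k|/=]; [move: (hs k)|move: (hs j)]; lia.
  case e: (s j) => [|b l] /=; first by move: (hs i); lia.
  by apply: size_upd => [k|/=]; [move: (hs k)|move: (hs j); rewrite e /=]; lia.
have [R' H1 H2] := IH _ _ hs1 rep1; exists R' => //.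
by apply: (reach_trans r1 H2); lia.
Qed.

(** Reversed, because the bottom of a register lies at the left end of the tape, where the input
    word begins. *)
Definition input_store (x : seq bool) : store := nth [::] [:: rev x].

Lemma machine_ok x t y : exec c (input_store x) t (input_store y) ->
  runs_within machine x (2 + t * (2 * (size x + t) + 3)) y.
Proof.
move=> /exec_runs /(_ _ prog id) /= H.
have {H} H : runs prog (entry c, input_store x) t (None, input_store y).
  by apply: H => s /=; congr Some; case: (code s).
pose R0 : seq sym := [seq Some (bit_cell b) | b <- x].
have nthR z p : nth blank0 [seq Some (bit_cell b) | b <- z] p =
    Some [ffun i : 'I_m.+1 => onth (rev (input_store z i)) p].
  case: (ltnP p (size z)) => pz.
    rewrite (nth_map false) //; congr Some; apply/ffunP => i; rewrite !ffunE /input_store.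
    case: i => [[|i] Hi] /=; last by rewrite nth_nil; case: p {pz}.
    by rewrite revK onthE (nth_map false).
  rewrite nth_default ?size_map //; congr Some; apply/ffunP => i; rewrite !ffunE /input_store.
  case: i => [[|i] Hi] /=; last by rewrite nth_nil; case: p {pz}.
  by rewrite revK onth_default.
(* On empty input the two initial moves leave one visited blank cell behind. *)
pose R1 : seq sym := if x is [::] then [:: blank0] else R0.
have rep : represents (input_store x) R1.
  apply: (@represents_ext _ R0); first exact: nthR.
  by move=> p; rewrite /R1 /R0; case: (x) => [|b z] //; case: p => [|[|p]].
have hs i : size (input_store x i) <= size x.
  by rewrite /input_store; case: i => [|i] /=; rewrite ?nth_nil ?size_rev.
have [R' rep' [i ii e]] := runs_reach H hs rep.
have e0 : iter 2 (step (M := machine)) (init_config machine x) = embed (home (entry c) R1).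
  have -> : init_config machine x = embed (None, [::], R0).
    rewrite /init_config /embed /= /R0 -map_comp; congr (_, _, _).
    by apply: eq_map => b /=; rewrite enc_bit.
  rewrite 2!iterS -[iter 0 _ _]/(embed _) !step_embed; congr embed.
  by rewrite /R1 /R0; case: (x).
exists (i + 2); split; first by move: ii; lia.
have -> : iter (i + 2) (step (M := machine)) (init_config machine x) = embed (home None R').
  rewrite iterD e0 -e; elim: i {ii e} => //= i ->; exact: step_embed.
have E z : delta (dec_state (enc_state (Some (Run None)))) z = None by rewrite enc_stateK.
split; first by move: E => /= E; rewrite /halted /= E.
have sz : size y <= size R'.
  by have := represents_size (leq0n m) rep'; rewrite /input_store /= size_rev.
exists (size R' - size y); rewrite /embed /=.
have -> : R' = [seq Some (bit_cell b) | b <- y] ++ nseq (size R' - size y) blank0.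
  apply: (@eq_from_nth _ blank0) => [|p pR]; first by rewrite size_cat size_map size_nseq subnKC.
  rewrite rep' nth_cat size_map -nthR; case: ltnP => // yp.
  by rewrite nth_default ?size_map // nth_nseq if_same.
rewrite map_cat -map_comp map_nseq enc_blank size_cat size_map size_nseq addKn; congr cat.
by apply: eq_map => b /=; rewrite enc_bit.
Qed.

End Simulation.

(** * Executing straight-line blocks *)

Lemma leq_expr m n e : m <= n -> m ^ e <= n ^ e.
Proof. by case: e => // e; rewrite leq_exp2r. Qed.

(** The shape demanded by [poly_time_computable]; the base [n.+1] keeps all powers positive. *)
Definition pol (c d n : nat) := c * n.+1 ^ d.
Definition poly (p : nat -> nat) := exists c d, forall n, p n <= pol c d n.

Lemma pol_mono c d n n' : n <= n' -> pol c d n <= pol c d n'.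
Proof. by move=> le; rewrite /pol leq_mul2l leq_expr ?orbT. Qed.

Lemma poly_le p q : poly q -> (forall n, p n <= q n) -> poly p.
Proof. by move=> [c [d H]] le; exists c, d => n; apply: leq_trans (le n) (H n). Qed.
Lemma poly_pol c d : poly (pol c d). Proof. by exists c, d. Qed.
Lemma poly_const c : poly (fun=> c).
Proof. by exists c, 0 => n; rewrite /pol expn0 muln1. Qed.
Lemma poly_id : poly id.
Proof. by exists 1, 1 => n; rewrite /pol expn1 mul1n. Qed.
Lemma poly_add p q : poly p -> poly q -> poly (fun n => p n + q n).
Proof.
move=> [c [d H]] [c' [d' H']]; exists (c + c'), (d + d') => n.
have := H n; have := H' n; rewrite /pol mulnDl expnD.
have h1 : 0 < n.+1 ^ d by rewrite expn_gt0.
have h2 : 0 < n.+1 ^ d' by rewrite expn_gt0.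
by move: (n.+1 ^ d) (n.+1 ^ d') h1 h2 => x y; nia.
Qed.
Lemma poly_mul p q : poly p -> poly q -> poly (fun n => p n * q n).
Proof.
move=> [c [d H]] [c' [d' H']]; exists (c * c'), (d + d') => n.
by rewrite /pol expnD mulnACA leq_mul.
Qed.
Lemma poly_comp p q : poly p -> poly q -> poly (fun n => p (q n)).
Proof.
move=> [c [d H]] [c' [d' H']]; exists (c * (c' + 1) ^ d), (d' * d) => n.
apply: leq_trans (H _) _; apply: leq_trans (pol_mono _ _ (H' n)) _.
rewrite /pol -mulnA leq_mul2l expnM -expnMn leq_expr ?orbT //.
have h2 : 0 < n.+1 ^ d' by rewrite expn_gt0.
by move: (n.+1 ^ d') h2 => y; nia.
Qed.
Lemma poly_polc c d p : poly p -> poly (fun n => pol c d (p n)).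
Proof. by move=> P; exact: (poly_comp (poly_pol c d) P). Qed.

Lemma poly_S p : poly p -> poly (fun n => (p n).+1).
Proof.
move=> P; apply: poly_le (poly_add P (poly_const 1)) _ => n; by rewrite addn1.
Qed.

Ltac polyt := repeat first [apply: poly_id | apply: poly_const | apply: poly_polc
  | apply: poly_S | apply: poly_add | apply: poly_mul].

Lemma exec_le c s t t' s' : exec c s t s' -> t <= t' -> exec c s t' s'.
Proof.
move=> H; case: c s t s' / H t'.
- by move=> *; exact: ex_skip.
- by move=> i b s t t0 t' le; apply: ex_push; lia.
- by move=> c d s s1 s2 t1 t2 t H1 H2 le t' le'; apply: ex_seq H1 H2 _; lia.
- by move=> i c0 cF cT s t1 t s' e H le t' le'; apply: ex_case0 e H _; lia.
- by move=> i c0 cF cT b r s t1 t s' e H le t' le'; apply: ex_caseb e H _; lia.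
- by move=> i c s t e le t' le'; apply: ex_loop0 => //; lia.
- by move=> i c r s t e le t' le'; apply: ex_loopF => //; lia.
- by move=> i c r s t1 s1 t2 s2 t e H1 H2 le t' le'; apply: ex_loopT e H1 H2 _; lia.
- by move=> i cF cT s t e le t' le'; apply: ex_each0 => //; lia.
- by move=> i cF cT b r s t1 s1 t2 s2 t e H1 H2 le t' le'; apply: ex_eachb e H1 H2 _; lia.
Qed.

Definition rg (l : seq (seq bool)) : store := nth [::] l.

Lemma rg_ext l l' : (forall i, nth [::] l i = nth [::] l' i) -> rg l = rg l'.
Proof. by move=> e; apply: functional_extensionality. Qed.

Lemma rg_upd l i v : upd (rg l) i v = rg (set_nth [::] l i v).
Proof. by apply: functional_extensionality => j; rewrite /upd /rg nth_set_nth. Qed.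

Lemma rg_pad l j : rg l = rg (l ++ nseq j [::]).
Proof.
apply: rg_ext => i; rewrite nth_cat; case: ltnP => // le.
by rewrite nth_default // nth_nseq if_same.
Qed.

(* [block] ends with [Skip], so that an execution can be closed by an equality of stores. *)
Fixpoint block (l : seq cmd) : cmd := if l is c :: l' then Seq c (block l') else Skip.

Arguments block : simpl never.

Lemma ex_block0 s s' : s = s' -> exec (block [::]) s 0 s'.
Proof. by move=> ->; exact: ex_skip. Qed.
Lemma ex_blockS c l s t1 s1 t2 s2 :
  exec c s t1 s1 -> exec (block l) s1 t2 s2 -> exec (block (c :: l)) s (t1 + t2) s2.
Proof. by move=> H1 H2; exact: ex_seq H1 H2 _. Qed.

Lemma bl_push i b l L t s : exec (block L) (rg (set_nth [::] l i (b :: nth [::] l i))) t s ->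
  exec (block (Push i b :: L)) (rg l) (1 + t) s.
Proof. by move=> H; apply: ex_blockS H; rewrite -rg_upd; exact: ex_push. Qed.

(** Moving between stacks reverses the word, so a faithful transfer takes an even number of moves.
    Since reading destroys, duplication needs the two targets of [mv2]. *)
Definition mv i j := Each i (Push j false) (Push j true).
Definition mv2 (g : bool -> bool) i j k :=
  Each i (block [:: Push j false; Push k (g false)]) (block [:: Push j true; Push k (g true)]).
Definition clear i := Each i Skip Skip.

Lemma upd_upd s i v w : upd (upd s i v) i w = upd s i w.
Proof. by apply: functional_extensionality => j; rewrite /upd; case: (j == i). Qed.
Lemma upd_id s i v : s i = v -> upd s i v = s.
Proof. by move=> <-; apply: functional_extensionality => j; rewrite /upd; case: eqP => // ->. Qed.
Lemma updE s i v : upd s i v i = v. Proof. by rewrite /upd eqxx. Qed.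
Lemma updN s i j v : i != j -> upd s i v j = s j.
Proof. by rewrite /upd eq_sym => /negbTE ->. Qed.

Lemma ex_clear i s : exec (clear i) s (2 * size (s i) + 1) (upd s i [::]).
Proof.
case e: (s i) => [|b r]; first by rewrite upd_id //; apply: ex_each0.
elim: r b s e => [|b' r IH] b s e.
  apply: (ex_eachb (t1 := 0) (t2 := 1) e) => //; last by apply: ex_each0; rewrite ?updE.
  by case: b {e}; exact: ex_skip.
rewrite -(@upd_upd s i (b' :: r)).
apply: (ex_eachb (t1 := 0) e _ (IH b' _ _)); last by rewrite /=; lia.
  by case: b {e}; exact: ex_skip.
by rewrite updE.
Qed.

Lemma ex_mv_store i j s : i != j ->
  exec (mv i j) s (2 * size (s i) + 1) (upd (upd s j (rev (s i) ++ s j)) i [::]).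
Proof.
move=> ij; move e: (s i) => r; elim: r s e => [|b r IH] s e.
  by rewrite [upd s j _]upd_id // upd_id //; apply: ex_each0.
pose s1 := upd (upd s i r) j (b :: s j).
have H : exec (if b then Push j true else Push j false) (upd s i r) 1 s1.
  by rewrite /s1 -(@updN s i j r ij); case: b {e s1}; exact: ex_push.
have e1 : s1 i = r by rewrite /s1 updN 1?eq_sym // updE.
have := IH _ e1; have -> : s1 j = b :: s j by rewrite /s1 updE.
move=> H2; have -> : upd (upd s j (rev (b :: r) ++ s j)) i [::] =
          upd (upd s1 j (rev r ++ b :: s j)) i [::].
  rewrite rev_cons cat_rcons; apply: functional_extensionality => x; rewrite /s1 /upd.
  by do 2 case: eqP => //.
by apply: ex_eachb e H H2 _ => /=; lia.
Qed.

Lemma ex_mv2_store g i j k s : i != j -> i != k -> j != k ->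
  exec (mv2 g i j k) s (3 * size (s i) + 1)
    (upd (upd (upd s j (rev (s i) ++ s j)) k (rev (map g (s i)) ++ s k)) i [::]).
Proof.
move=> ij ik jk; move e: (s i) => r; elim: r s e => [|b r IH] s e.
  by rewrite [upd s j _]upd_id // [upd s k _]upd_id // upd_id //; apply: ex_each0.
pose s1 := upd (upd (upd s i r) j (b :: s j)) k (g b :: s k).
have H : exec (if b then block [:: Push j true; Push k (g true)]
                   else block [:: Push j false; Push k (g false)]) (upd s i r) 2 s1.
  have -> : (if b then block [:: Push j true; Push k (g true)]
     else block [:: Push j false; Push k (g false)]) = block [:: Push j b; Push k (g b)] by case: (b).
  rewrite /s1 -(@updN s i j r ij) -(@updN s i k r ik) -(@updN _ j k (b :: upd s i r j) jk).
  apply: (@ex_blockS _ _ _ 1 _ 1); first exact: ex_push.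
  by apply: (@ex_blockS _ _ _ 1 _ 0); [exact: ex_push|exact: ex_skip].
have e1 : s1 i = r by rewrite /s1 updN 1?eq_sym // updN 1?eq_sym // updE.
have := IH _ e1; have -> : s1 j = b :: s j by rewrite /s1 updN 1?eq_sym // updE.
have -> : s1 k = g b :: s k by rewrite /s1 updE.
have -> : upd (upd (upd s1 j (rev r ++ b :: s j)) k (rev (map g r) ++ g b :: s k)) i [::] =
   upd (upd (upd s j (rev (b :: r) ++ s j)) k (rev (map g (b :: r)) ++ s k)) i [::].
  rewrite /= !rev_cons !cat_rcons; apply: functional_extensionality => x; rewrite /s1 /upd.
  by do 3 case: eqP => //.
by move=> H2; apply: ex_eachb e H H2 _ => /=; lia.
Qed.

(** The loop stops at the end of the unary block and also consumes a terminating [false], whence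
    [behead tl]; an empty [tl] covers a bare counter. *)
Lemma ex_tally i j n tl s : i != j -> ~~ head false tl -> s i = nseq n true ++ tl ->
  exec (Loop i (Push j true)) s (2 * n + 1) (upd (upd s j (nseq n true ++ s j)) i (behead tl)).
Proof.
move=> ij tlF; elim: n s => [|n IH] s e.
  rewrite [upd s j _]upd_id //; case: tl tlF e => [|[] tl] //= _ e; last exact: ex_loopF.
  by rewrite upd_id //; apply: ex_loop0.
pose s1 := upd (upd s i (nseq n true ++ tl)) j (true :: s j).
have H : exec (Push j true) (upd s i (nseq n true ++ tl)) 1 s1.
  by rewrite /s1 -(@updN s i j (nseq n true ++ tl) ij); exact: ex_push.
have e1 : s1 i = nseq n true ++ tl by rewrite /s1 updN 1?eq_sym // updE.
have := IH _ e1; have -> : s1 j = true :: s j by rewrite /s1 updE.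
move=> H2.
have -> : upd (upd s j (nseq n.+1 true ++ s j)) i (behead tl) =
   upd (upd s1 j (nseq n true ++ true :: s j)) i (behead tl).
  rewrite -[true :: s j]cat1s catA cats1 (_ : rcons _ _ = nseq n.+1 true); last first.
    by rewrite -[n.+1]addn1 nseqD cats1.
  apply: functional_extensionality => x; rewrite /s1 /upd; by do 2 case: eqP => //.
by apply: ex_loopT e H H2 _ => /=; lia.
Qed.

Lemma ex_droptally i n tl s : ~~ head false tl -> s i = nseq n true ++ tl ->
  exec (Loop i Skip) s (n + 1) (upd s i (behead tl)).
Proof.
move=> tlF; elim: n s => [|n IH] s e.
  case: tl tlF e => [|[] tl] //= _ e; last exact: ex_loopF.
  by rewrite upd_id //; apply: ex_loop0.
rewrite -(@upd_upd s i (nseq n true ++ tl)).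
apply: (ex_loopT (t1 := 0) e (ex_skip _ _) (IH _ _)); last lia.
by rewrite updE.
Qed.

Lemma bl_mv i j L l t s : i != j ->
  exec (block L) (rg (set_nth [::] (set_nth [::] l j (rev (nth [::] l i) ++ nth [::] l j)) i [::])) t s ->
  exec (block (mv i j :: L)) (rg l) (2 * size (nth [::] l i) + 1 + t) s.
Proof. by move=> ij H; apply: ex_blockS H; rewrite -!rg_upd; exact: ex_mv_store. Qed.

Lemma bl_mv2 g i j k L l t s : i != j -> i != k -> j != k ->
  exec (block L) (rg (set_nth [::] (set_nth [::] (set_nth [::] l j (rev (nth [::] l i) ++ nth [::] l j))
     k (rev (map g (nth [::] l i)) ++ nth [::] l k)) i [::])) t s ->
  exec (block (mv2 g i j k :: L)) (rg l) (3 * size (nth [::] l i) + 1 + t) s.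
Proof. by move=> ij ik jk H; apply: ex_blockS H; rewrite -!rg_upd; exact: ex_mv2_store. Qed.

Lemma bl_clear i L l t s : exec (block L) (rg (set_nth [::] l i [::])) t s ->
  exec (block (clear i :: L)) (rg l) (2 * size (nth [::] l i) + 1 + t) s.
Proof. by move=> H; apply: ex_blockS H; rewrite -!rg_upd; exact: ex_clear. Qed.

Lemma bl_tally i j n tl L l t s : i != j -> nth [::] l i = nseq n true ++ tl -> ~~ head false tl ->
  exec (block L) (rg (set_nth [::] (set_nth [::] l j (nseq n true ++ nth [::] l j)) i (behead tl))) t s ->
  exec (block (Loop i (Push j true) :: L)) (rg l) (2 * n + 1 + t) s.
Proof. by move=> ij e tlF H; apply: ex_blockS H; rewrite -!rg_upd; exact: ex_tally. Qed.

Lemma bl_droptally i n tl L l t s : nth [::] l i = nseq n true ++ tl -> ~~ head false tl ->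
  exec (block L) (rg (set_nth [::] l i (behead tl))) t s ->
  exec (block (Loop i Skip :: L)) (rg l) (n + 1 + t) s.
Proof. by move=> e tlF H; apply: ex_blockS H; rewrite -!rg_upd; exact: ex_droptally e. Qed.

Lemma bl_do c l' t1 L l t s : exec c (rg l) t1 (rg l') -> exec (block L) (rg l') t s ->
  exec (block (c :: L)) (rg l) (t1 + t) s.
Proof. exact: ex_blockS. Qed.

(** * Relocation of programs to higher registers *)

Fixpoint shift n c : cmd :=
  match c with
  | Skip => Skip
  | Push i b => Push (n + i) b
  | Seq c d => Seq (shift n c) (shift n d)
  | Case i c0 cF cT => Case (n + i) (shift n c0) (shift n cF) (shift n cT)
  | Loop i c => Loop (n + i) (shift n c)
  | Each i cF cT => Each (n + i) (shift n cF) (shift n cT)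
  end.

(** A frame: the registers in [lo] sit below those of [s], and a program shifted by [size lo] leaves
    them alone. *)
Definition under (lo : seq (seq bool)) (s : store) : store :=
  fun i => if i < size lo then nth [::] lo i else s (i - size lo).

Lemma under_at lo s i : under lo s (size lo + i) = s i.
Proof. by rewrite /under ltnNge leq_addr /= addKn. Qed.
Lemma upd_under lo s i v : upd (under lo s) (size lo + i) v = under lo (upd s i v).
Proof.
apply: functional_extensionality => x; rewrite /under /upd.
case: (x =P size lo + i) => [->|ne]; first by rewrite ltnNge leq_addr /= addKn eqxx.
by case: ltnP => // le; case: eqP => // e; case: ne; lia.
Qed.
Lemma under_rg lo l : under lo (rg l) = rg (lo ++ l).
Proof. by apply: functional_extensionality => x; rewrite /under /rg nth_cat. Qed.

Lemma exec_shift lo c s t s' : exec c s t s' ->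
  exec (shift (size lo) c) (under lo s) t (under lo s').
Proof.
elim=> {c s t s'} /=.
- by move=> *; exact: ex_skip.
- by move=> i b s t t0; rewrite -upd_under -(under_at lo s i); exact: ex_push.
- by move=> c d s s1 s2 t1 t2 t _ IH1 _ IH2 le; apply: ex_seq IH1 IH2 le.
- by move=> i c0 cF cT s t1 t s' e _ IH le; apply: ex_case0 IH le; rewrite under_at.
- move=> i c0 cF cT b r s t1 t s' e _ IH le.
  apply: (@ex_caseb _ _ _ _ b r _ t1) => //; first by rewrite under_at.
  by rewrite upd_under; case: b {e} IH.
- by move=> i c s t e le; apply: ex_loop0 => //; rewrite under_at.
- by move=> i c r s t e le; rewrite -upd_under; apply: ex_loopF => //; rewrite under_at.
- move=> i c r s t1 s1 t2 s2 t e _ IH1 _ IH2 le.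
  by apply: (ex_loopT (r := r) _ _ IH2 le); rewrite ?under_at // upd_under.
- by move=> i cF cT s t e le; apply: ex_each0 => //; rewrite under_at.
- move=> i cF cT b r s t1 s1 t2 s2 t e _ IH1 _ IH2 le.
  apply: (@ex_eachb _ _ _ b r _ _ _ _ _ _ _ _ IH2 le); rewrite ?under_at // upd_under.
  by case: b {e} IH1.
Qed.

Lemma bl_shift n c l l' lo t1 L t s : size lo = n -> exec c (rg l) t1 (rg l') ->
  exec (block L) (rg (lo ++ l')) t s ->
  exec (block (shift n c :: L)) (rg (lo ++ l)) (t1 + t) s.
Proof.
by move=> <- H H2; apply: bl_do H2; rewrite -!under_rg; exact: exec_shift.
Qed.

(** * Polynomial-time functions *)

(* Self-delimiting encodings: [mover] pops the code of [x] from register 0 and pushes it,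
   reversed, on register 1; register 2 is a stack of loop counters. *)
Class Enc (X : Type) := {
  enc : X -> seq bool;
  mover : cmd;
  mover_time : nat;
  ex_mover : forall x r0 r1 r2 l, exec mover (rg [:: enc x ++ r0, r1, r2 & l])
     (mover_time * size (enc x)) (rg [:: r0, rev (enc x) ++ r1, r2 & l]);
  enc_pos : forall x, 0 < size (enc x);
  dflt : X }.
Arguments mover X {Enc}.
Arguments dflt X {Enc}.
Arguments enc_pos {X Enc} x.
Arguments ex_mover {X Enc}.
Arguments mover_time X {Enc}.

Notation esize x := (size (enc x)).

Lemma bl_mover (X : Type) `{Enc X} (x : X) r0 r1 r2 l L t s :
  exec (block L) (rg [:: r0, rev (enc x) ++ r1, r2 & l]) t s ->
  exec (block (mover X :: L)) (rg [:: enc x ++ r0, r1, r2 & l]) (mover_time X * esize x + t) s.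
Proof. by move=> H1; apply: bl_do (ex_mover _ _ _ _ _) H1. Qed.

Lemma size_enc_nat n : size (enc_nat n) = n.+1.
Proof. by rewrite /enc_nat size_cat size_nseq addn1. Qed.
Lemma enc_nat_cat n r : enc_nat n ++ r = nseq n true ++ false :: r.
Proof. by rewrite /enc_nat -catA. Qed.
Lemma rev_enc_nat n : rev (enc_nat n) = false :: nseq n true.
Proof. by rewrite /enc_nat rev_cat rev_nseq. Qed.

Lemma ex_mover_nat n r0 r1 r2 l :
  exec (block [:: Loop 0 (Push 1 true); Push 1 false]) (rg [:: enc_nat n ++ r0, r1, r2 & l])
    (3 * size (enc_nat n)) (rg [:: r0, rev (enc_nat n) ++ r1, r2 & l]).
Proof.
apply: exec_le.
  apply: (bl_tally (n := n) (tl := false :: r0)) => //; first by rewrite /= enc_nat_cat.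
  by apply: bl_push => /=; apply: ex_block0; rewrite rev_enc_nat.
by rewrite size_enc_nat; lia.
Qed.
Lemma enc_nat_pos n : 0 < size (enc_nat n). Proof. by rewrite size_enc_nat. Qed.
#[export] Instance Enc_nat : Enc nat := Build_Enc ex_mover_nat enc_nat_pos 0.

Lemma ex_mover_bool b r0 r1 r2 l :
  exec (Case 0 Skip (Push 1 false) (Push 1 true)) (rg [:: [:: b] ++ r0, r1, r2 & l])
    (2 * size [:: b]) (rg [:: r0, rev [:: b] ++ r1, r2 & l]).
Proof.
apply: (@ex_caseb _ _ _ _ b r0 _ 1) => //.
have -> : rg [:: r0, rev [:: b] ++ r1, r2 & l] = upd (rg [:: r0, r1, r2 & l]) 1 (b :: r1).
  by rewrite rg_upd.
by rewrite rg_upd /=; case: b; exact: ex_push.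
Qed.
#[export] Instance Enc_bool : Enc bool := Build_Enc ex_mover_bool (fun=> isT) false.

Section Prod.
Variables (X Y : Type) (HX : Enc X) (HY : Enc Y).

Lemma ex_mover_prod (p : X * Y) r0 r1 r2 l :
  exec (block [:: mover X; mover Y]) (rg [:: (enc p.1 ++ enc p.2) ++ r0, r1, r2 & l])
    ((mover_time X + mover_time Y) * size (enc p.1 ++ enc p.2))
    (rg [:: r0, rev (enc p.1 ++ enc p.2) ++ r1, r2 & l]).
Proof.
apply: exec_le.
  rewrite -catA; apply: bl_mover; apply: bl_mover; apply: ex_block0.
  by rewrite rev_cat catA.
by rewrite size_cat; lia.
Qed.
Lemma enc_prod_pos (p : X * Y) : 0 < size (enc p.1 ++ enc p.2).
Proof. by rewrite size_cat addn_gt0 enc_pos. Qed.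

End Prod.
#[export] Instance Enc_prod (X Y : Type) (HX : Enc X) (HY : Enc Y) : Enc (X * Y) :=
  Build_Enc (@ex_mover_prod X Y HX HY) (@enc_prod_pos X Y HX HY) (dflt X, dflt Y).

Section EncSeq.
Variables (X : Type) (HX : Enc X).

(** The length is copied to register 2 as a unary counter on top of a [false], so the movers of
    nested lists can use the same stack for their own counters. *)
Lemma ex_mover_seq (s : seq X) r0 r1 r2 l :
  exec (block [:: Push 2 false; Loop 0 (block [:: Push 1 true; Push 2 true]); Push 1 false;
                  Loop 2 (mover X)]) (rg [:: enc_seq (map enc s) ++ r0, r1, r2 & l])
    ((mover_time X + 5) * size (enc_seq (map enc s)))
    (rg [:: r0, rev (enc_seq (map enc s)) ++ r1, r2 & l]).
Proof.
rewrite /enc_seq size_map.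
have H1 n r : forall r1 r2, exec (Loop 0 (block [:: Push 1 true; Push 2 true]))
    (rg [:: enc_nat n ++ r, r1, r2 & l]) (3 * n + 1) (rg [:: r, nseq n true ++ r1, nseq n true ++ r2 & l]).
  elim: n => [|n IH] q1 q2.
    have -> : rg [:: r, nseq 0 true ++ q1, nseq 0 true ++ q2 & l] =
      upd (rg [:: enc_nat 0 ++ r, q1, q2 & l]) 0 r by rewrite rg_upd.
    exact: ex_loopF.
  have e z : nseq n.+1 true ++ z = nseq n true ++ true :: z.
    by rewrite -[true :: z]cat1s catA cats1 -[n.+1]addn1 nseqD cats1.
  rewrite !e; apply: (@ex_loopT 0 _ (enc_nat n ++ r) _ 2 (rg [:: enc_nat n ++ r, true :: q1, true :: q2 & l])
     (3 * n + 1)) => //; last lia.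
  by rewrite rg_upd; exact: (bl_push (bl_push (ex_block0 (erefl _)))).
have H2 : forall (s : seq X) r1, exec (Loop 2 (mover X))
    (rg [:: flatten (map enc s) ++ r0, r1, nseq (size s) true ++ false :: r2 & l])
    ((mover_time X + 1) * size (flatten (map enc s)) + 1) (rg [:: r0, rev (flatten (map enc s)) ++ r1, r2 & l]).
  elim=> [|x s1 IH] q1.
    have -> : rg [:: r0, rev (flatten (map enc [::])) ++ q1, r2 & l] =
      upd (rg [:: flatten (map enc [::]) ++ r0, q1, nseq 0 true ++ false :: r2 & l]) 2 r2 by rewrite rg_upd.
    by apply: ex_loopF; rewrite // addn1.
  rewrite /= rev_cat -!catA.
  apply: (@ex_loopT 2 _ (nseq (size s1) true ++ false :: r2) _ (mover_time X * esize x) _ _ _ _ _ _ (IH _)) => //.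
    by rewrite rg_upd /=; apply: ex_mover.
  have e0 : 0 < esize x by exact: enc_pos.
  by rewrite size_cat; nia.
apply: exec_le.
  apply: bl_push => /=; rewrite -catA; apply: bl_do (H1 _ _ _ _) _.
  apply: bl_push => /=; apply: bl_do (H2 _ _) _; apply: ex_block0.
  by rewrite rev_cat rev_enc_nat -catA.
by rewrite size_cat size_enc_nat; nia.
Qed.
Lemma enc_seq_pos (s : seq X) : 0 < size (enc_seq (map enc s)).
Proof. by rewrite /enc_seq size_cat size_enc_nat. Qed.

End EncSeq.
#[export] Instance Enc_seq (X : Type) (HX : Enc X) : Enc (seq X) :=
  Build_Enc (@ex_mover_seq X HX) (@enc_seq_pos X HX) [::].

Lemma enc_cons (X : Type) `{Enc X} x (s : seq X) :
  enc (x :: s) = enc_nat (size s).+1 ++ enc x ++ flatten (map enc s).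
Proof. by rewrite /= /enc_seq /= size_map. Qed.
Lemma enc_list (X : Type) `{Enc X} (s : seq X) : enc s = enc_nat (size s) ++ flatten (map enc s).
Proof. by rewrite /= /enc_seq size_map. Qed.

(** All registers but the first are empty before and after, so that programs can be chained. *)
Definition PT (X Y : Type) `{Enc X} `{Enc Y} (f : X -> Y) :=
  exists c C d, forall x, exec c (rg [:: enc x]) (pol C d (esize x)) (rg [:: enc (f x)]).

Lemma PT_intro (X Y : Type) `{Enc X} `{Enc Y} (f : X -> Y) c p : poly p ->
  (forall x, exec c (rg [:: enc x]) (p (esize x)) (rg [:: enc (f x)])) -> PT f.
Proof. by move=> [C [d P]] H1; exists c, C, d => x; apply: exec_le (H1 x) (P _). Qed.

Lemma PT_ext (X Y : Type) `{Enc X} `{Enc Y} (f g : X -> Y) : PT g -> (forall x, f x = g x) -> PT f.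
Proof. by move=> [c [C [d P]]] e; exists c, C, d => x; rewrite e. Qed.

Lemma PT_size (X Y : Type) `{Enc X} `{Enc Y} (f : X -> Y) : PT f ->
  exists C d, forall x, esize (f x) <= pol C d (esize x).
Proof.
move=> [c [C [d P]]].
have [C' [d' H1]] : poly (fun n => n + pol C d n) by polyt.
exists C', d' => x; apply: leq_trans (H1 _).
have hs i : size (rg [:: enc x] i) <= esize x by rewrite /rg; case: i => [|i] /=; rewrite ?nth_nil.
exact: (exec_size (P x) hs 0).
Qed.

Lemma PT_comp (X Y Z : Type) `{Enc X} `{Enc Y} `{Enc Z} (f : X -> Y) (g : Y -> Z) :
  PT g -> PT f -> PT (fun x => g (f x)).
Proof.
move=> Pg Pf; have [C' [d' B]] := PT_size Pf; case: Pg Pf => [c [C [d P]]] [c1 [C1 [d1 P1]]].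
apply: (@PT_intro _ _ _ _ _ (Seq c1 c) (fun n => pol C1 d1 n + pol C d (pol C' d' n))); first by polyt.
by move=> x; apply: ex_seq (P1 x) (P _) _; rewrite leq_add2l pol_mono.
Qed.

Lemma PT_id (X : Type) `{Enc X} : PT (@id X).
Proof. by exists Skip, 0, 0 => x; exact: ex_skip. Qed.

Lemma rg3 (u : seq bool) : rg [:: u] = rg [:: u; [::]; [::]]. Proof. exact: (rg_pad [:: u] 2). Qed.
Lemma rg4 (u : seq bool) : rg [:: u] = rg [:: u; [::]; [::]; [::]]. Proof. exact: (rg_pad [:: u] 3). Qed.

(** A reversed copy of the input waits in register 1 while the program for [f] works from register 2
    upwards; then the result waits in register 0 while the program for [g] does. *)
Lemma PT_pair (X Y Z : Type) `{Enc X} `{Enc Y} `{Enc Z} (f : X -> Y) (g : X -> Z) :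
  PT f -> PT g -> PT (fun x => (f x, g x)).
Proof.
move=> Pf Pg; have [C' [d' B]] := PT_size Pf; have [C2 [d2 B2]] := PT_size Pg.
case: Pf Pg => [c1 [C1 [d1 P1]]] [c [C [d P]]].
apply: (@PT_intro _ _ _ _ _ (block [:: mv 0 1; mv2 id 1 0 2; mv 0 1; shift 2 c1; mv 2 0; mv 1 2; shift 2 c;
  mv 2 1; mv 1 2; mv 0 2; mv 2 1; mv 1 0])
  (fun n => 20 * n + 20 + (20 * pol C' d' n + 20 * pol C2 d2 n) + pol C1 d1 n + pol C d n)); first by polyt.
move=> x; apply: exec_le.
  rewrite rg3; apply: bl_mv => //=; apply: bl_mv2 => //=; rewrite map_id; apply: bl_mv => //=.
  rewrite !cats0 !revK; apply: (bl_shift (lo := [:: _; _]) (l := [:: _]) _ (P1 x)) => //=.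
  apply: bl_mv => //=; apply: bl_mv => //=; rewrite !cats0 !revK.
  apply: (bl_shift (lo := [:: _; _]) (l := [:: _]) _ (P x)) => //=.
  do 5 (apply: bl_mv => //=; rewrite ?cats0 ?revK ?cats0).
  by apply: ex_block0; rewrite [RHS]rg3.
have := B x; have := B2 x; rewrite /= !(cats0, size_rev, size_cat) /=; lia.
Qed.

Lemma PT_fst (X Y : Type) `{Enc X} `{Enc Y} : PT (@fst X Y).
Proof.
apply: (@PT_intro _ _ _ _ _ (block [:: mover X; clear 0; mv 1 0]) (fun n => (mover_time X + 4) * n + 2)).
  by polyt.
move=> [x y]; apply: exec_le.
  rewrite rg3 /=; apply: bl_mover; apply: bl_clear => /=; apply: bl_mv => //=; apply: ex_block0.
  by rewrite !cats0 revK rg3.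
by rewrite /= cats0 size_rev size_cat; lia.
Qed.

Lemma PT_snd (X Y : Type) `{Enc X} `{Enc Y} : PT (@snd X Y).
Proof.
apply: (@PT_intro _ _ _ _ _ (block [:: mover X; clear 1]) (fun n => (mover_time X + 4) * n + 2)).
  by polyt.
move=> [x y]; apply: exec_le.
  rewrite rg3 /=; apply: bl_mover; apply: bl_clear => /=; apply: ex_block0.
  by rewrite rg3.
by rewrite /= cats0 size_rev size_cat; lia.
Qed.

Definition pushes (i : nat) (v : seq bool) : seq cmd := rev [seq Push i b | b <- v].

Lemma bl_pushes i v L l t s : exec (block L) (rg (set_nth [::] l i (v ++ nth [::] l i))) t s ->
  exec (block (pushes i v ++ L)) (rg l) (size v + t) s.
Proof.
rewrite /pushes -map_rev; elim/last_ind: v l => [|v b IH] l H /=.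
  move: H; rewrite -rg_upd upd_id //.
rewrite rev_rcons size_rcons /=; apply: bl_push; apply: IH.
by move: H; rewrite nth_set_nth /= eqxx set_set_nth eqxx cat_rcons.
Qed.

Lemma PT_const (X Y : Type) `{Enc X} `{Enc Y} (y : Y) : PT (fun _ : X => y).
Proof.
apply: (@PT_intro _ _ _ _ _ (block (clear 0 :: pushes 0 (enc y) ++ [::]))
  (fun n => 2 * n + 1 + esize y)); first by polyt.
move=> x; apply: exec_le.
  apply: bl_clear => /=; apply: bl_pushes => /=; apply: ex_block0.
  by rewrite cats0.
by rewrite /=; lia.
Qed.

Lemma PT_S : PT S.
Proof.
apply: (@PT_intro _ _ _ _ _ (block [:: Push 0 true]) (fun n => 1)); first by polyt.
by move=> x; apply: exec_le; first by apply: bl_push; apply: ex_block0.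
Qed.

Lemma exec_seq_inv c d s t s' : exec (Seq c d) s t s' ->
  exists t1 s1 t2, [/\ exec c s t1 s1, exec d s1 t2 s' & t1 + t2 <= t].
Proof.
move e: (Seq c d) => cd H; case: H e => // c1 d1 s0 s1 s2 t1 t2 t0 H1 H2 le [-> ->].
by exists t1, s1, t2.
Qed.

Lemma bl_case i c0 cF cT L l t s b r : nth [::] l i = b :: r ->
  exec (block ((if b then cT else cF) :: L)) (rg (set_nth [::] l i r)) t s ->
  exec (block (Case i c0 cF cT :: L)) (rg l) (1 + t) s.
Proof.
move=> e /exec_seq_inv [t1 [s1 [t2 [H1 H2 le]]]].
apply: (@ex_seq _ _ _ s1 _ t1.+1 t2) => //.
by apply: (@ex_caseb _ _ _ _ b r _ t1) => //; rewrite rg_upd.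
Qed.

Lemma PT_pred : PT predn.
Proof.
apply: (@PT_intro _ _ _ _ _ (block [:: Case 0 Skip (Push 0 false) Skip]) (fun n => 2)); first by polyt.
case=> [|x]; apply: exec_le.
- by apply: bl_case => //=; apply: bl_push; apply: ex_block0.
- by [].
- by apply: bl_case => //=; apply: (bl_do (ex_skip _ 0)); apply: ex_block0.
- by [].
Qed.

Lemma PT_is0 : PT (fun n => n == 0).
Proof.
apply: (@PT_intro _ _ _ _ _ (block [:: Case 0 Skip (Push 0 true) (block [:: clear 0; Push 0 false])])
  (fun n => 2 * n + 10)); first by polyt.
case=> [|x]; apply: exec_le.
- by apply: bl_case => //=; apply: bl_push; apply: ex_block0.
- by [].
- apply: bl_case => //=; apply: bl_do; last by apply: ex_block0.
  by apply: bl_clear => /=; apply: bl_push; apply: ex_block0.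
- by rewrite /= size_enc_nat; lia.
Qed.

Lemma PT_if (X Y : Type) `{Enc X} `{Enc Y} (b : X -> bool) (f g : X -> Y) :
  PT b -> PT f -> PT g -> PT (fun x => if b x then f x else g x).
Proof.
move=> Pb Pf Pg.
have P : PT (fun p : bool * X => if p.1 then f p.2 else g p.2); last first.
  exact: (PT_comp P (PT_pair Pb PT_id)).
case: Pf Pg => [c1 [C1 [d1 P1]]] [c [C [d P]]].
apply: (@PT_intro _ _ _ _ _ (block [:: Case 0 Skip c c1]) (fun n => 1 + (pol C1 d1 n + pol C d n)));
  first by polyt.
move=> [[] x]; apply: exec_le.
- by apply: bl_case => //=; apply: bl_do (P1 x) _; apply: ex_block0.
- rewrite addn0 leq_add2l; apply: leq_trans (leq_addr _ _).
  by apply: pol_mono; rewrite /= leqnSn.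
- by apply: bl_case => //=; apply: bl_do (P x) _; apply: ex_block0.
- rewrite addn0 leq_add2l; apply: leq_trans (leq_addl _ _).
  by apply: pol_mono; rewrite /= leqnSn.
Qed.

Lemma PT_cons_pair (X : Type) `{Enc X} : PT (fun p : X * seq X => p.1 :: p.2).
Proof.
apply: (@PT_intro _ _ _ _ _ (block [:: mover X; Loop 0 (Push 2 true); mv 1 0; Push 0 false; mv 2 0; Push 0 true])
  (fun n => (mover_time X + 20) * n + 20)); first by polyt.
move=> [x s]; apply: exec_le.
  rewrite rg3 [enc _]/=; apply: bl_mover; rewrite [enc_seq _]enc_list.
  apply: (bl_tally (n := size s) (tl := false :: flatten (map enc s))) => //; first by rewrite /= enc_nat_cat.
  rewrite /= !cats0; apply: bl_mv => //=; apply: bl_push => /=; apply: bl_mv => //=; apply: bl_push => /=.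
  by apply: ex_block0; rewrite rg3 /enc_seq /= size_map rev_nseq revK /enc_nat -catA.
by rewrite /= /enc_seq size_map !(size_enc_nat, size_cat, size_rev, size_nseq) /=; nia.
Qed.

Lemma PT_size_seq (X : Type) `{Enc X} : PT (@size X).
Proof.
apply: (@PT_intro _ _ _ _ _ (block [:: mover nat; clear 0; mv 1 0]) (fun n => 20 * n + 20)); first by polyt.
move=> s; apply: exec_le.
  rewrite rg3 enc_list; apply: (bl_mover (X := nat)); apply: bl_clear => /=; apply: bl_mv => //=.
  by apply: ex_block0; rewrite !cats0 rg3 revK.
by rewrite enc_list /= !(cats0, size_enc_nat, size_rev, size_cat) /=; lia.
Qed.

Lemma PT_head (X : Type) `{Enc X} (x0 : X) : PT (head x0).
Proof.
apply: (@PT_intro _ _ _ _ _ (block [:: Case 0 Skip (block (pushes 0 (enc x0) ++ [::]))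
    (block [:: Loop 0 Skip; mover X; clear 0; mv 1 0])])
  (fun n => (mover_time X + 20) * n + 20 + esize x0)); first by polyt.
case=> [|x s]; apply: exec_le.
- apply: bl_case => //=; apply: bl_do; last by apply: ex_block0.
  by apply: bl_pushes; apply: ex_block0; rewrite /= cats0.
- by rewrite /=; lia.
- rewrite rg3 enc_cons; apply: bl_case => //=; apply: bl_do; last by apply: ex_block0.
  apply: (bl_droptally (n := size s) (tl := false :: enc x ++ flatten (map enc s))) => //=.
    by rewrite enc_nat_cat.
  apply: bl_mover; apply: bl_clear => /=; apply: bl_mv => //=; apply: ex_block0.
  by rewrite !cats0 rg3 revK.
- by rewrite enc_cons !(size_enc_nat, size_cat, size_rev, cats0) /=; nia.
Qed.

Lemma PT_behead (X : Type) `{Enc X} : PT (@behead X).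
Proof.
apply: (@PT_intro _ _ _ _ _ (block [:: Case 0 Skip (Push 0 false)
    (block [:: Loop 0 (Push 3 true); mover X; clear 1; Push 0 false; mv 3 0])])
  (fun n => (mover_time X + 20) * n + 20)); first by polyt.
case=> [|x s]; apply: exec_le.
- by apply: bl_case => //=; apply: bl_push; apply: ex_block0.
- by rewrite /=; lia.
- rewrite rg4 enc_cons; apply: bl_case => //=; apply: bl_do; last by apply: ex_block0.
  apply: (bl_tally (n := size s) (tl := false :: enc x ++ flatten (map enc s))) => //=.
    by rewrite enc_nat_cat.
  apply: bl_mover; apply: bl_clear => /=; apply: bl_push => /=; apply: bl_mv => //=; apply: ex_block0.
  by rewrite /= cats0 rg4 rev_nseq /enc_seq size_map enc_nat_cat.
- by rewrite enc_cons !(size_enc_nat, size_cat, size_rev, cats0, size_nseq) /=; nia.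
Qed.

(** Polynomial time of [f] alone would let the iterates grow exponentially; this is why their sizes
    are bounded by hypothesis. The counter stays in register 0, below the shifted program for
    [f]. *)
Lemma PT_iter (X S : Type) `{Enc X} `{Enc S} (n : X -> nat) (f : S -> S) (s0 : X -> S) p :
  poly p ->
  PT n -> PT s0 -> PT f ->
  (forall x i, i <= n x -> esize (iter i f (s0 x)) <= p (esize x)) ->
  PT (fun x => iter (n x) f (s0 x)).
Proof.
move=> [C [d Pp]] Pn Ps Pf B';
have {B'} B x i : i <= n x -> esize (iter i f (s0 x)) <= pol C d (esize x).
  by move=> le; apply: leq_trans (B' x i le) (Pp _).
 have [Cn [dn Bn]] := PT_size Pn.
case: (PT_pair Pn Ps) Pf => [c1 [C1 [d1 P1]]] [c [Cf [df P]]].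
apply: (@PT_intro _ _ _ _ _ (block [:: c1; Loop 0 (Push 1 true); mv 0 2; mv 1 0; mv 2 1;
   Loop 0 (shift 1 c); mv 1 2; mv 2 0])
  (fun m => pol C1 d1 m + 20 + 20 * pol C d m +
    10 * (pol Cn dn m * (pol Cf df (pol C d m) + 10)))); first by polyt.
move=> x.
pose T := pol Cf df (pol C d (size (@enc X H x))).
have L k : k <= n x -> exec (Loop 0 (shift 1 c))
    (rg [:: nseq k true; enc (iter (n x - k) f (s0 x)); [::]])
    (k * T.+1 + 1) (rg [:: [::]; enc (iter (n x) f (s0 x)); [::]]).
  elim: k => [|k IH] kn; first by rewrite subn0; apply: ex_loop0.
  apply: (ex_loopT (r := nseq k true) (t1 := T) _ _ (IH (ltnW kn))) => //; last lia.
  rewrite rg_upd /= -[n x - k]prednK ?subn_gt0 // -subnS iterS.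
  have e u : rg [:: nseq k true; u; [::]] = under [:: nseq k true] (rg [:: u]).
    by rewrite under_rg (rg_pad ([:: nseq k true] ++ [:: u]) 1).
  rewrite !e; apply: exec_le (exec_shift [:: nseq k true] (P _)) _.
  by rewrite pol_mono // B // leq_subr.
apply: exec_le.
  apply: bl_do (P1 x) _; rewrite rg3 [enc _]/= enc_nat_cat.
  apply: (bl_tally (n := n x) (tl := false :: enc (s0 x))) => //=.
  rewrite !cats0; apply: bl_mv => //=; apply: bl_mv => //=; rewrite !cats0; apply: bl_mv => //=.
  rewrite !cats0 rev_nseq revK; apply: bl_do; first by have := L _ (leqnn _); rewrite subnn; exact.
  apply: bl_mv => //=; rewrite !cats0; apply: bl_mv => //=; rewrite !cats0 revK.
  by apply: ex_block0; rewrite [RHS]rg3.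
rewrite /= !size_rev !size_nseq -/T.
have := Bn x; rewrite size_enc_nat => b1.
have /= := B x 0 (leq0n _) => b2; have := B x _ (leqnn (n x)) => b3.
by move: b1 b2 b3; move: (pol C d _) (pol Cn dn _) (pol C1 d1 _) => p1 p2 p3; nia.
Qed.

(** * Arithmetic and list operations in polynomial time *)

Section Derived.
Context {X : Type} {HX : Enc X}.

Lemma PT_fst_of (A B : Type) `{Enc A} `{Enc B} (f : X -> A * B) : PT f -> PT (fun x => (f x).1).
Proof. exact: (PT_comp PT_fst). Qed.
Lemma PT_snd_of (A B : Type) `{Enc A} `{Enc B} (f : X -> A * B) : PT f -> PT (fun x => (f x).2).
Proof. exact: (PT_comp PT_snd). Qed.
Lemma PT_S_of (f : X -> nat) : PT f -> PT (fun x => (f x).+1).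
Proof. exact: (PT_comp PT_S). Qed.
Lemma PT_is0_of (f : X -> nat) : PT f -> PT (fun x => f x == 0).
Proof. exact: (PT_comp PT_is0). Qed.
Lemma PT_cons (A : Type) `{Enc A} (f : X -> A) (g : X -> seq A) :
  PT f -> PT g -> PT (fun x => f x :: g x).
Proof. by move=> Pf Pg; exact: (PT_comp PT_cons_pair (PT_pair Pf Pg)). Qed.
Lemma PT_size_of (A : Type) `{Enc A} (f : X -> seq A) : PT f -> PT (fun x => size (f x)).
Proof. exact: (PT_comp PT_size_seq). Qed.
Lemma PT_head_of (A : Type) `{Enc A} a (f : X -> seq A) : PT f -> PT (fun x => head a (f x)).
Proof. exact: (PT_comp (PT_head a)). Qed.
Lemma PT_behead_of (A : Type) `{Enc A} (f : X -> seq A) : PT f -> PT (fun x => behead (f x)).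
Proof. exact: (PT_comp PT_behead). Qed.

(** The parameter [x] of the iterated function is carried along as a component of the state. *)
Lemma PT_iter_env (S : Type) `{Enc S} (n : X -> nat) (f : X -> S -> S) (s0 : X -> S) p :
  poly p -> PT n -> PT s0 -> PT (fun q : X * S => f q.1 q.2) ->
  (forall x i, i <= n x -> esize (iter i (f x) (s0 x)) <= p (esize x)) ->
  PT (fun x => iter (n x) (f x) (s0 x)).
Proof.
move=> Pp Pn Ps Pf B.
have e x i : iter i (fun q : X * S => (q.1, f q.1 q.2)) (x, s0 x) = (x, iter i (f x) (s0 x)).
  by elim: i => //= i ->.
have P : PT (fun x => iter (n x) (fun q : X * S => (q.1, f q.1 q.2)) (x, s0 x)).
  apply: (@PT_iter _ _ _ _ _ _ _ (fun m => m + p m)) => //; first by apply: poly_add => //; exact: poly_id.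
  - by apply: PT_pair => //; exact: PT_id.
  - by apply: PT_pair => //; exact: PT_fst.
  - by move=> x i le; rewrite e /= size_cat leq_add2l B.
by apply: PT_ext (PT_snd_of P) _ => x; rewrite e.
Qed.

Lemma PT_addn (f g : X -> nat) : PT f -> PT g -> PT (fun x => f x + g x).
Proof.
move=> Pf Pg; have [C [d B]] := PT_size Pf; have [C' [d' B']] := PT_size Pg.
have P : PT (fun x => iter (f x) S (g x)).
  apply: (@PT_iter _ _ _ _ _ _ _ (fun m => pol C d m + pol C' d' m)) => //; first by polyt.
    exact: PT_S.
  move=> x i le; have := B x; have := B' x; rewrite /= !size_enc_nat.
  by rewrite (_ : iter i S (g x) = i + g x); [lia|elim: (i) => //= j ->].
by apply: PT_ext P _ => x; elim: (f x) => //= n <-.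
Qed.

End Derived.

Lemma PT_app2 (X A B C : Type) `{Enc X} `{Enc A} `{Enc B} `{Enc C} (f : A -> B -> C)
    (g : X -> A) (h : X -> B) :
  PT (fun p : A * B => f p.1 p.2) -> PT g -> PT h -> PT (fun x => f (g x) (h x)).
Proof. by move=> Pf Pg Ph; apply: (PT_comp Pf (PT_pair Pg Ph)). Qed.

Lemma PT_app3 (X A B C D : Type) `{Enc X} `{Enc A} `{Enc B} `{Enc C} `{Enc D}
    (f : A -> B -> C -> D) (g : X -> A) (h : X -> B) (k : X -> C) :
  PT (fun p : A * B * C => f p.1.1 p.1.2 p.2) -> PT g -> PT h -> PT k ->
  PT (fun x => f (g x) (h x) (k x)).
Proof. by move=> Pf Pg Ph Pk; apply: (PT_comp Pf (PT_pair (PT_pair Pg Ph) Pk)). Qed.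

Ltac pt_known :=
  match goal with
  | H : PT _ |- _ => exact: H
  | H : PT _ |- _ => apply: (PT_app2 H)
  | H : PT _ |- _ => apply: (PT_app3 H)
  | H : PT _ |- _ => apply: (PT_comp H)
  end.

Ltac pt1 :=
  match goal with
  | |- PT (fun x => x) => exact: PT_id
  | |- PT (fun _ => ?c) => exact: PT_const
  | |- PT (fun x => fst (@?f x)) => apply: PT_fst_of
  | |- PT (fun x => snd (@?f x)) => apply: PT_snd_of
  | |- PT (fun x => pair (@?f x) (@?g x)) => apply: PT_pair
  | |- PT (fun x => S (@?f x)) => apply: PT_S_of
  | |- PT (fun x => cons (@?f x) (@?g x)) => apply: PT_cons
  | |- PT (fun x => addn (@?f x) (@?g x)) => apply: PT_addn
  | |- PT (fun x => size (@?f x)) => apply: PT_size_of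
  | |- PT (fun x => head _ (@?f x)) => apply: PT_head_of
  | |- PT (fun x => behead (@?f x)) => apply: PT_behead_of
  | |- PT (@size _) => exact: PT_size_seq
  | |- PT S => exact: PT_S
  | |- PT id => exact: PT_id
  | |- PT fst => exact: PT_fst
  | |- PT snd => exact: PT_snd
  | _ => pt_known
  | |- PT ?f => lazymatch f with (fun _ => _) => fail | _ => change (PT (fun x => f x)) end
  | _ => apply: PT_if
  end.
Ltac pt := repeat pt1; try done.

Lemma PT_muln (X : Type) `{Enc X} (f g : X -> nat) : PT f -> PT g -> PT (fun x => f x * g x).
Proof.
move=> Pf Pg; have [C [d B]] := PT_size Pf; have [C' [d' B']] := PT_size Pg.
have P : PT (fun x => iter (f x) (addn (g x)) 0).
  apply: (@PT_iter_env _ _ _ _ _ _ _ (fun m => pol C d m * pol C' d' m + 1)); [by polyt|by pt|by pt|by pt|].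
  move=> x i le; have := B x; have := B' x; rewrite /= !size_enc_nat.
  by rewrite (_ : iter i (addn (g x)) 0 = i * g x); [nia|elim: (i) => //= j ->].
by apply: PT_ext P _ => x; elim: (f x) => //= n <-; rewrite mulSn.
Qed.

Lemma PT_subn (X : Type) `{Enc X} (f g : X -> nat) : PT f -> PT g -> PT (fun x => f x - g x).
Proof.
move=> Pf Pg; have [C [d B]] := PT_size Pf.
have P : PT (fun x => iter (g x) predn (f x)).
  apply: (@PT_iter _ _ _ _ _ _ _ (pol C d)); [exact: poly_pol|by pt|by pt|exact: PT_pred|].
  move=> x i le; have := B x; rewrite /= !size_enc_nat.
  by rewrite (_ : iter i predn (f x) = f x - i); [lia|elim: (i) => /= [|j ->]; lia].
by apply: PT_ext P _ => x; elim: (g x) => [|n /= <-]; rewrite ?subn0 ?subnS.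
Qed.

Lemma PT_leq (X : Type) `{Enc X} (f g : X -> nat) : PT f -> PT g -> PT (fun x => f x <= g x).
Proof. by move=> Pf Pg; apply: PT_is0_of; apply: PT_subn. Qed.

Lemma PT_andb (X : Type) `{Enc X} (f g : X -> bool) : PT f -> PT g -> PT (fun x => f x && g x).
Proof. by move=> Pf Pg; apply: PT_if => //; exact: PT_const. Qed.
Lemma PT_orb (X : Type) `{Enc X} (f g : X -> bool) : PT f -> PT g -> PT (fun x => f x || g x).
Proof. by move=> Pf Pg; apply: PT_if => //; exact: PT_const. Qed.
Lemma PT_negb (X : Type) `{Enc X} (f : X -> bool) : PT f -> PT (fun x => ~~ f x).
Proof. by move=> Pf; apply: PT_if => //; exact: PT_const. Qed.
Lemma PT_eqn (X : Type) `{Enc X} (f g : X -> nat) : PT f -> PT g -> PT (fun x => f x == g x).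
Proof.
move=> Pf Pg; apply: (@PT_ext _ _ _ _ _ (fun x => (f x <= g x) && (g x <= f x))).
  by apply: PT_andb; apply: PT_leq.
by move=> x; rewrite eqn_leq.
Qed.
Lemma PT_eqb (X : Type) `{Enc X} (f g : X -> bool) : PT f -> PT g -> PT (fun x => f x == g x).
Proof.
move=> Pf Pg; apply: (@PT_ext _ _ _ _ _ (fun x => if f x then g x else ~~ g x)).
  by apply: PT_if => //; apply: PT_negb.
by move=> x; case: (f x) (g x) => [] [].
Qed.

Lemma PT_expn (X : Type) `{Enc X} (f : X -> nat) n : PT f -> PT (fun x => f x ^ n).
Proof.
move=> Pf; elim: n => [|n IH]; first exact: PT_const.
apply: (@PT_ext _ _ _ _ _ (fun x => f x * f x ^ n)); first exact: PT_muln.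
by move=> x; rewrite expnS.
Qed.

Section Lists.
Context {A : Type} {HA : Enc A}.
Implicit Type l : seq A.

Lemma esize_seq l : esize l = (size l).+1 + sumn [seq esize a | a <- l].
Proof.
rewrite enc_list size_cat size_enc_nat; congr addn.
by elim: l => //= a l IH; rewrite size_cat IH.
Qed.
Lemma size_le_esize l : size l < esize l. Proof. by rewrite esize_seq; lia. Qed.
Lemma esize_cat l l' : esize (l ++ l') <= esize l + esize l'.
Proof. by rewrite !esize_seq map_cat sumn_cat size_cat; lia. Qed.
Lemma esize_catl l l' : esize l <= esize (l ++ l').
Proof. by rewrite !esize_seq map_cat sumn_cat size_cat; lia. Qed.
Lemma esize_catr l l' : esize l' <= esize (l ++ l').
Proof. by rewrite !esize_seq map_cat sumn_cat size_cat; lia. Qed.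
Lemma esize_take n l : esize (take n l) <= esize l.
Proof. by rewrite -{2}(cat_take_drop n l) esize_catl. Qed.
Lemma esize_drop n l : esize (drop n l) <= esize l.
Proof. by rewrite -{2}(cat_take_drop n l) esize_catr. Qed.
Lemma esize_rev l : esize (rev l) = esize l.
Proof. by rewrite !esize_seq size_rev map_rev sumn_rev. Qed.
Lemma esize_filter p l : esize (filter p l) <= esize l.
Proof.
rewrite !esize_seq; elim: l => //= a l IH; case: (p a) => /=; lia.
Qed.
Lemma esize_bound l m : (forall n, n < size l -> esize (nth (dflt A) l n) <= m) ->
  esize l <= (size l).+1 * m.+1.
Proof.
move=> B; have : sumn [seq esize a | a <- l] <= size l * m; last by rewrite esize_seq; nia.
elim: l B => //= a l IH B; rewrite mulSn leq_add //; first exact: (B 0).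
by apply: IH => n; exact: (B n.+1).
Qed.
Lemma esize_mem l n : n < size l -> esize (nth (dflt A) l n) <= esize l.
Proof.
move=> lt; rewrite esize_seq; elim: l n lt => //= a l IH [_|n /IH] /=; lia.
Qed.
End Lists.

(** The iterated state pairs the unread suffix with the accumulator, so only the accumulators of
    prefixes need a size bound. *)
Lemma PT_foldl (X A S : Type) `{Enc X} `{HA : Enc A} `{Enc S} (f : X -> S -> A -> S) (s0 : X -> S) (l : X -> seq A) p :
  poly p -> PT s0 -> PT l -> PT (fun q : X * S * A => f q.1.1 q.1.2 q.2) ->
  (forall x i, i <= size (l x) -> esize (foldl (f x) (s0 x) (take i (l x))) <= p (esize x)) ->
  PT (fun x => foldl (f x) (s0 x) (l x)).
Proof.
move=> Pp Ps Pl Pf B; have [C [d Bl]] := PT_size Pl.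
pose step x (q : seq A * S) := (behead q.1, f x q.2 (head (@dflt A HA) q.1)).
have e x i : i <= size (l x) -> iter i (step x) (l x, s0 x) =
    (drop i (l x), foldl (f x) (s0 x) (take i (l x))).
  elim: i => [|i IH] le; first by rewrite /= drop0 take0.
  rewrite iterS (IH (ltnW le)) /step /= -drop1 drop_drop add1n; congr pair.
  by rewrite (take_nth (dflt A) le) foldl_rcons head_drop.
have P : PT (fun x => iter (size (l x)) (step x) (l x, s0 x)).
  apply: (@PT_iter_env _ _ _ _ _ _ _ (fun m => pol C d m + p m)); [by apply: poly_add => //; polyt|by pt|by pt|by rewrite /step; pt|].
  move=> x i le; rewrite e // [enc _]/= size_cat leq_add ?B //.
  exact: leq_trans (esize_drop _ _) (Bl x).
by apply: PT_ext (PT_snd_of P) _ => x; rewrite e // take_size.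
Qed.

Lemma PT_rev (X A : Type) `{Enc X} `{Enc A} (l : X -> seq A) : PT l -> PT (fun x => rev (l x)).
Proof.
move=> Pl; have [C [d Bl]] := PT_size Pl.
have e (k : seq A) : foldl (fun (s : seq A) a => a :: s) [::] k = rev k.
  by elim/last_ind: k => // k a IH; rewrite foldl_rcons IH rev_rcons.
apply: (@PT_ext _ _ _ _ _ (fun x => foldl (fun s a => a :: s) [::] (l x))); last by move=> x; rewrite e.
apply: (@PT_foldl _ _ _ _ _ _ _ _ _ (pol C d)); [exact: poly_pol|by pt|by pt|by pt|].
by move=> x i le; rewrite e esize_rev; apply: leq_trans (esize_take _ _) (Bl x).
Qed.

Lemma PT_map (X A B : Type) `{Enc X} `{Enc A} `{Enc B} (f : X -> A -> B) (l : X -> seq A) :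
  PT (fun q : X * A => f q.1 q.2) -> PT l -> PT (fun x => map (f x) (l x)).
Proof.
move=> Pf Pl; have [C [d Bl]] := PT_size Pl; have [C' [d' Bf]] := PT_size Pf.
have e x (k : seq A) : foldl (fun (s : seq B) a => f x a :: s) [::] k = rev (map (f x) k).
  by elim/last_ind: k => // k a IH; rewrite foldl_rcons IH map_rcons rev_rcons.
have P : PT (fun x => foldl (fun s a => f x a :: s) [::] (l x)).
  apply: (@PT_foldl _ _ _ _ _ _ (fun x s a => f x a :: s) _ _
    (fun m => (pol C d m).+1 * (pol C' d' (m + pol C d m)).+1)); [by polyt|by pt|by pt|by pt|].
  move=> x i le; rewrite e esize_rev.
  have le1 : size (take i (l x)) <= pol C d (esize x).
    by apply: leq_trans (Bl x); apply: leq_trans (ltnW (size_le_esize _)) (esize_take _ _).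
  apply: leq_trans (esize_bound (m := pol C' d' (esize x + pol C d (esize x))) _) _; last first.
    by rewrite size_map leq_mul.
  move=> n; rewrite size_map => lt; rewrite (nth_map (dflt A)) //.
  apply: leq_trans (Bf (x, _)) _; apply: pol_mono; rewrite [enc _]/= size_cat leq_add2l.
  apply: leq_trans (Bl x); apply: leq_trans (esize_mem lt) (esize_take _ _).
by apply: PT_ext (PT_rev P) _ => x; rewrite e revK.
Qed.

Lemma PT_filter (X A : Type) `{Enc X} `{Enc A} (p : X -> A -> bool) (l : X -> seq A) :
  PT (fun q : X * A => p q.1 q.2) -> PT l -> PT (fun x => filter (p x) (l x)).
Proof.
move=> Pf Pl; have [C [d Bl]] := PT_size Pl.
have e x (k : seq A) : foldl (fun (s : seq A) a => if p x a then a :: s else s) [::] k = rev (filter (p x) k).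
  by elim/last_ind: k => // k a IH; rewrite foldl_rcons IH filter_rcons; case: (p x a); rewrite ?rev_rcons.
have P : PT (fun x => foldl (fun s a => if p x a then a :: s else s) [::] (l x)).
  apply: (@PT_foldl _ _ _ _ _ _ (fun x s a => if p x a then a :: s else s) _ _ (pol C d));
    [exact: poly_pol|by pt|by pt|by pt|].
  move=> x i le; rewrite e esize_rev.
  by apply: leq_trans (Bl x); apply: leq_trans (esize_filter _ _) (esize_take _ _).
by apply: PT_ext (PT_rev P) _ => x; rewrite e revK.
Qed.

Lemma PT_count (X A : Type) `{Enc X} `{Enc A} (p : X -> A -> bool) (l : X -> seq A) :
  PT (fun q : X * A => p q.1 q.2) -> PT l -> PT (fun x => count (p x) (l x)).
Proof. by move=> Pp Pl; apply: PT_ext (PT_size_of (PT_filter Pp Pl)) _ => x; rewrite size_filter. Qed.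

Lemma PT_has (X A : Type) `{Enc X} `{Enc A} (p : X -> A -> bool) (l : X -> seq A) :
  PT (fun q : X * A => p q.1 q.2) -> PT l -> PT (fun x => has (p x) (l x)).
Proof.
move=> Pp Pl; apply: (@PT_ext _ _ _ _ _ (fun x => 0 < count (p x) (l x))); last by move=> x; rewrite has_count.
by apply: PT_leq; [exact: PT_const|exact: PT_count].
Qed.

Lemma PT_all (X A : Type) `{Enc X} `{Enc A} (p : X -> A -> bool) (l : X -> seq A) :
  PT (fun q : X * A => p q.1 q.2) -> PT l -> PT (fun x => all (p x) (l x)).
Proof.
move=> Pp Pl; apply: (@PT_ext _ _ _ _ _ (fun x => count (p x) (l x) == size (l x))); last by move=> x; rewrite all_count.
by apply: PT_eqn; [exact: PT_count|exact: PT_size_of].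
Qed.

Lemma PT_cat (X A : Type) `{Enc X} `{Enc A} (k l : X -> seq A) : PT k -> PT l -> PT (fun x => k x ++ l x).
Proof.
move=> Pk Pl; have [C [d Bl]] := PT_size Pl; have [C' [d' Bk]] := PT_size Pk.
have e (q q' : seq A) : foldl (fun (s : seq A) a => a :: s) q q' = rev q' ++ q.
  by elim/last_ind: q' => // q' a IH; rewrite foldl_rcons IH rev_rcons.
have Pr := PT_rev Pk.
apply: (@PT_ext _ _ _ _ _ (fun x => foldl (fun s a => a :: s) (l x) (rev (k x)))); last first.
  by move=> x; rewrite e revK.
apply: (@PT_foldl _ _ _ _ _ _ _ _ _ (fun m => pol C' d' m + pol C d m)); [by polyt|by []|by []|by pt|].
move=> x i le; rewrite e; apply: leq_trans (esize_cat _ _) _; rewrite leq_add //.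
by rewrite esize_rev; apply: leq_trans (esize_take _ _) _; rewrite esize_rev.
Qed.

Lemma esize_flatten (A : Type) `{Enc A} (l : seq (seq A)) : esize (flatten l) <= esize l.
Proof.
elim: l => // k l IH; apply: leq_trans (esize_cat _ _) _.
by move: IH; rewrite [esize (flatten _)]esize_seq [esize l]esize_seq [esize (k :: l)]esize_seq /=; lia.
Qed.

Lemma PT_flatten (X A : Type) `{Enc X} `{Enc A} (l : X -> seq (seq A)) : PT l -> PT (fun x => flatten (l x)).
Proof.
move=> Pl; have [C [d Bl]] := PT_size Pl.
have e (k : seq (seq A)) : foldl cat [::] k = flatten k.
  by elim/last_ind: k => // k a IH; rewrite foldl_rcons IH flatten_rcons.
apply: (@PT_ext _ _ _ _ _ (fun x => foldl cat [::] (l x))); last by move=> x; rewrite e.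
apply: (@PT_foldl _ _ _ _ _ _ _ _ _ (pol C d)); [exact: poly_pol|by pt|by pt|by apply: PT_cat; pt|].
by move=> x i le; rewrite e; apply: leq_trans (esize_flatten _) _; apply: leq_trans (esize_take _ _) (Bl x).
Qed.

Lemma PT_iota (X : Type) `{Enc X} (n : X -> nat) : PT n -> PT (fun x => iota 0 (n x)).
Proof.
move=> Pn; have [C [d Bn]] := PT_size Pn.
have e i : iter i (fun s => size s :: s) [::] = rev (iota 0 i).
  by elim: i => // i IH; rewrite iterS IH size_rev size_iota -[in RHS]addn1 iotaD rev_cat.
have P : PT (fun x => iter (n x) (fun s => size s :: s) [::]).
  apply: (@PT_iter _ _ _ _ _ _ _ (fun m => (pol C d m + 1) * (pol C d m + 1)));
    [by polyt|by pt|by pt|by pt|].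
  move=> x i le; rewrite e esize_rev; apply: leq_trans (esize_bound (m := i) _) _.
    by rewrite size_iota => k lt; rewrite nth_iota // /= size_enc_nat.
  have := Bn x; rewrite size_iota /= size_enc_nat; nia.
by apply: PT_ext (PT_rev P) _ => x; rewrite e revK.
Qed.

Lemma PT_nth (X A : Type) `{Enc X} `{Enc A} a (l : X -> seq A) (n : X -> nat) :
  PT l -> PT n -> PT (fun x => nth a (l x) (n x)).
Proof.
move=> Pl Pn; have [C [d Bl]] := PT_size Pl.
have e i (k : seq A) : iter i behead k = drop i k.
  by elim: i => [|i IH]; rewrite ?drop0 //= IH -drop1 drop_drop add1n.
apply: (@PT_ext _ _ _ _ _ (fun x => head a (iter (n x) behead (l x)))); last first.
  by move=> x; rewrite e head_drop.
apply: PT_head_of; apply: (@PT_iter _ _ _ _ _ _ _ (pol C d)); [exact: poly_pol|by []|by []|exact: PT_behead|].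
by move=> x i le; rewrite e; apply: leq_trans (esize_drop _ _) (Bl x).
Qed.

(** The quotient is the number of [i < f x] with [i.+1 * g x <= f x]. *)
Lemma PT_divn (X : Type) `{Enc X} (f g : X -> nat) : PT f -> PT g -> PT (fun x => f x %/ g x).
Proof.
move=> Pf Pg; apply: (@PT_ext _ _ _ _ _
  (fun x => if g x == 0 then 0 else count (fun i => i.+1 * g x <= f x) (iota 0 (f x)))).
  apply: PT_if; [exact: PT_is0_of|exact: PT_const|].
  apply: PT_count; [|exact: PT_iota].
  by apply: PT_leq; [apply: PT_muln|]; pt.
move=> x; case: eqP => [->|/eqP g0]; first by rewrite divn0.
rewrite -lt0n in g0; rewrite (eq_count (a2 := fun i => i < f x %/ g x)); last first.
  by move=> i /=; rewrite leq_divRL.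
have le : f x %/ g x <= f x by rewrite leq_div.
rewrite -[X in iota 0 X](subnKC le) iotaD count_cat (eq_in_count (a2 := predT)); last first.
  by move=> i; rewrite mem_iota /=; lia.
rewrite count_predT size_iota (eq_in_count (a2 := pred0)) ?count_pred0 ?addn0 //.
by move=> i; rewrite mem_iota /=; lia.
Qed.

(** * The kernelization algorithm *)

Notation lit := (nat * bool)%type.
Notation clause := (seq lit).

Definition mem_lit (C : clause) v s := has (fun l => (l.1 == v) && (l.2 == s)) C.
Definition touches (C : clause) v := has (fun l => l.1 == v) C.
Definition has_neg (C : clause) := has (fun l => ~~ l.2) C.
Definition memn (T : seq nat) v := has (fun u => u == v) T.

Definition num_neg (cls : seq clause) := count has_neg cls.
Definition deg_neg cls v := count (fun C => has_neg C && touches C v) cls.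
Definition deg_pos cls v := count (fun C => ~~ has_neg C && touches C v) cls.
Definition deg_all cls v := count (fun C => touches C v) cls.

Definition argmin (sc : nat -> nat) l := head 0 [seq v <- l | all (fun u => sc v <= sc u) l].
Definition prune_step t (cand : seq nat -> seq nat) sc W :=
  if size W <= t then W else [seq u <- W | ~~ (u == argmin sc (cand W))].
(** Starting from at most [n] entries, [n] rounds suffice, since each round above the target size
    removes one. *)
Definition prune t cand sc n W := iter n (prune_step t cand sc) W.

(** A clause may contain both [v] and its negation, so an occurring variable shows one of three sign
    patterns. *)
Definition pattern_class (C : clause) (p q : bool) W :=
  [seq v <- W | (mem_lit C v true == p) && (mem_lit C v false == q)].
Definition refinements (cls : seq clause) th W :=
  [seq W' <- [seq pattern_class C true false W | C <- cls] ++
             [seq pattern_class C false true W | C <- cls] ++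
             [seq pattern_class C true true W | C <- cls]
          | (th < size W') && (size W' < size W)].
(* Shrinks [W] along clauses on which many of its members show the same signs.  When this
   stops with [r' + 1] levels left, no further clause is shared by more than [th r'] of them. *)
Fixpoint core (cls : seq clause) (th : nat -> nat) r W :=
  if r is r'.+1 then
    if size (refinements cls (th r') W) == 0 then W
    else core cls th r' (head [::] (refinements cls (th r') W))
  else W.

Fixpoint seqs_upto (r : nat) (al : seq nat) : seq (seq nat) :=
  if r is r'.+1 then [::] :: flatten [seq [seq v :: Y | v <- al] | Y <- seqs_upto r' al]
  else [:: [::]].

Definition value (cls : seq clause) (Y : seq nat) :=
  count (fun C => has (fun l => memn Y l.1 == l.2) C) cls.

(* The literal (p, s) of the reduced clause stands for the p-th selected variable. *)
Definition reduced_clause (T : seq nat) (C : clause) : clause :=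
  [seq (p, true) | p <- [seq p <- iota 0 (size T) | mem_lit C (nth 0 T p) true]] ++
  [seq (p, false) | p <- [seq p <- iota 0 (size T) | mem_lit C (nth 0 T p) false]].
Definition neg_outside (T : seq nat) (C : clause) := has (fun l => ~~ l.2 && ~~ memn T l.1) C.
(** A surviving clause whose reduction is empty has only positive unselected literals; it is false
    for every solution inside [T] and is dropped. *)
Definition reduced (T : seq nat) (cls : seq clause) : seq clause :=
  [seq c <- [seq reduced_clause T C | C <- [seq C <- cls | ~~ neg_outside T C]] | 0 < size c].

Section Kernel.
Variables (a b E K0 : nat).

(* [E] stands for [1 / eps] up to a constant, and below [K0] the optimum is found by
   exhaustive search, polynomial because [K0] depends only on [a], [b] and [eps]. *)
Definition opt_bound k := b * k * E * E.
(** The first condition makes [card_dense] applicable. A variable failing it meets fewer than [b]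
    clauses with negative literals, which is negligible once the optimum reaches [opt_bound k]. *)
Definition heavy cls k v := (b <= deg_neg cls v) && (num_neg cls <= k * E * deg_neg cls v).
(** One more than the number of variables that can each meet a [1 / (k * E * E)] fraction of a fixed
    clause set in at least [b] clauses. *)
Definition pos_quota k := a * opt_bound k ^ b + 1.
(** The factor 6 is three sign patterns times the [2 * opt] clauses that a swap has to avoid; the
    added 1 leaves members to choose from. *)
Definition core_quota k r := a * (6 * opt_bound k + 1) ^ r.

Definition select_pos n cls k :=
  prune (pos_quota k) id (deg_pos cls) n [seq v <- iota 0 n | ~~ heavy cls k v].
Definition select_core n cls k :=
  prune (core_quota k b) (core cls (core_quota k) b) (deg_all cls) n (iota 0 n).
Definition select_large n cls k :=
  [seq v <- iota 0 n | [|| heavy cls k v, memn (select_pos n cls k) v | memn (select_core n cls k) v]].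

Definition small_sets n k := [seq Y <- seqs_upto K0 (iota 0 n) | size Y <= k].
Definition best_set n cls k :=
  head [::] [seq Y <- small_sets n k | all (fun Y' => value cls Y' <= value cls Y) (small_sets n k)].
Definition select n cls k :=
  if K0 <= k then select_large n cls k else [seq v <- iota 0 n | memn (best_set n cls k) v].

Definition small_clause m (c : clause) := count (fun p => touches c p) (iota 0 m) < a.
(* Keeps every [s]-th copy of each small clause, so that multiplicities are divided by [s]
   and rounded down. *)
Definition sample m s (L : seq clause) :=
  [seq nth [::] L j | j <- [seq j <- iota 0 (size L) | small_clause m (nth [::] L j) &&
     (s %| (count (fun i => nth [::] L i == nth [::] L j) (iota 0 j)).+1)]].
(** There are at most [(2 * n1) ^ (2 * a)] distinct small clauses. One more factor [n1] is needed
    because the optimum is only known to be a [1 / n1] fraction of the number of clauses. *)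
Definition clause_quota n1 := 2 * E * b * (2 * n1) ^ (2 * a + 1).
Definition scale T cls := size (reduced T cls) %/ clause_quota (size T).+1.
Definition sparsified T cls :=
  if scale T cls <= 1 then reduced T cls else sample (size T) (scale T cls) (reduced T cls).
(* Clauses satisfied by an unselected variable are dropped, which shifts all values by the
   same amount; if nothing else remains, the clause [~ w] on a fresh variable [w] keeps the
   optimum positive, as an arbitrarily large [beta] must not be allowed. *)
Definition final_clauses T cls :=
  if size (sparsified T cls) == 0 then
    if has (neg_outside T) cls then [:: [:: (size T, false)]] else [::]
  else sparsified T cls.

(** The successor makes room for the fresh variable, whose index is the number of selected ones;
    [lift_of] ignores it. *)
Definition kernel_of (x : nat * seq clause * nat) : nat * seq clause :=
  ((size (select x.1.1 x.1.2 x.2)).+1, final_clauses (select x.1.1 x.1.2 x.2) x.1.2).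
Definition lift_of (x : (nat * seq clause * nat) * seq bool) : seq bool :=
  [seq has (fun p => (nth 0 (select x.1.1.1 x.1.1.2 x.1.2) p == i) && nth false x.2 p)
           (iota 0 (size (select x.1.1.1 x.1.1.2 x.1.2))) | i <- iota 0 x.1.1.1].

End Kernel.

(** * Polynomial running time of the kernelization *)

Lemma PT_eqclause (X : Type) `{Enc X} (f g : X -> clause) : PT f -> PT g -> PT (fun x => f x == g x).
Proof.
move=> Pf Pg; apply: (@PT_ext _ _ _ _ _ (fun x => (size (f x) == size (g x)) &&
  all (fun p => ((nth (0, false) (f x) p).1 == (nth (0, false) (g x) p).1) &&
                ((nth (0, false) (f x) p).2 == (nth (0, false) (g x) p).2)) (iota 0 (size (f x))))).
  apply: PT_andb; first by apply: PT_eqn; pt.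
  apply: PT_all; last by apply: PT_iota; pt.
  by apply: PT_andb; [apply: PT_eqn|apply: PT_eqb]; [apply: PT_fst_of|apply: PT_fst_of|apply: PT_snd_of|apply: PT_snd_of]; apply: PT_nth; pt.
move=> x; apply/eqP/andP => [->|[/eqP es /allP H1]].
  by split=> //; apply/allP => p _; rewrite !eqxx.
apply: (@eq_from_nth _ (0, false)) => // p lt.
have /H1 : p \in iota 0 (size (f x)) by rewrite mem_iota.
by case: (nth _ _ p) => u v; case: (nth _ _ p) => u' v' /= /andP [/eqP -> /eqP ->].
Qed.

Ltac pt2 :=
  match goal with
  | |- PT (fun _ => ?c) => exact: PT_const
  | |- PT (fun x => muln (@?f x) (@?g x)) => apply: PT_muln
  | |- PT (fun x => expn (@?f x) _) => apply: PT_expn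
  | |- PT (fun x => leq (@?f x) (@?g x)) => apply: PT_leq
  | |- PT (fun x => andb (@?f x) (@?g x)) => apply: PT_andb
  | |- PT (fun x => orb (@?f x) (@?g x)) => apply: PT_orb
  | |- PT (fun x => negb (@?f x)) => apply: PT_negb
  | |- PT (fun x => eq_op (@?f x) (@?g x)) => first [apply: PT_eqn | apply: PT_eqb | apply: PT_eqclause]
  | |- PT (fun x => has (@?f x) (@?g x)) => apply: PT_has
  | |- PT (fun x => all (@?f x) (@?g x)) => apply: PT_all
  | |- PT (fun x => count (@?f x) (@?g x)) => apply: PT_count
  | |- PT (fun x => filter (@?f x) (@?g x)) => apply: PT_filter
  | |- PT (fun x => map (@?f x) (@?g x)) => apply: PT_map
  | |- PT (fun x => cat (@?f x) (@?g x)) => apply: PT_cat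
  | |- PT (fun x => flatten (@?g x)) => apply: PT_flatten
  | |- PT (fun x => nth _ (@?f x) (@?g x)) => apply: PT_nth
  | |- PT (fun x => iota 0 (@?g x)) => apply: PT_iota
  | |- PT (fun x => divn (@?f x) (@?g x)) => apply: PT_divn
  | _ => pt1
  end.
Ltac pts := repeat pt2; try done.

Section PTKernel.
Variables (a b E K0 : nat).

Lemma PT_mem_lit : PT (fun p : clause * nat * bool => mem_lit p.1.1 p.1.2 p.2).
Proof. by rewrite /mem_lit; pts. Qed.
Lemma PT_touches : PT (fun p : clause * nat => touches p.1 p.2).
Proof. by rewrite /touches; pts. Qed.
Lemma PT_has_neg : PT has_neg.
Proof. by rewrite /has_neg; pts. Qed.
Lemma PT_memn : PT (fun p : seq nat * nat => memn p.1 p.2).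
Proof. by rewrite /memn; pts. Qed.

Lemma PT_num_neg : PT num_neg.
Proof. by have P := PT_has_neg; rewrite /num_neg; pts. Qed.
Lemma PT_deg_neg : PT (fun p : seq clause * nat => deg_neg p.1 p.2).
Proof. by have P := PT_has_neg; have P1 := PT_touches; rewrite /deg_neg; pts. Qed.
Lemma PT_deg_pos : PT (fun p : seq clause * nat => deg_pos p.1 p.2).
Proof. by have P := PT_has_neg; have P1 := PT_touches; rewrite /deg_pos; pts. Qed.
Lemma PT_deg_all : PT (fun p : seq clause * nat => deg_all p.1 p.2).
Proof. by have P1 := PT_touches; rewrite /deg_all; pts. Qed.

Lemma PT_argmin (X : Type) `{Enc X} (sc : X -> nat -> nat) (l : X -> seq nat) :
  PT (fun q : X * nat => sc q.1 q.2) -> PT l -> PT (fun x => argmin (sc x) (l x)).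
Proof. by move=> Ps Pl; rewrite /argmin; pts. Qed.

Lemma PT_prune (X : Type) `{Enc X} t cand sc n W :
  PT t -> PT (fun q : X * seq nat => cand q.1 q.2) -> PT (fun q : X * nat => sc q.1 q.2) ->
  PT n -> PT W -> PT (fun x => prune (t x) (cand x) (sc x) (n x) (W x)).
Proof.
move=> Pt Pc Ps Pn PW; have [C [d B]] := PT_size PW.
apply: (@PT_iter_env _ _ _ _ _ (fun x => prune_step (t x) (cand x) (sc x)) _ (pol C d)) => //.
- exact: poly_pol.
- have Pa : PT (fun q : X * seq nat => argmin (sc q.1) (cand q.1 q.2)).
    by apply: (@PT_argmin _ _ (fun q u => sc q.1 u) (fun q => cand q.1 q.2)); pts.
  by rewrite /prune_step; pts.
- move=> x i _; apply: leq_trans (B x); elim: i => // i IH.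
  rewrite iterS /prune_step; case: ifP => // _; exact: leq_trans (esize_filter _ _) IH.
Qed.

Lemma PT_pattern_class (X : Type) `{Enc X} C p q W : PT C -> PT W ->
  PT (fun x : X => pattern_class (C x) p q (W x)).
Proof. by move=> PC PW; have P := PT_mem_lit; rewrite /pattern_class; pts. Qed.

Lemma PT_refinements (X : Type) `{Enc X} cls th W : PT cls -> PT th -> PT W ->
  PT (fun x : X => refinements (cls x) (th x) (W x)).
Proof.
move=> Pc Pt PW.
have P p q : PT (fun x : X * clause => pattern_class x.2 p q (W x.1)) by apply: PT_pattern_class; pts.
have M p q : PT (fun x : X => [seq pattern_class C p q (W x) | C <- cls x]) by apply: PT_map => //; exact: P.
by rewrite /refinements; pts.
Qed.

Lemma PT_core (X : Type) `{Enc X} (cls : X -> seq clause) th r (W : X -> seq nat) :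
  PT cls -> (forall r, PT (fun x => th x r)) -> PT W ->
  PT (fun x : X => core (cls x) (th x) r (W x)).
Proof.
move=> Pc Pt; elim: r W => //= r IH W PW.
have P : PT (fun x : X => refinements (cls x) (th x r) (W x)) by exact: PT_refinements.
by apply: PT_if => //; [pts|apply: IH; pts].
Qed.

Lemma PT_seqs_upto (X : Type) `{Enc X} r (al : X -> seq nat) :
  PT al -> PT (fun x : X => seqs_upto r (al x)).
Proof. by move=> Pa; elim: r => [|r IH] /=; pts. Qed.

Lemma PT_value : PT (fun p : seq clause * seq nat => value p.1 p.2).
Proof. by have P := PT_memn; rewrite /value; pts. Qed.

Lemma PT_opt_bound : PT (fun k => opt_bound b E k).
Proof. by rewrite /opt_bound; pts. Qed.
Lemma PT_pos_quota : PT (fun k => pos_quota a b E k).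
Proof. by have P := PT_opt_bound; rewrite /pos_quota; pts. Qed.
Lemma PT_core_quota r : PT (fun k => core_quota a b E k r).
Proof. by have P := PT_opt_bound; rewrite /core_quota; pts. Qed.

Lemma PT_heavy : PT (fun p : seq clause * nat * nat => heavy b E p.1.1 p.1.2 p.2).
Proof. by have P := PT_deg_neg; have P1 := PT_num_neg; rewrite /heavy; pts. Qed.

Notation inst := (nat * seq clause * nat)%type.

Lemma PT_select_pos : PT (fun x : inst => select_pos a b E x.1.1 x.1.2 x.2).
Proof.
have P := PT_heavy; have P1 := PT_deg_pos; have P2 := PT_pos_quota.
rewrite /select_pos.
apply: (@PT_prune _ _ (fun x : inst => pos_quota a b E x.2) (fun _ W => W)
  (fun x : inst => deg_pos x.1.2) (fun x : inst => x.1.1)); by pts.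
Qed.

Lemma PT_select_core : PT (fun x : inst => select_core a b E x.1.1 x.1.2 x.2).
Proof.
have P := PT_heavy; have P1 := PT_deg_all; have P2 := PT_core_quota.
rewrite /select_core.
apply: (@PT_prune _ _ (fun x : inst => core_quota a b E x.2 b)
  (fun x : inst => core x.1.2 (core_quota a b E x.2) b)
  (fun x : inst => deg_all x.1.2) (fun x : inst => x.1.1)).
- exact: (PT_comp (P2 b) PT_snd).
- apply: PT_core; [by pts| |by pts].
  by move=> r; have P3 := P2 r; apply: (PT_comp P3); pts.
- by pts.
- by pts.
- by pts.
Qed.

Lemma PT_select_large : PT (fun x : inst => select_large a b E x.1.1 x.1.2 x.2).
Proof.
have P := PT_heavy; have P1 := PT_select_pos; have P2 := PT_select_core; have P3 := PT_memn.
by rewrite /select_large; pts.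
Qed.

Lemma PT_best_set : PT (fun x : inst => best_set K0 x.1.1 x.1.2 x.2).
Proof.
have P : PT (fun x : inst => small_sets K0 x.1.1 x.2).
  rewrite /small_sets; apply: PT_filter; first by pts.
  by apply: PT_seqs_upto; pts.
by have P1 := PT_value; rewrite /best_set; pts.
Qed.

Lemma PT_select : PT (fun x : inst => select a b E K0 x.1.1 x.1.2 x.2).
Proof.
have P := PT_select_large; have P1 := PT_best_set; have P2 := PT_memn.
by rewrite /select; pts.
Qed.

Lemma PT_reduced_clause : PT (fun p : seq nat * clause => reduced_clause p.1 p.2).
Proof. by have P := PT_mem_lit; rewrite /reduced_clause; pts. Qed.
Lemma PT_neg_outside : PT (fun p : seq nat * clause => neg_outside p.1 p.2).
Proof. by have P := PT_memn; rewrite /neg_outside; pts. Qed.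
Lemma PT_reduced : PT (fun p : seq nat * seq clause => reduced p.1 p.2).
Proof. by have P := PT_reduced_clause; have P1 := PT_neg_outside; rewrite /reduced; pts. Qed.

Lemma PT_sample : PT (fun p : nat * nat * seq clause => sample a p.1.1 p.1.2 p.2).
Proof.
have P : PT (fun p : nat * clause => small_clause a p.1 p.2).
  by have P := PT_touches; rewrite /small_clause; pts.
apply: (@PT_ext _ _ _ _ _ (fun p : nat * nat * seq clause =>
  [seq nth [::] p.2 j | j <- [seq j <- iota 0 (size p.2) | small_clause a p.1.1 (nth [::] p.2 j) &&
     ((count (fun i => nth [::] p.2 i == nth [::] p.2 j) (iota 0 j)).+1 %/ p.1.2 * p.1.2
       == (count (fun i => nth [::] p.2 i == nth [::] p.2 j) (iota 0 j)).+1)]])).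
  by pts.
by move=> p; rewrite /sample; congr map; apply: eq_filter => j; rewrite dvdn_eq.
Qed.

Lemma PT_scale : PT (fun p : seq nat * seq clause => scale a b E p.1 p.2).
Proof. by have P := PT_reduced; rewrite /scale /clause_quota; pts. Qed.

Lemma PT_sparsified : PT (fun p : seq nat * seq clause => sparsified a b E p.1 p.2).
Proof.
have P := PT_reduced; have P1 := PT_scale; have P2 := PT_sample.
by rewrite /sparsified; pts.
Qed.

Lemma PT_final_clauses : PT (fun p : seq nat * seq clause => final_clauses a b E p.1 p.2).
Proof.
have P1 := PT_sparsified; have P2 := PT_neg_outside.
by rewrite /final_clauses; pts.
Qed.

Lemma PT_kernel_of : PT (fun x => kernel_of a b E K0 x).
Proof.
have P := PT_select; have P1 := PT_final_clauses.
by rewrite /kernel_of; pts.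
Qed.

Lemma PT_lift_of : PT (fun x => lift_of a b E K0 x).
Proof. by have P := PT_select; rewrite /lift_of; pts. Qed.

End PTKernel.

(** * From polynomial-time functions to Turing machines *)

(** The tape puts the first bit at the bottom of register 0, the programs expect it on top: three
    moves reverse the word before and after. *)
Lemma poly_time_intro (X : Type) (Y : X -> Type) (P : X -> Prop) (encX : X -> seq bool)
    (encY : forall x, Y x -> seq bool) (f : forall x, Y x) c p :
  poly p ->
  (forall x, P x -> exec c (rg [:: encX x]) (p (size (encX x))) (rg [:: encY x (f x)])) ->
  poly_time_computable P encX encY f.
Proof.
move=> Pp H.
pose flip := [:: mv 0 1; mv 1 2; mv 2 0].
have flip_ok u L t s : exec (block L) (rg [:: rev u]) t s ->
    exec (block (flip ++ L)) (rg [:: u]) (6 * size u + 3 + t) s.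
  rewrite (rg3 (rev u)) (rg3 u) => H1; apply: exec_le.
    apply: bl_mv => //=; apply: bl_mv => //=; apply: bl_mv => //=.
    rewrite !cats0 !revK; exact: H1.
  rewrite /= !(cats0, size_rev); lia.
pose T n := 6 * n + 3 + (p n + (6 * (n + p n) + 3)).
have PT' : poly (fun n => 2 + T n * (2 * (n + T n) + 3)).
  have PTn : poly T by rewrite /T; do ! (exact: Pp || (progress polyt)).
  by do ! (exact: PTn || (progress polyt)).
have [C [d HT]] := PT'.
exists (machine (block (flip ++ c :: flip))), C, d => x Px.
have E : exec (block (flip ++ c :: flip)) (input_store (encX x)) (T (size (encX x)))
    (input_store (encY x (f x))).
  have sz : size (encY x (f x)) <= size (encX x) + p (size (encX x)).
    have hs i : size (rg [:: encX x] i) <= size (encX x) by rewrite /rg; case: i => [|i] /=; rewrite ?nth_nil.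
    exact: (exec_size (H x Px) hs 0).
  apply: exec_le.
    apply: (flip_ok); rewrite revK; apply: bl_do (H x Px) _.
    by have F := flip_ok _ [::]; rewrite cats0 in F; apply: F; apply: ex_block0.
  by rewrite /T size_rev; lia.
have [i [ii R]] := machine_ok E.
by exists i; split=> //; apply: leq_trans ii (HT _).
Qed.

Definition raw (I : cnf) : nat * seq clause :=
  (nvars I, [seq [seq (val l.1, l.2) | l <- C] | C <- clauses I]).

Definition cnf_of (r : nat * seq clause) : cnf :=
  CNF [seq pmap (fun l => omap (fun v => (v, l.2)) (insub l.1 : option 'I_r.1)) C | C <- r.2].

Lemma raw_cnf_of (r : nat * seq clause) : (forall (C : clause) (l : lit), C \in r.2 -> l \in C -> l.1 < r.1) -> raw (cnf_of r) = r.
Proof.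
case: r => n cls /= H; rewrite /raw /cnf_of /=; congr pair; rewrite -map_comp -[RHS]map_id.
apply/eq_in_map => C CI /=; have := fun l => H C l CI; move: (C : clause) => {CI}; elim=> //= l {}C IH H1.
case: insubP => [v _ ev|]; last by rewrite H1 ?mem_head.
rewrite /= IH => [|l' l'C]; last by apply: H1; rewrite in_cons l'C orbT.
by rewrite ev; case: l {H1 ev}.
Qed.

Lemma enc_cnfE I : enc_cnf I = enc (raw I).
Proof.
rewrite /enc_cnf /= -map_comp; congr cat; congr (Defs.enc_seq _); apply: eq_map => C /=.
by rewrite -map_comp.
Qed.

Lemma enc_setE n (Y : {set 'I_n}) : enc (enc_set Y) = enc_nat n ++ enc_set Y.
Proof.
rewrite enc_list {1}/enc_set size_map size_enum_ord; congr cat.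
by elim: (enc_set Y) => //= b s ->.
Qed.

Lemma nvars_lt_size I : nvars I < size (enc_cnf I).
Proof. by rewrite /enc_cnf size_cat size_enc_nat; lia. Qed.

Section Glue.
Variables (a b E K0 : nat).
Notation K := (kernel_of a b E K0).
Notation Lft := (lift_of a b E K0).

Definition fA (I : cnf) (k : nat) : cnf := cnf_of (K (raw I, k)).
Definition fB (I : cnf) (k : nat) (Y : {set 'I_(nvars (fA I k))}) : {set 'I_(nvars I)} :=
  [set v : 'I_(nvars I) | nth false (Lft (raw I, k, enc_set Y)) v].

Variable P : cnf -> nat -> Prop.
Hypothesis wf : forall I k, P I k -> raw (fA I k) = K (raw I, k).

Lemma fA_poly : poly_time_computable (X := (cnf * nat)%type) (Y := fun _ => cnf)
  (fun x => P x.1 x.2) (fun x => enc_cnf x.1 ++ enc_nat x.2)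
  (fun x y => enc_cnf y ++ enc_nat x.2) (fun x => fA x.1 x.2).
Proof.
have PK := PT_kernel_of a b E K0.
have [c [C [d H]]] : PT (fun x : nat * seq clause * nat => (K x, x.2)) by pts.
apply: (@poly_time_intro _ _ _ _ _ _ c (pol C d)) => [|[I k] PI]; first exact: poly_pol.
change (exec c (rg [:: enc_cnf I ++ enc_nat k]) (pol C d (size (enc_cnf I ++ enc_nat k)))
  (rg [:: enc_cnf (fA I k) ++ enc_nat k])).
by rewrite !enc_cnfE wf //; exact: (H (raw I, k)).
Qed.

Lemma enc_set_fB I k Y : enc_set (@fB I k Y) = Lft (raw I, k, enc_set Y).
Proof.
have sz : size (Lft (raw I, k, enc_set Y)) = nvars I by rewrite /lift_of size_map size_iota.
apply: (@eq_from_nth _ false) => [|i]; first by rewrite sz /enc_set size_map size_enum_ord.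
rewrite /enc_set size_map size_enum_ord => lt.
by rewrite (nth_map (Ordinal lt)) ?size_enum_ord // inE nth_enum_ord.
Qed.

Notation prefix := ((nat * seq clause) * (nat * ((nat * seq clause) * nat)))%type.

(** The set arrives as a bare bit string, while [Enc] wants its length in front. After the
    self-delimiting prefix has been moved away, [mv2] tallies the remaining bits and the tally is
    put before them; the final loop strips the length from the result. *)
Lemma fB_poly : poly_time_computable
    (X := {x : cnf * nat & {set 'I_(nvars (fA x.1 x.2))}})
    (Y := fun z => {set 'I_(nvars (projT1 z).1)})
    (fun z => P (projT1 z).1 (projT1 z).2 /\ #|projT2 z| <= (projT1 z).2)
    (fun z => enc_cnf (projT1 z).1 ++ enc_nat (projT1 z).2 ++
              enc_cnf (fA (projT1 z).1 (projT1 z).2) ++ enc_nat (projT1 z).2 ++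
              enc_set (projT2 z))
    (fun z Y => enc_set Y)
    (fun z => fB (projT2 z)).
Proof.
have PL := PT_lift_of a b E K0.
have [c [C [d H]]] : PT (fun x : prefix * seq bool => Lft (x.1.1, x.1.2.1, x.2)) by pts.
apply: (@poly_time_intro _ _ _ _ _ _ (block [:: mover prefix; mv2 (fun=> true) 0 2 3; mv 2 0;
    Push 0 false; mv 3 0; mv 1 0; c; Loop 0 Skip])
  (fun n => (mover_time prefix + 20) * n + 20 + (pol C d (n + n + 1)) + (n + 1))); first by polyt.
case=> [[I k] Y]; rewrite [projT1 _]/= [projT2 _]/= ![(I, k).1]/= ![(I, k).2]/= => -[PI _].
have H1 := H (raw I, (k, (raw (fA I k), k)), enc_set Y).
have ep : enc (raw I, (k, (raw (fA I k), k))) =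
    enc_cnf I ++ enc_nat k ++ enc_cnf (fA I k) ++ enc_nat k.
  by rewrite !enc_cnfE.
have -> : enc_cnf I ++ enc_nat k ++ enc_cnf (fA I k) ++ enc_nat k ++ enc_set Y =
    enc (raw I, (k, (raw (fA I k), k))) ++ enc_set Y by rewrite ep -!catA.
have e1 : enc_nat (nvars (fA I k)) ++ enc_set Y = enc (enc_set Y) by rewrite enc_setE.
have sY : size (enc_set Y) = nvars (fA I k) by rewrite /enc_set size_map size_enum_ord.
have e2 : [seq true | _ <- enc_set Y] = nseq (nvars (fA I k)) true.
  have e0 (s : seq bool) : [seq true | _ <- s] = nseq (size s) true by elim: s => //= _ s ->.
  by rewrite e0 sY.
have {}H1 : exec c (rg [:: enc (raw I, (k, (raw (fA I k), k))) ++ enc (enc_set Y)])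
   (pol C d (size (enc (raw I, (k, (raw (fA I k), k)))) + esize (enc_set Y)))
   (rg [:: enc (enc_set (fB Y))]).
  rewrite enc_set_fB; apply: exec_le H1 _.
  by rewrite [X in pol _ _ X <= _](size_cat (enc (raw I, (k, (raw (fA I k), k)))) (enc (enc_set Y))).
have les : nvars (fA I k) < size (enc (raw I, (k, (raw (fA I k), k)))).
  rewrite ep size_cat size_cat [size (enc_cnf (fA I k) ++ _)]size_cat.
  by have := nvars_lt_size (fA I k); lia.
have leI : nvars I < size (enc (raw I, (k, (raw (fA I k), k)))).
  by rewrite ep size_cat; have := nvars_lt_size I; lia.
move: H1 les leI {ep}; move: (raw I, (k, (raw (fA I k), k))) => p H1 les leI.
have M r0 r1 r2 l : exec (mover prefix) (rg [:: enc p ++ r0, r1, r2 & l])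
    (mover_time prefix * size (enc p)) (rg [:: r0, rev (enc p) ++ r1, r2 & l]) by exact: ex_mover.
move: (enc p) M H1 les leI => w M H1 les leI.
apply: exec_le.
  rewrite rg4; apply: (bl_do (M _ _ _ _)); apply: bl_mv2 => //=; apply: bl_mv => //=; apply: bl_push => /=.
  apply: bl_mv => //=; apply: bl_mv => //=.
  rewrite !cats0 e2 !rev_nseq !revK.
  rewrite -(enc_nat_cat _ (enc_set Y)) e1.
  rewrite -(rg4 (w ++ _)); apply: bl_do H1 _; rewrite enc_setE.
  apply: (bl_droptally (n := nvars I) (tl := false :: enc_set (fB Y))) => //=; first by rewrite enc_nat_cat.
  exact: ex_block0.
have sE : esize (enc_set Y) = (nvars (fA I k)).+1 + nvars (fA I k).
  by rewrite enc_setE !(size_enc_nat, size_cat) sY.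
move: (enc_set Y) sY sE les {e1 e2 H1 M}; move: (nvars (fA I k)) => N z sz sE les.
rewrite sE /= !(cats0, size_nseq, size_rev, size_map, size_cat) /= ?size_nseq sz.
have P1 : pol C d (size w + (N.+1 + N)) <= pol C d (size w + N + (size w + N) + 1).
  by apply: pol_mono; lia.
have : N <= size w by lia.
lia.
Qed.
End Glue.

(** * Biclique-free incidence structures *)

(** Factor by factor: [(d - i) * b >= d] for [i < b <= d], since [(d - b) * (b - 1) >= 0]. *)
Lemma expn_le_ffact d b : b <= d -> d ^ b <= d ^_ b * b ^ b.
Proof.
move=> bd; rewrite ffact_prod.
have -> : b ^ b = \prod_(i < b) b by rewrite big_const_ord iter_muln_1.
have -> : d ^ b = \prod_(i < b) d by rewrite big_const_ord iter_muln_1.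
rewrite -big_split /=; apply: leq_prod => i _.
by have := ltn_ord i; nia.
Qed.

Lemma ffact_le_expn n b : n ^_ b <= n ^ b.
Proof.
rewrite ffact_prod (_ : n ^ b = \prod_(i < b) n); last by rewrite big_const_ord iter_muln_1.
by apply: leq_prod => i _; rewrite leq_subr.
Qed.

Lemma bin_ratio n d b : b <= d -> 'C(n, b) * d ^ b <= 'C(d, b) * (b * n) ^ b.
Proof.
move=> bd; rewrite -(leq_pmul2l (fact_gt0 b)) !mulnA ![b`! * _]mulnC !bin_ffact expnMn.
have := leq_mul (ffact_le_expn n b) (expn_le_ffact bd).
by rewrite mulnCA [_ * (b ^ b * _)]mulnA [n ^ b * _]mulnC -mulnA.
Qed.

Lemma card_bigcup_le (I T : finType) (P : pred I) (F : I -> {set T}) :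
  #|\bigcup_(i | P i) F i| <= \sum_(i | P i) #|F i|.
Proof.
elim/big_rec2: _ => [|i n A _ IH]; first by rewrite cards0.
by apply: leq_trans (leq_add (leqnn _) IH); rewrite cardsU leq_subr.
Qed.

Section Incidence.
Variables (V J : finType) (pos neg : V -> J -> bool) (a b k E : nat).
Hypotheses (b0 : 0 < b) (k0 : 0 < k) (E0 : 0 < E).

Definition inc v j := pos v j || neg v j.
Definition star v := [set j | inc v j].
(* [locked] keeps [inE] from unfolding it. *)
Definition negs := locked [set j | [exists v, neg v j]].
Definition sat (Y : {set V}) j :=
  [exists v in Y, pos v j] || [exists v, (v \notin Y) && neg v j].
Definition worth Y := #|[set j | sat Y j]|.
Definition opt := \max_(Y : {set V} | #|Y| <= k) worth Y.

Hypothesis Kfree : forall B : {set J}, #|B| = b -> #|[set v | B \subset star v]| < a.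

Lemma worth_le_opt (Y : {set V}) : #|Y| <= k -> worth Y <= opt.
Proof. by move=> Yk; exact: (@leq_bigmax_cond _ (fun Y : {set V} => #|Y| <= k) worth Y Yk). Qed.

Lemma opt_attained : exists2 Y : {set V}, #|Y| <= k & worth Y = opt.
Proof.
have [|Y Yk e] := @eq_bigmax_cond _ (fun Y : {set V} => #|Y| <= k) worth; last by exists Y.
by apply/card_gt0P; exists set0; rewrite unfold_in cards0.
Qed.

(* Double counting of the pairs of [v] in [W] and a [b]-subset of [star v :&: U]. *)
Lemma card_common (W : {set V}) (U : {set J}) d :
  (forall v, v \in W -> d <= #|star v :&: U|) -> #|W| * 'C(d, b) <= a * 'C(#|U|, b).
Proof.
move=> dW.
apply: (@leq_trans (\sum_(v in W) #|[set B : {set J} | (B \subset star v :&: U) && (#|B| == b)]|)).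
  rewrite -sum_nat_const; apply: leq_sum => v vW; rewrite cards_draws.
  exact: leq_bin2l (dW v vW).
have -> : \sum_(v in W) #|[set B : {set J} | (B \subset star v :&: U) && (#|B| == b)]| =
    \sum_(B : {set J} | (B \subset U) && (#|B| == b)) #|[set v in W | B \subset star v]|.
  under eq_bigr do rewrite -sum1_card; rewrite (exchange_big_dep (fun B : {set J} => (B \subset U) && (#|B| == b))) /=.
    apply: eq_bigr => B /andP [BU Bb]; rewrite -sum1_card; apply: eq_bigl => v.
    by rewrite !inE subsetI BU Bb !andbT.
  by move=> v B _; rewrite inE subsetI -andbA => /and3P [_ -> ->].
have -> : a * 'C(#|U|, b) = \sum_(B : {set J} | (B \subset U) && (#|B| == b)) a.
  by rewrite -cards_draws -sum1_card big_distrr /= muln1; apply: eq_bigl => B; rewrite inE.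
apply: leq_sum => B /andP [_ /eqP Bb]; apply: ltnW; apply: leq_ltn_trans (Kfree Bb).
by apply: subset_leq_card; apply/subsetP => v; rewrite !inE => /andP [].
Qed.

(** [card_common] is applied with [d] the least degree into [U], and [bin_ratio] turns the quotient
    of binomials into a power. That all degrees are at least [b] makes ['C(d, b)] positive. *)
Lemma card_dense (W : {set V}) (U : {set J}) c :
  (forall v, v \in W -> b <= #|star v :&: U| /\ #|U| <= c * #|star v :&: U|) ->
  #|W| <= a * (b * c) ^ b.
Proof.
move=> H; have [->|[v0 v0W]] := set_0Vmem W; first by rewrite cards0.
case: (arg_minnP (fun v => #|star v :&: U|) v0W) => v vW vmin.
have [bd Uc] := H v vW; set d := #|star v :&: U| in bd Uc vmin.
have C := @card_common W U d vmin.
have d0 : 0 < d ^ b by rewrite expn_gt0 (leq_trans b0 bd).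
have Cd : 0 < 'C(d, b) by rewrite bin_gt0.
rewrite -(leq_pmul2r d0) -(leq_pmul2r Cd).
apply: (@leq_trans (a * 'C(#|U|, b) * d ^ b)); first by rewrite mulnAC leq_mul2r C orbT.
rewrite -mulnA; apply: (@leq_trans (a * ('C(d, b) * (b * #|U|) ^ b))).
  by rewrite leq_mul2l bin_ratio ?orbT.
have e : (b * #|U|) ^ b <= (b * c) ^ b * d ^ b.
  by rewrite -expnMn leq_expr // -mulnA leq_mul2l Uc orbT.
by rewrite -!mulnA leq_mul2l mulnA [X in _ <= X]mulnC leq_mul2l e !orbT.
Qed.

(** The worth of a solution splits into [cov], a coverage function on the purely positive clauses,
    and [satn], the satisfied clauses with a negative literal. *)
Definition touched (Y : {set V}) := \bigcup_(v in Y) star v.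
Definition cov Y := #|touched Y :\: negs|.
Definition satn (Y : {set V}) := #|[set j in negs | sat Y j]|.
Definition dneg v := #|star v :&: negs|.
Definition dpos v := #|star v :\: negs|.

Lemma in_negs j : (j \in negs) = [exists v, neg v j]. Proof. by rewrite /negs -lock inE. Qed.

Lemma inc_pos v j : j \notin negs -> inc v j = pos v j.
Proof.
rewrite in_negs negb_exists => /forallP /(_ v) /negbTE nv.
by rewrite /inc nv orbF.
Qed.

Lemma touchedP (Y : {set V}) j : reflect (exists2 v, v \in Y & inc v j) (j \in touched Y).
Proof.
apply: (iffP bigcupP) => [[v vY]|[v vY vj]]; first by rewrite inE => vj; exists v.
by exists v; rewrite ?inE.
Qed.

Lemma sat_touched (Y : {set V}) j : j \notin negs -> sat Y j = (j \in touched Y).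
Proof.
move=> jN; rewrite /sat.
have -> : [exists v, (v \notin Y) && neg v j] = false.
  apply/negbTE; rewrite negb_exists; apply/forallP => v; apply/negP => /andP [_ vj].
  by move: jN; rewrite in_negs => /existsP []; exists v.
rewrite orbF; apply/existsP/touchedP => [[v /andP [vY vj]]|[v vY vj]].
  by exists v; rewrite ?inc_pos.
by exists v; rewrite vY -inc_pos.
Qed.

Lemma worthE Y : worth Y = cov Y + satn Y.
Proof.
rewrite /worth -(cardsID negs) addnC; congr addn; last first.
  by apply: eq_card => j; rewrite !inE andbC.
by apply: eq_card => j; rewrite !inE; case jN: (j \in negs) => //=; rewrite sat_touched ?jN.
Qed.

(** Setting all variables to false satisfies every clause with a negative literal. *)
Lemma negs_le_opt : #|negs| <= opt.
Proof.
apply: leq_trans (worth_le_opt (Y := set0) _); last by rewrite cards0.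
apply: subset_leq_card; apply/subsetP => j; rewrite in_negs inE => /existsP [v vj].
by rewrite /sat; apply/orP; right; apply/existsP; exists v; rewrite inE.
Qed.

Lemma touchedU X Y : touched (X :|: Y) = touched X :|: touched Y.
Proof. by rewrite /touched bigcup_setU. Qed.

Lemma satn_diff (Y Y' Z : {set V}) : (forall v, v \notin Z -> (v \in Y) = (v \in Y')) ->
  satn Y <= satn Y' + #|touched Z :&: negs|.
Proof.
move=> e; apply: (@leq_trans #|[set j in negs | sat Y' j] :|: (touched Z :&: negs)|); last first.
  by rewrite cardsU leq_subr.
apply: subset_leq_card; apply/subsetP => j; rewrite !inE => /andP [jN Yj].
case jZ: (j \in touched Z); rewrite jN /= ?orbT // orbF.
have nZ v : inc v j -> v \notin Z.
  by move=> vj; apply/negP => vZ; move/touchedP: jZ; apply; exists v.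
case/orP: Yj => [/existsP [v /andP [vY vj]]|/existsP [v /andP [vY vj]]]; apply/orP; [left|right];
  apply/existsP; exists v; rewrite -e ?vY //; apply: nZ; by rewrite /inc vj ?orbT.
Qed.

Lemma touched_card (A : {set J}) (Y : {set V}) c :
  (forall v, v \in Y -> #|star v :&: A| <= c) -> #|touched Y :&: A| <= #|Y| * c.
Proof.
move=> H; rewrite /touched big_distrl /= -sum_nat_const.
by apply: leq_trans (card_bigcup_le _ _) _; apply: leq_sum.
Qed.

(* The part of an optimal solution outside [H :|: R] is replaced one variable at a time:
   by [card_dense], some member of [R] always has few clauses that are already covered. *)
Lemma high_case (H R : {set V}) t :
  (forall v, v \in R -> v \notin H) ->
  (forall v, v \notin H -> dneg v < b \/ k * E * dneg v < #|negs|) ->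
  (forall u v, u \in R -> v \notin H -> v \notin R -> dpos v <= dpos u) ->
  t <= #|R| \/ (forall v, v \notin H -> v \in R) ->
  a * (b * k * E * E) ^ b < t -> b * k * E * E <= opt -> 1 < E ->
  exists Y : {set V}, [/\ Y \subset H :|: R, #|Y| <= k & E * opt <= E * worth Y + 4 * opt].
Proof.
move=> RH light Rtop Rbig tbig optbig E1.
have [Y Yk Yopt] := opt_attained.
pose Y1 := Y :&: (H :|: R); pose Y2 := Y :\: (H :|: R).
have [Y20|[y0 y0Y2]] := set_0Vmem Y2.
  exists Y; split=> //; last by rewrite Yopt; lia.
  by apply/subsetP => v vY; apply: contraT => vn; have := in_set0 v; rewrite -Y20 inE vn vY.
have Y2E v : v \in Y2 -> v \notin H /\ v \notin R.
  by rewrite !inE negb_or => /andP [/andP []].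
have Rt : t <= #|R|.
  case: Rbig => // /(_ y0); have [nH nR] := Y2E _ y0Y2.
  by move=> /(_ nH); rewrite (negbTE nR).
have cardY : #|Y1| + #|Y2| = #|Y| by rewrite cardsID.
have [ym ymY2 ymax] : exists2 y, y \in Y2 & forall v, v \in Y2 -> dpos v <= dpos y.
  by case: (arg_maxnP dpos y0Y2) => y; exists y.
set D := dpos ym in ymax.
have DR u : u \in R -> D <= dpos u.
  by move=> uR; have [nH nR] := Y2E _ ymY2; exact: Rtop.
have covle (X : {set V}) : #|X| <= k -> cov X <= opt.
  by move=> Xk; apply: leq_trans (worth_le_opt Xk); rewrite worthE leq_addr.
have covY : cov Y <= cov Y1 + #|Y2| * D.
  have -> : cov Y = #|(touched Y1 :\: negs) :|: (touched Y2 :&: ~: negs)|.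
    by rewrite -setDE -setDUl -touchedU setID.
  apply: leq_trans (_ : _ <= cov Y1 + #|touched Y2 :&: ~: negs|) _; first by rewrite cardsU leq_subr.
  by rewrite leq_add2l; apply: touched_card => v vY2; rewrite -setDE; exact: ymax.
(* A light variable has [k * E * dneg v <= opt], by the size of the optimum or by [negs_le_opt]. The
   bound [2 * k] accommodates the variables taken out together with those put in. *)
have tneg (Z : {set V}) : (forall v, v \in Z -> v \notin H) -> #|Z| <= 2 * k ->
    E * #|touched Z :&: negs| <= 2 * opt.
  move=> ZH Zk.
  have dv v : v \in Z -> k * E * dneg v <= opt.
    move=> vZ; case: (light v (ZH v vZ)) => [lt|lt]; last exact: leq_trans (ltnW lt) negs_le_opt.
    apply: leq_trans optbig; apply: (@leq_trans (k * E * b)); first by rewrite leq_mul2l ltnW ?orbT.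
    by rewrite (_ : b * k * E * E = k * E * b * E) ?leq_pmulr //; nia.
  have kE0 : 0 < k * E by rewrite muln_gt0 k0.
  have := touched_card (A := negs) (Y := Z) (c := opt %/ (k * E)).
  have le1 v : v \in Z -> #|star v :&: negs| <= opt %/ (k * E).
    by move=> vZ; rewrite leq_divRL // mulnC; exact: dv.
  move=> /(_ le1) le2.
  have le3 := leq_divM opt (k * E).
  rewrite -(leq_pmul2l k0) mulnA; apply: leq_trans (leq_mul (leqnn (k * E)) le2) _.
  by nia.
(* [2 * opt] is lost on coverage here and [2 * opt] on the clauses of [negs] by [tneg], which makes
   the 4 of the statement. *)
suff [Z [ZR Zk covZ]] : exists Z : {set V}, [/\ Z \subset R, #|Z| <= #|Y2| &
    E * cov Y <= E * cov (Y1 :|: Z) + 2 * opt].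
  exists (Y1 :|: Z); split.
  - by rewrite subUset subsetIr /=; apply: subset_trans ZR (subsetUr _ _).
  - by rewrite cardsU; apply: leq_trans (leq_subr _ _) _; lia.
  have YZ v : v \notin Y2 :|: Z -> (v \in Y) = (v \in Y1 :|: Z).
    rewrite !inE negb_or; case/andP; rewrite negb_and => Hv /negbTE ->; rewrite orbF.
    by case: (v \in Y) Hv => //=; rewrite orbF negbK.
  have Z2k : #|Y2 :|: Z| <= 2 * k.
    by rewrite cardsU; apply: leq_trans (leq_subr _ _) _; lia.
  have ZnH v : v \in Y2 :|: Z -> v \notin H.
    by rewrite in_setU => /orP [/Y2E [] //|vZ]; apply: RH; exact: (subsetP ZR).
  have le1 := tneg _ ZnH Z2k.
  have le2 := leq_mul (leqnn E) (satn_diff YZ); rewrite mulnDr in le2.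
  have -> : E * opt = E * cov Y + E * satn Y by rewrite -Yopt worthE mulnDr.
  by rewrite worthE mulnDr; lia.
(* If some member of [R] has small positive degree, so have all of [Y2]; together they cover at most
   [opt / E] clauses and are simply dropped. *)
have [/existsP [u /andP [uR ulow]]|none] := boolP [exists u in R, k * E * dpos u < opt].
  exists set0; rewrite sub0set cards0 setU0; split=> //.
  have le1 : k * E * D <= opt by apply: leq_trans (ltnW ulow); rewrite leq_mul2l DR ?orbT.
  have le2 : #|Y2| * D <= k * D by rewrite leq_mul2r (_ : #|Y2| <= k) ?orbT //; lia.
  have := leq_mul (leqnn E) covY; have := leq_mul (leqnn E) le2.
  have -> : E * (k * D) = k * E * D by rewrite mulnCA mulnA.
  by rewrite mulnDr; lia.
have dhigh u : u \in R -> opt <= k * E * dpos u.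
  by move=> uR; rewrite leqNgt; apply: contra none => lt; apply/existsP; exists u; rewrite uR.
(* Otherwise each member of [R] meets the at most [opt] positive clauses covered by [X] in a
   [1 / (k * E * E)] fraction, hence in at least [b] of them, and [card_dense] contradicts the size
   of [R]. *)
have ext (X : {set V}) : #|X| <= k ->
    exists2 z, z \in R & E * #|(star z :\: negs) :&: touched X| <= dpos z.
  move=> Xk; apply/exists_inP; apply: contraT; rewrite negb_exists_in => /forall_inP Hz.
  have := @card_dense R (touched X :\: negs) (k * E * E) _.
  have -> : b * (k * E * E) = b * k * E * E by rewrite !mulnA.
  move=> HR; suff : #|R| <= a * (b * k * E * E) ^ b by lia.
  apply: HR => z zR; have := Hz z zR; rewrite -ltnNge => lt.
  have -> : star z :&: (touched X :\: negs) = (star z :\: negs) :&: touched X.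
    by apply/setP => j; rewrite !inE; case: (_ \in negs); rewrite /= ?andbF ?andbT.
  set d := #|_ :&: touched X| in lt *.
  have le1 := dhigh z zR; have le2 := covle X Xk; rewrite /cov in le2.
  have le3 : opt <= k * E * E * d by nia.
  split; last lia.
  have : b * (k * E * E) <= d * (k * E * E) by nia.
  by rewrite leq_pmul2r // !muln_gt0 k0 E0.
(* Each new variable gains at least [(1 - 1 / E) * D], while a removed one contributed at most
   [D]. *)
have grow n : n <= #|Y2| -> exists Z : {set V}, [/\ Z \subset R, #|Z| <= n &
    E * cov Y1 + (E - 1) * (n * D) <= E * cov (Y1 :|: Z)].
  elim: n => [|n IH] nY2.
    by exists set0; rewrite sub0set cards0 setU0 mul0n muln0 addn0.
  have [Z [ZR Zn covZ]] := IH (ltnW nY2).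
  have Xk : #|Y1 :|: Z| <= k by rewrite cardsU; apply: leq_trans (leq_subr _ _) _; lia.
  have [z zR lez] := ext _ Xk.
  exists (z |: Z); split; first by rewrite subUset sub1set zR.
    by rewrite cardsU1; case: (z \in Z) => /=; lia.
  have -> : cov (Y1 :|: (z |: Z)) = cov (Y1 :|: Z) + dpos z - #|(star z :\: negs) :&: touched (Y1 :|: Z)|.
    have -> : Y1 :|: (z |: Z) = (Y1 :|: Z) :|: [set z] by rewrite setUCA setUC.
    rewrite /cov touchedU {2}/touched big_set1 setDUl cardsU; congr (_ - _).
    by apply: eq_card => j; rewrite !inE; case: (_ \in negs); rewrite /= ?andbF ?andbT // andbC.
  have := DR z zR.
  have le1 : #|(star z :\: negs) :&: touched (Y1 :|: Z)| <= dpos z by apply: subset_leq_card; exact: subsetIl.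
  by nia.
have [Z [ZR Zn covZ]] := grow _ (leqnn _); exists Z; split=> //.
(* [E] times the shortfall is at most [#|Y2| * D], and [(E - 1) * #|Y2| * D <= E * opt] bounds this
   by [2 * opt] because [E >= 2]. *)
have : cov (Y1 :|: Z) <= opt by apply: covle; rewrite cardsU; apply: leq_trans (leq_subr _ _) _; lia.
by nia.
Qed.

End Incidence.

(** * Lossless exchange of a single variable *)

Section Swap.
Variables (V J : finType) (pos neg : V -> J -> bool) (k : nat).
Notation star := (star pos neg).
Notation worth := (worth pos neg).
Notation opt := (opt pos neg k).
Notation negs := (negs neg).
Notation touched := (touched pos neg).
Notation inc := (inc pos neg).
Notation sat := (sat pos neg).

Definition same_on (u v : V) j := (pos u j == pos v j) && (neg u j == neg v j).

(* Trading [v] for a member [u] of [W] whose clauses outside [A] are purely positive and not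
   yet covered loses at most [star v :\: A] and gains all of [star u :\: A]. *)
Lemma swap_case (Y W : {set V}) (A : {set J}) v :
  v \in Y -> #|Y| <= k -> v \in W -> (forall u, u \in W -> #|star v| <= #|star u|) ->
  A \subset star v -> (forall u j, u \in W -> j \in A -> same_on u v j) ->
  (forall U : {set J}, #|U| <= 2 * opt ->
     exists u, [/\ u \in W, u != v & star u :&: U \subset A]) ->
  exists u, [/\ u \in W, u != v & worth Y <= worth (u |: Y :\ v)].
Proof.
move=> vY Yk vW vmin Av AW avoid; pose X := Y :\ v.
have Xk : #|X| <= k by apply: leq_trans Yk; apply: subset_leq_card; exact: subsetDl.
(* The clauses to avoid: those with a negative literal and the positive ones covered by [X]. Either
   kind numbers at most [opt], whence the factor 2. *)
have [|u [uW uv uU]] := avoid (negs :|: (touched X :\: negs)).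
  have := worth_le_opt pos neg Xk; rewrite worthE /cov => le1.
  by have := negs_le_opt pos neg k; have := cardsU negs (touched X :\: negs); lia.
exists u; split=> //; rewrite -/X.
have uA j : j \in A -> inc u j.
  move=> jA; have := AW u j uW jA; have := subsetP Av j jA.
  by rewrite inE /inc /same_on => vj /andP [/eqP -> /eqP ->].
have outA j : inc u j -> j \notin A -> j \notin negs /\ j \notin touched X.
  move=> uj jA; have : j \notin negs :|: (touched X :\: negs).
    by apply: contra jA => jU; apply: (subsetP uU); rewrite inE jU inE uj.
  by rewrite in_setU in_setD negb_or negb_and negbK => /andP [jN]; rewrite (negbTE jN).
set S1 := [set j | sat Y j]; set S2 := [set j | sat (u |: X) j].
have sub : (S1 :\: (star v :\: A)) :|: (star u :\: A) \subset S2.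
  apply/subsetP => j; rewrite in_setU !in_setD => /orP [/andP [jv]|/andP [jA uj]]; last first.
    rewrite inE in uj; have [jN _] := outA j uj jA.
    by rewrite inE sat_touched // touchedU inE; apply/orP; left; apply/touchedP; exists u; rewrite ?inE.
  rewrite negb_and negbK in jv; rewrite !inE => Yj.
  (* On [A] the signs of [u] and [v] agree: [u] takes over the clauses satisfied by [v], and if the
     negation of [u] satisfied a clause, the negation of [v] now does. *)
  have [jA|jA] := boolP (j \in A).
    have /andP [/eqP ep /eqP en] := AW u j uW jA.
    case/orP: Yj => /existsP [w /andP [wY wj]]; apply/orP.
      left; apply/existsP; case: (eqVneq w v) => [e|wv].
        by exists u; rewrite in_setU1 eqxx ep -e.
      by exists w; rewrite in_setU1 in_setD1 wv wY orbT.
    right; apply/existsP; case: (eqVneq w u) => [e|wu].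
      by exists v; rewrite in_setU1 in_setD1 eqxx orbF -en -[u in neg u]e wj andbT eq_sym.
    by exists w; rewrite in_setU1 in_setD1 (negbTE wu) (negbTE wY) andbF wj.
  rewrite (negbTE jA) inE /= in jv.
  have nv : pos v j = false /\ neg v j = false by move: jv; rewrite /inc; case: (pos v j) (neg v j) => [] [].
  have [uj|uj] := boolP (inc u j).
    have [jN _] := outA j uj jA; change (is_true (sat (u |: X) j)); rewrite sat_touched //.
    by rewrite touchedU inE; apply/orP; left; apply/touchedP; exists u; rewrite ?inE.
  have nu : pos u j = false /\ neg u j = false by move: uj; rewrite /inc; case: (pos u j) (neg u j) => [] [].
  case/orP: Yj => /existsP [w /andP [wY wj]]; apply/orP; [left|right]; apply/existsP; exists w.
    rewrite wj in_setU1 in_setD1 wY andbT andbT; case: (eqVneq w v) wj => [->|_ _]; last by rewrite orbT.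
    by rewrite nv.1.
  rewrite wj in_setU1 in_setD1 (negbTE wY) andbF orbF andbT.
  by apply: contraTneq wj => ->; rewrite nu.2.
have dis : [disjoint S1 :\: (star v :\: A) & star u :\: A].
  rewrite -setI_eq0; apply/eqP/setP => j; rewrite !inE.
  apply/negbTE/negP; rewrite negb_and negbK => /andP [/andP [jv Yj] /andP [jA uj]].
  have [jN jX] := outA j uj jA.
  rewrite (negbTE jA) /= in jv.
  move: Yj; rewrite -/(sat Y j) sat_touched // => /touchedP [w wY wj].
  case/touchedP: jX; exists w => //; rewrite inE wY andbT inE.
  by apply: contraNneq jv => <-.
have le1 := subset_leq_card sub.
rewrite cardsU disjoint_setI0 // cards0 subn0 in le1.
have A1 : #|star v :\: A| = #|star v| - #|A| by rewrite cardsD (setIidPr Av).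
have Au : A \subset star u by apply/subsetP => j jA; rewrite inE uA.
have A2 : #|star u :\: A| = #|star u| - #|A| by rewrite cardsD (setIidPr Au).
have := vmin u uW; have := cardsID (star v :\: A) S1.
have : #|S1 :&: (star v :\: A)| <= #|star v :\: A| by apply: subset_leq_card; exact: subsetIr.
by rewrite /worth -/S1 -/S2; lia.
Qed.

End Swap.

(** * Pruning and cores *)

Lemma count_lt (T : eqType) (p q : pred T) s x :
  (forall y, y \in s -> p y -> q y) -> x \in s -> q x -> ~~ p x -> count p s < count q s.
Proof.
move=> pq xs qx px; have := count_predUI p (pred1 x) s.
rewrite (eq_count (a1 := predI _ _) (a2 := pred0)) ?count_pred0 => [|y /=]; last first.
  by case: eqP => [->|]; rewrite ?andbF ?andbT ?(negbTE px).
have x0 : 0 < count (pred1 x) s by rewrite -has_count has_pred1.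
have : count (predU p (pred1 x)) s <= count q s; last by lia.
rewrite (eq_in_count (a2 := predI q (predU p (pred1 x)))) ?sub_count // => [y /andP [] //|y ys /=].
by case h: (_ || _); rewrite ?andbF // andbT; case/orP: h => [/(pq y ys)|/eqP ->].
Qed.

Lemma count_sum (T : Type) (p : pred T) s : count p s = \sum_(x <- s) p x.
Proof. by rewrite -sum1_count big_mkcond. Qed.

Lemma count_card (T : Type) (x0 : T) (p : pred T) s :
  count p s = #|[set j : 'I_(size s) | p (nth x0 s j)]|.
Proof. by rewrite -sum1_count (big_nth x0) big_mkord sum1dep_card. Qed.

Lemma argminP (sc : nat -> nat) l : 0 < size l ->
  argmin sc l \in l /\ forall u, u \in l -> sc (argmin sc l) <= sc u.
Proof.
move=> l0; set f := [seq v <- l | all (fun u => sc v <= sc u) l].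
have f0 : f != [::].
  rewrite /f -has_filter.
  have : exists m, has (fun v => sc v == m) l.
    by case: l l0 {f} => // x l _; exists (sc x); rewrite /= eqxx.
  move=> /ex_minnP [m /hasP [v vl /eqP vm] mmin]; apply/hasP; exists v => //.
  by apply/allP => u ul; rewrite vm; apply: mmin; apply/hasP; exists u.
have : argmin sc l \in f by rewrite /argmin -/f; case: f f0 => //= x s _; exact: mem_head.
by rewrite mem_filter => /andP [/allP H ?].
Qed.

Section Prune.
Variables (t : nat) (cand : seq nat -> seq nat) (sc : nat -> nat) (P : seq nat -> Prop).
Hypothesis step : forall W, P W -> t < size W -> P [seq u <- W | ~~ (u == argmin sc (cand W))].

Lemma prune_ind n W : P W -> P (prune t cand sc n W).
Proof.
move=> PW; rewrite /prune; elim: n => //= n IH.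
by rewrite {1}/prune_step; case: leqP => // lt; exact: step.
Qed.

Hypothesis inW : forall W, P W -> t < size W -> argmin sc (cand W) \in W.

Lemma size_prune n W : P W -> size W <= t + n -> size (prune t cand sc n W) <= t.
Proof.
move=> PW le; suff : forall i, size (iter i (prune_step t cand sc) W) <= maxn t (size W - i).
  by move=> /(_ n); rewrite /prune; lia.
elim=> [|i IH]; first by rewrite /=; lia.
have PWi := prune_ind i PW; rewrite iterS {1}/prune_step.
rewrite /prune in PWi; set Wi := iter i _ W in IH PWi *.
case: (leqP (size Wi) t) => [le1|lt]; first lia.
have ai := inW PWi lt; rewrite size_filter.
set m := argmin sc (cand Wi) in ai *.
have c0 : 0 < count (fun u => u == m) Wi by rewrite -has_count; apply/hasP; exists m.
have e : count (fun u => u == m) Wi + count (fun u => ~~ (u == m)) Wi = size Wi by exact: count_predC.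
rewrite -(leq_add2l (count (fun u => u == m) Wi)) e.
by move: c0 IH lt; move: (count _ Wi) (size Wi) => x z; lia.
Qed.
End Prune.

Lemma mem_litP C v s : reflect ((v, s) \in C) (mem_lit C v s).
Proof.
apply: (iffP hasP) => [[[u r] uC /andP [/eqP <- /eqP <-]] //|vC].
by exists (v, s); rewrite ?eqxx.
Qed.

Lemma touchesE C v : touches C v = mem_lit C v true || mem_lit C v false.
Proof.
apply/hasP/orP => [[[u r] uC /eqP /= <-]|[/mem_litP|/mem_litP] vC].
- by case: r uC => uC; [left|right]; apply/mem_litP.
- by exists (v, true).
- by exists (v, false).
Qed.

Lemma memnE T v : memn T v = (v \in T).
Proof. by apply/hasP/idP => [[u uT /eqP <-]|vT] //; exists v. Qed.

(* Multiplicity-aware form of biclique-freeness, without indices. *)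
Definition Kfree (a b : nat) (cls : seq clause) :=
  forall A : seq nat, uniq A -> size A = a -> count (fun C => all (touches C) A) cls < b.

Definition patterns := [:: (true, false); (false, true); (true, true)].
Definition has_pattern (C : clause) (pq : bool * bool) v :=
  (mem_lit C v true == pq.1) && (mem_lit C v false == pq.2).
Definition constant_on (W : seq nat) C := has (fun pq => all (has_pattern C pq) W) patterns.

Lemma pattern_touches C pq v : pq \in patterns -> has_pattern C pq v -> touches C v.
Proof. by rewrite touchesE /has_pattern => pqP /andP [/eqP -> /eqP ->]; move: pq pqP => [[] []]. Qed.

Lemma touches_pattern C v : touches C v -> has (fun pq => has_pattern C pq v) patterns.
Proof. by rewrite touchesE /= /has_pattern /=; do 2 case: (mem_lit _ _ _). Qed.

Lemma refinementsP cls th W W1 :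
  reflect (exists C pq, [/\ C \in cls, pq \in patterns, W1 = filter (has_pattern C pq) W
                        & th < size W1 < size W])
    (W1 \in refinements cls th W).
Proof.
rewrite mem_filter !mem_cat; apply: (iffP andP).
  move=> [szs /orP [/mapP [C Cc e]|/orP [/mapP [C Cc e]|/mapP [C Cc e]]]]; exists C.
  - by exists (true, false).
  - by exists (false, true).
  - by exists (true, true).
move=> [C [pq [Cc pqP e szs]]]; split=> //; rewrite e.
move: pqP; rewrite !inE => /or3P [] /eqP ->; apply/or3P; [apply: Or31|apply: Or32|apply: Or33]; apply/mapP; by exists C.
Qed.

Section Core.
Variables (a b : nat) (cls : seq clause) (th : nat -> nat).
Hypotheses (K : Kfree a b cls) (th0 : th 0 = a).

(** Every refinement uses up a level and makes one more clause constant on the list, and a constant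
    clause contains the whole list. With no level left, [b] such clauses and more than [th 0 = a]
    variables would form a biclique, so the recursion must stop earlier, at a list without
    refinements. *)
Lemma core_spec r W : uniq W -> th r < size W -> b <= r + count (constant_on W) cls ->
  let W' := core cls th r W in
  [/\ {subset W' <= W}, uniq W' & exists r', th r'.+1 < size W' /\
    forall C pq, C \in cls -> pq \in patterns ->
      size (filter (has_pattern C pq) W') <= th r' \/ size W' <= size (filter (has_pattern C pq) W')].
Proof.
elim: r W => [|r IH] W uW szW bW.
  exfalso; rewrite th0 in szW.
  have := K (take_uniq a uW) (size_takel (ltnW szW)); rewrite ltnNge; case/negP.
  apply: leq_trans bW _; apply: sub_count => C /hasP [pq pqP /allP H].
  by apply/allP => v /mem_take vW; apply: pattern_touches pqP (H v vW).
rewrite /=; case: eqP => [e|/eqP ne].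
  split=> //; exists r; split=> // C pq Cc pqP; case: leqP => [|lt]; first by left.
  right; rewrite leqNgt; apply/negP => lt2.
  have : filter (has_pattern C pq) W \in refinements cls (th r) W.
    by apply/refinementsP; exists C, pq; rewrite lt lt2.
  by move/size0nil: e => ->.
have : head [::] (refinements cls (th r) W) \in refinements cls (th r) W.
  by case: (refinements _ _ _) ne => // w s _; exact: mem_head.
move=> /refinementsP; set W1 := head _ _ => -[C [pq [Cc pqP e /andP [lt1 lt2]]]].
have sub1 : {subset W1 <= W} by move=> v; rewrite e mem_filter => /andP [].
have [|//||s u [r' H]] := IH W1.
- by rewrite e filter_uniq.
(* [C] is newly constant: constancy on [W] with the same pattern would give [W1 = W], with another
   pattern an empty [W1]. *)
- have : count (constant_on W) cls < count (constant_on W1) cls; last by lia.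
  apply: (@count_lt _ _ _ _ C) => //.
  + move=> D _ /hasP [pq' pqP' /allP H]; apply/hasP; exists pq' => //.
    by apply/allP => v /sub1 /H.
  + by apply/hasP; exists pq => //; apply/allP => v; rewrite e mem_filter => /andP [].
  + apply/negP => /hasP [pq' pqP' /allP H].
    have [pe|pne] := eqVneq pq pq'.
      by move: lt2; rewrite e (_ : filter _ W = W) ?ltnn //; apply/all_filterP/allP; rewrite pe.
    have : size W1 = 0; last by lia.
    rewrite e size_filter; apply/eqP; rewrite -leqn0 leqNgt -has_count; apply/negP => /hasP [v vW].
    have := H v vW; rewrite /has_pattern => /andP [/eqP -> /eqP ->] /andP [/eqP e1 /eqP e2].
    by move: pne; case: (pq) e1 e2 => p q /= <- <-; case: (pq') => ? ?; rewrite eqxx.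
by split=> [v /s /sub1|//|]; last by exists r'.
Qed.

End Core.

(** Union bound: a clause of [U] that is not constant touches at most [th'] members for each of the
    three patterns, so more than [th'] members avoid all of them. As [th' > 0] these are at least
    two, and one differs from [v]. *)
Lemma core_avoid (cls : seq clause) W' (th' Q v : nat) (U : {set 'I_(size cls)}) :
  uniq W' -> (3 * Q).+1 * th' < size W' -> 0 < th' -> #|U| <= Q ->
  (forall C pq, C \in cls -> pq \in patterns ->
      size (filter (has_pattern C pq) W') <= th' \/ size W' <= size (filter (has_pattern C pq) W')) ->
  exists u, [/\ u \in W', u != v & forall j : 'I_(size cls), j \in U ->
     touches (nth [::] cls j) u -> constant_on W' (nth [::] cls j)].
Proof.
move=> uW szW th'0 UQ H.
pose badj (j : 'I_(size cls)) u := ~~ constant_on W' (nth [::] cls j) && touches (nth [::] cls j) u.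
pose bad u := [exists j in U, badj j u].
have le1 : count bad W' <= \sum_(j in U) count (badj j) W'.
  under eq_bigr do rewrite count_sum; rewrite count_sum exchange_big /=.
  apply: leq_sum => u _; rewrite /bad; case: existsP => //= -[j /andP [jU jb]].
  by rewrite (bigD1 j) //= jb.
have le2 j : count (badj j) W' <= 3 * th'.
  have [cj|ncj] := boolP (constant_on W' (nth [::] cls j)).
    by rewrite (eq_count (a2 := pred0)) ?count_pred0 // => u; rewrite /badj cj.
  apply: (@leq_trans (\sum_(pq <- patterns) count (has_pattern (nth [::] cls j) pq) W')).
    rewrite (eq_bigr (fun pq => \sum_(u <- W') has_pattern (nth [::] cls j) pq u)); last first.
      by move=> pq _; rewrite count_sum.
    rewrite count_sum exchange_big /=; apply: leq_sum => u _; rewrite /badj ncj /=.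
    case tu: (touches _ _) => //; have := touches_pattern tu => /hasP [pq pqP pu].
    by rewrite (big_rem pq) //= pu.
  have le3 pq : pq \in patterns -> count (has_pattern (nth [::] cls j) pq) W' <= th'.
    move=> pqP; rewrite -size_filter; case: (H (nth [::] cls j) pq) => //; first exact: mem_nth.
    move=> le; case/negP: ncj; apply/hasP; exists pq => //; apply/all_filterP/eqP.
    by rewrite -size_subseq_leqif ?filter_subseq // eqn_leq le size_filter count_size.
  rewrite !big_cons big_nil addn0.
  have := le3 (true, false) isT; have := le3 (false, true) isT; have := le3 (true, true) isT; lia.
have le4 : count bad W' <= Q * (3 * th').
  apply: leq_trans le1 _; apply: (@leq_trans (\sum_(j in U) 3 * th')); first by apply: leq_sum.
  by rewrite sum_nat_const leq_mul2r UQ orbT.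
have le5 : 1 < count (predC bad) W' by have := count_predC bad W'; nia.
have : exists u, [/\ u \in W', u != v & ~~ bad u].
  have : uniq (filter (predC bad) W') by rewrite filter_uniq.
  have : 1 < size (filter (predC bad) W') by rewrite size_filter.
  case E : (filter _ _) => [|x [|y s]] // _ /= /andP [xy _].
  have xW : x \in filter (predC bad) W' by rewrite E mem_head.
  have yW : y \in filter (predC bad) W' by rewrite E !inE eqxx orbT.
  move: xW yW; rewrite !mem_filter /= => /andP [bx xW] /andP [by' yW].
  have [e|ne] := eqVneq x v; last by exists x.
  exists y; split=> //; apply: contraNneq xy => ->.
  by rewrite e mem_head.
move=> [u [uW' uv /existsP nb]]; exists u; split=> // j jU tj.
apply: contraT => nc; case: nb; exists j; by rewrite jU /badj nc.
Qed.

(** * The selected variables contain a good solution *)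

Lemma count_iota (p : pred nat) n : count p (iota 0 n) = #|[set v : 'I_n | p v]|.
Proof. by rewrite -[n in iota 0 n]subn0 -sum1_count big_mkord sum1dep_card. Qed.

Lemma card_ord_mem n (s : seq nat) : uniq s -> {subset s <= iota 0 n} ->
  #|[set v : 'I_n | val v \in s]| = size s.
Proof.
move=> us sn; rewrite -(@count_iota (mem s)) -size_filter; apply: perm_size; apply: uniq_perm => //.
  by rewrite filter_uniq ?iota_uniq.
by move=> v; rewrite mem_filter /=; case vs: (v \in s) => //=; exact: sn.
Qed.

Lemma card_ord_mem_le n (s : seq nat) : #|[set v : 'I_n | val v \in s]| <= size s.
Proof.
rewrite cardE -(size_map val); apply: uniq_leq_size; first by rewrite map_inj_uniq ?enum_uniq //; exact: val_inj.
by move=> v /mapP [u]; rewrite mem_enum inE => us ->.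
Qed.

Lemma seqs_uptoP r al (Y : seq nat) : (Y \in seqs_upto r al) = (size Y <= r) && all (mem al) Y.
Proof.
elim: r Y => [|r IH] [|v Y] //=.
rewrite in_cons /=; apply/flattenP/andP => [[s /mapP [Z Zs ->] /mapP [u ual [-> ->]]]|[Yr /andP [val Yal]]].
  by move: Zs; rewrite IH ltnS ual => /andP [-> ->].
by exists [seq u :: Y | u <- al]; apply/mapP; [exists Y; rewrite // IH -ltnS Yr Yal|exists v].
Qed.

Definition asat (A : pred nat) (C : clause) := has (fun l => A l.1 == l.2) C.
Definition aval (A : pred nat) (cls : seq clause) := count (asat A) cls.

Section Select.
Variables (n : nat) (cls : seq clause) (a b k E K0 : nat).
Hypotheses (wf : forall (C : clause) (l : lit), C \in cls -> l \in C -> l.1 < n).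
Hypotheses (a0 : 0 < a) (b0 : 0 < b) (k0 : 0 < k) (E1 : 1 < E) (K : Kfree a b cls).

Notation V := 'I_n.
Notation J := 'I_(size cls).
Definition cl (j : J) := nth [::] cls j.
Definition posv (v : V) (j : J) := mem_lit (cl j) v true.
Definition negv (v : V) (j : J) := mem_lit (cl j) v false.

Notation Opt := (opt posv negv k).
Notation Worth := (worth posv negv).
Notation Negs := (negs negv).
Notation Star := (star posv negv).
Let E0 : 0 < E := ltnW E1.

Lemma cl_mem j : cl j \in cls. Proof. exact: mem_nth. Qed.

Lemma in_star v j : (j \in Star v) = touches (cl j) v.
Proof. by rewrite inE touchesE. Qed.

Lemma has_neg_negs j : (j \in Negs) = has_neg (cl j).
Proof.
rewrite in_negs; apply/existsP/hasP => [[v /mem_litP vj]|[[u []] // uj _]]; first by exists (val v, false).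
by exists (Ordinal (wf (cl_mem j) uj)); apply/mem_litP.
Qed.

Lemma card_star v : #|Star v| = deg_all cls v.
Proof. by rewrite /deg_all (count_card [::]); apply: eq_card => j; rewrite in_star inE. Qed.
Lemma card_negs : #|Negs| = num_neg cls.
Proof. by rewrite /num_neg (count_card [::]); apply: eq_card => j; rewrite has_neg_negs inE. Qed.
Lemma card_dneg v : dneg posv negv v = deg_neg cls v.
Proof.
rewrite /deg_neg (count_card [::]); apply: eq_card => j.
by rewrite in_setI in_star has_neg_negs inE andbC.
Qed.
Lemma card_dpos v : dpos posv negv v = deg_pos cls v.
Proof.
rewrite /deg_pos (count_card [::]); apply: eq_card => j.
by rewrite in_setD in_star has_neg_negs inE.
Qed.

Lemma Kfree_card (B : {set J}) : #|B| = b -> #|[set v | B \subset Star v]| < a.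
Proof.
move=> Bb; rewrite ltnNge; apply/negP => le.
pose A := take a [seq val v | v <- enum [set v | B \subset Star v]].
have uA : uniq A by rewrite take_uniq // map_inj_uniq ?enum_uniq //; exact: val_inj.
have sA : size A = a by rewrite size_takel // size_map -cardE.
have := K uA sA; rewrite ltnNge -Bb (count_card [::]); case/negP.
apply: subset_leq_card; apply/subsetP => j jB; rewrite inE; apply/allP => x /mem_take.
by move=> /mapP [v]; rewrite mem_enum inE => /subsetP /(_ j jB); rewrite in_star => ? ->.
Qed.

Lemma worth_aval (A : pred nat) (Y : {set V}) : (forall v : V, A v = (v \in Y)) ->
  Worth Y = aval A cls.
Proof.
move=> AY; rewrite /aval (count_card [::]); apply: eq_card => j; rewrite !inE -/(cl j).
apply/orP/hasP => [[/existsP [v /andP [vY /mem_litP vj]]|/existsP [v /andP [vY /mem_litP vj]]]|].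
- by exists (val v, true); rewrite //= AY vY.
- by exists (val v, false); rewrite //= AY (negbTE vY).
move=> [[u s] uj /=]; have un : u < n := wf (cl_mem j) uj.
rewrite -[u]/(val (Ordinal un)) AY => /eqP e.
case: s e uj => e uj; [left|right]; apply/existsP; exists (Ordinal un); rewrite e /=; exact/mem_litP.
Qed.

Definition light_vars := [seq v <- iota 0 n | ~~ heavy b E cls k v].

Lemma select_pos_spec (R := select_pos a b E n cls k) (t := pos_quota a b E k) :
  [/\ uniq R, {subset R <= light_vars}, size R <= t,
    forall u v, u \in R -> v \in light_vars -> v \notin R -> deg_pos cls v <= deg_pos cls u &
    R = light_vars \/ t <= size R].
Proof.
pose P W := [/\ uniq W, {subset W <= light_vars},
    forall u v, u \in W -> v \in light_vars -> v \notin W -> deg_pos cls v <= deg_pos cls u &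
    W = light_vars \/ t <= size W].
have step W : P W -> t < size W -> P [seq u <- W | ~~ (u == argmin (deg_pos cls) W)].
  move=> [uW sW tW bW] lt; have [mW mmin] := argminP (deg_pos cls) (leq_ltn_trans (leq0n _) lt).
  set m := argmin _ _ in mW mmin *; split.
  - by rewrite filter_uniq.
  - by move=> v; rewrite mem_filter => /andP [_ /sW].
  - move=> u v; rewrite mem_filter => /andP [um uW'] vL.
    rewrite mem_filter negb_and negbK => /orP [/eqP ->|vW].
      exact: mmin.
    exact: (tW u v).
  right; rewrite -rem_filter // size_rem //; lia.
have P0 : P light_vars by split=> //; [rewrite filter_uniq ?iota_uniq|move=> u v _ -> |left].
have [uR sR tR bR] := @prune_ind t id (deg_pos cls) P step n _ P0.
split=> //; apply: (@size_prune t id (deg_pos cls) P step _ n _ P0).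
  move=> W _ lt; exact: (argminP (deg_pos cls) (leq_ltn_trans (leq0n _) lt)).1.
by rewrite size_filter; apply: leq_trans (count_size _ _) _; rewrite size_iota leq_addl.
Qed.

(** Invariant of the deletion: if the optimum is small, some optimal solution survives. If it
    contains the deleted variable, which has least degree in the core, [swap_case] repairs it with
    the member supplied by [core_avoid]. *)
Lemma select_core_spec (D := select_core a b E n cls k) :
  [/\ uniq D, {subset D <= iota 0 n}, size D <= core_quota a b E k b &
    Opt <= opt_bound b E k ->
    exists Y : {set V}, [/\ #|Y| <= k, Worth Y = Opt & forall v, v \in Y -> val v \in D]].
Proof.
pose B := opt_bound b E k; pose th := core_quota a b E k; pose cr := core cls th b.
pose P W := [/\ uniq W, {subset W <= iota 0 n} & Opt <= B ->
    exists Y : {set V}, [/\ #|Y| <= k, Worth Y = Opt & forall v, v \in Y -> val v \in W]].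
have th0 : th 0 = a by rewrite /th /core_quota expn0 muln1.
(* Exactly the ratio that [core_avoid] asks for with [Q = 2 * B]. *)
have thS r : th r.+1 = (3 * (2 * B)).+1 * th r.
  by rewrite /th /core_quota expnS mulnCA -/B; congr (_ * _); lia.
have thp r : 0 < th r by rewrite /th /core_quota muln_gt0 a0 expn_gt0 addn1.
have cr_spec W : uniq W -> th b < size W -> argmin (deg_all cls) (cr W) \in W /\
    (argmin (deg_all cls) (cr W) \in cr W /\ forall u, u \in cr W -> deg_all cls (argmin (deg_all cls) (cr W)) <= deg_all cls u).
  move=> uW lt; have [//|sW _ [r' [lt' _]]] := core_spec K th0 uW lt; first exact: leq_addr.
  have sz : 0 < size (cr W) by apply: leq_ltn_trans lt'.
  by have [mW mmin] := argminP (deg_all cls) sz; split=> //; exact: sW.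
have step W : P W -> th b < size W -> P [seq u <- W | ~~ (u == argmin (deg_all cls) (cr W))].
  move=> [uW sW optW] lt; have [mW [mC mmin]] := cr_spec W uW lt.
  set m := argmin _ _ in mW mC mmin *; split.
  - by rewrite filter_uniq.
  - by move=> v; rewrite mem_filter => /andP [_ /sW].
  move=> optB; have [Y [Yk Yopt YW]] := optW optB.
  have mn : m < n by have := sW m mW; rewrite mem_iota.
  pose v : V := Ordinal mn.
  have [vY|vY] := boolP (v \in Y); last first.
    exists Y; split=> // u uY; rewrite mem_filter YW // andbT.
    by apply: contraNneq vY => e; rewrite (_ : v = u) //; apply: val_inj.
  have [//|subC uC [r' [szC Hc]]] := core_spec K th0 uW lt; first exact: leq_addr.
  rewrite -/(cr W) in subC uC szC Hc.
  pose A := [set j : J | constant_on (cr W) (cl j)].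
  have Hsame (u : V) j : val u \in cr W -> j \in A -> same_on posv negv u v j /\ j \in Star v.
    move=> uC'; rewrite inE => /hasP [pq pqP /allP H].
    have h1 := H _ uC'; have h2 := H _ mC; split.
      by move: h1 h2; rewrite /same_on /has_pattern => /andP [/eqP e1 /eqP e2] /andP [/eqP e3 /eqP e4];
         rewrite /posv /negv e1 e2 /= e3 e4 !eqxx.
    rewrite in_star; exact: pattern_touches pqP h2.
  have [||||||| u [uW' uv le]] := swap_case (pos := posv) (neg := negv) (k := k) (Y := Y)
      (W := [set u : V | val u \in cr W]) (A := A) (v := v).
  - exact: vY.
  - exact: Yk.
  - by rewrite inE.
  - by move=> u; rewrite inE !card_star => /mmin.
  - by apply/subsetP => j jA; exact: (Hsame v j mC jA).2.
  - by move=> u j; rewrite inE => uC' jA; exact: (Hsame u j uC' jA).1.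
  - move=> U UO; have [||||u [uC' uv H]] := @core_avoid cls (cr W) (th r') (2 * B) m U uC.
    + by rewrite -thS.
    + exact: thp.
    + by apply: leq_trans UO _; rewrite leq_mul2l optB.
    + exact: Hc.
    have un : u < n by have := sW u (subC u uC'); rewrite mem_iota.
    exists (Ordinal un); split; first by rewrite inE.
      by apply: contraNneq uv => /(congr1 val) /= ->.
    by apply/subsetP => j; rewrite inE in_star => /andP [tj jU]; rewrite inE; exact: H.
  have Yk' : #|u |: Y :\ v| <= k.
    rewrite cardsU1; have := cardsD1 v Y; rewrite vY => e.
    by apply: leq_trans Yk; rewrite e leq_add2r; case: (_ \notin _).
  exists (u |: Y :\ v); split=> //.
    by apply/eqP; rewrite eqn_leq worth_le_opt //= -Yopt.
  move=> w; rewrite in_setU1 in_setD1 mem_filter => /orP [/eqP ->|/andP [wv wY]].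
    by rewrite inE in uW'; rewrite subC // andbT; apply: contraNneq uv => e; apply/eqP; apply: val_inj.
  by rewrite YW // andbT; apply: contraNneq wv => e; apply/eqP; apply: val_inj.
have P0 : P (iota 0 n).
  split=> //; first exact: iota_uniq.
  move=> _; have [Y Yk Yo] := opt_attained posv negv k.
  by exists Y; split=> // v _; rewrite mem_iota /=.
have [uD sD oD] := @prune_ind (th b) cr (deg_all cls) P step n _ P0.
split=> //; apply: (@size_prune (th b) cr (deg_all cls) P step _ n _ P0).
  by move=> W [uW _ _] lt; have [] := cr_spec W uW lt.
by rewrite size_iota leq_addl.
Qed.

Lemma count_memn_le W : count (memn W) (iota 0 n) <= size W.
Proof.
rewrite -size_filter; apply: uniq_leq_size; first by rewrite filter_uniq ?iota_uniq.
by move=> v; rewrite mem_filter memnE => /andP [].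
Qed.

Lemma size_select_large : size (select_large a b E n cls k) <=
  a * (b * (k * E)) ^ b + pos_quota a b E k + core_quota a b E k b.
Proof.
rewrite size_filter; set R := select_pos _ _ _ _ _ _; set D := select_core _ _ _ _ _ _.
have U (p q : pred nat) s : count (fun v => p v || q v) s <= count p s + count q s.
  by rewrite -count_predUI leq_addr.
apply: leq_trans (U _ _ _) _; rewrite -addnA leq_add //.
  rewrite count_iota; apply: (card_dense (pos := posv) (neg := negv) b0 Kfree_card (U := Negs)) => v.
  by rewrite inE /heavy card_negs -(card_dneg v) => /andP [].
apply: leq_trans (U _ _ _) _; rewrite leq_add //.
  by apply: leq_trans (count_memn_le _) _; have [] := select_pos_spec.
by apply: leq_trans (count_memn_le _) _; have [] := select_core_spec.
Qed.

Lemma mem_select_large (v : V) : (val v \in select_large a b E n cls k) =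
  [|| heavy b E cls k v, val v \in select_pos a b E n cls k | val v \in select_core a b E n cls k].
Proof. by rewrite mem_filter mem_iota /= ltn_ord andbT !memnE. Qed.

Lemma select_large_opt : exists Y : {set V}, [/\ #|Y| <= k,
  forall v, v \in Y -> val v \in select_large a b E n cls k & E * Opt <= E * Worth Y + 4 * Opt].
Proof.
have [_ _ _ oD] := select_core_spec.
have [low|high] := leqP Opt (opt_bound b E k).
  have [Y [Yk YO YD]] := oD low; exists Y; split=> // [v vY|]; last by rewrite YO leq_addr.
  by rewrite mem_select_large YD ?orbT.
have [uR sR _ tR bR] := select_pos_spec; set R := select_pos _ _ _ _ _ _ in uR sR tR bR.
pose H := [set v : V | heavy b E cls k v].
pose RS := [set v : V | val v \in R].
have RH (v : V) : val v \in R -> ~~ heavy b E cls k v.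
  by move=> /sR; rewrite mem_filter => /andP [].
have inL (v : V) : (val v \in light_vars) = ~~ heavy b E cls k v.
  by rewrite mem_filter mem_iota /= ltn_ord andbT.
have [|||||||Y [YHR Yk YO]] := high_case (pos := posv) (neg := negv) (k := k) b0 k0 E0 Kfree_card (H := H) (R := RS)
    (t := pos_quota a b E k).
- by move=> v; rewrite !inE => /RH.
- move=> v; rewrite inE /heavy negb_and -!ltnNge card_dneg card_negs => /orP [lt|lt]; [left|right]; exact: lt.
- move=> u v; rewrite !inE !card_dpos => uR' vH vR; apply: tR => //.
  by rewrite inL.
- case: bR => [e|le]; [right|left].
    by move=> v; rewrite !inE e inL.
  rewrite card_ord_mem // => v /sR; by rewrite mem_filter => /andP [].
- by rewrite /pos_quota addn1.
- exact: ltnW.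
- exact: E1.
exists Y; split=> // v vY; rewrite mem_select_large.
by have := subsetP YHR v vY; rewrite !inE => /orP [->|->]; rewrite ?orbT.
Qed.

Lemma value_aval (Y : seq nat) : value cls Y = aval (mem Y) cls.
Proof. by apply: eq_count => C; apply: eq_has => l; rewrite memnE. Qed.

Lemma best_set_spec (Y := best_set K0 n cls k) : k <= K0 ->
  size Y <= k /\ Opt <= Worth [set v : V | val v \in Y].
Proof.
move=> kK; have [Z Zk ZO] := opt_attained posv negv k.
pose Zs := [seq val v | v <- enum Z].
have ZsE (v : V) : (val v \in Zs) = (v \in Z) by rewrite mem_map ?mem_enum //; exact: val_inj.
have sZ : size Zs = #|Z| by rewrite size_map -cardE.
set cand := small_sets K0 n k.
have inc_cand W : W \in cand -> size W <= k by rewrite mem_filter => /andP [].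
have Zcand : Zs \in cand.
  rewrite mem_filter seqs_uptoP sZ Zk (leq_trans Zk kK) /=; apply/allP => v /mapP [u _ ->].
  by rewrite /= mem_iota /=.
set bests := [seq Y <- cand | all (fun Y' => value cls Y' <= value cls Y) cand].
have b0' : bests != [::].
  rewrite -has_filter; pose f W := value cls W.
  (* [m - f W == 0] means [m <= f W]: [m] is the maximum of [f] on [cand], obtained as its least
     upper bound. *)
  have : exists m, has (fun W => m - f W == 0) cand && all (fun W => f W <= m) cand.
    have [m mP] : exists m, all (fun W => f W <= m) cand.
      exists (\sum_(W <- cand) f W); apply/allP => W Wc.
      by rewrite (big_rem W) //= leq_addr.
    have [m' /andP [_ mP'] mmin] := ex_minnP (ex_intro (fun m => true && all (fun W => f W <= m) cand) m mP).
    exists m'; rewrite mP' andbT; apply: contraT => /hasPn none.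
    have m0 : 0 < m'.
      by have := none _ Zcand; rewrite subn_eq0 -ltnNge; lia.
    have := mmin m'.-1; rewrite leqNgt ltn_predL m0 /=; case/(_ _)/negP => //.
    by apply/allP => W Wc; have := none W Wc; rewrite subn_eq0 -ltnNge; lia.
  move=> [m /andP [/hasP [W Wc Wm] /allP mP]]; apply/hasP; exists W => //.
  by apply/allP => W' /mP; rewrite -/(f W') -/(f W); rewrite subn_eq0 in Wm; lia.
have Yb : Y \in bests by rewrite /Y /best_set -/cand -/bests; case: (bests) b0' => // W s _; exact: mem_head.
move: Yb; rewrite mem_filter => /andP [/allP /(_ _ Zcand) le Yc]; split; first exact: inc_cand.
have e1 : Worth Z = aval (mem Zs) cls by apply: worth_aval.
have e2 : Worth [set v : V | val v \in Y] = aval (mem Y) cls by apply: worth_aval => v; rewrite [RHS]inE.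
by rewrite -ZO e1 e2 -!value_aval.
Qed.

Lemma select_spec (T := select a b E K0 n cls k) :
  [/\ uniq T, {subset T <= iota 0 n},
    size T <= (if K0 <= k then a * (b * (k * E)) ^ b + pos_quota a b E k + core_quota a b E k b else k) &
    exists Y : {set V}, [/\ #|Y| <= k, forall v, v \in Y -> val v \in T & E * Opt <= E * Worth Y + 4 * Opt]].
Proof.
rewrite /T /select; case: leqP => kK.
  split; [by rewrite filter_uniq ?iota_uniq| |exact: size_select_large|exact: select_large_opt].
  by move=> v; rewrite mem_filter => /andP [].
have [sY optY] := best_set_spec (ltnW kK); set Y := best_set _ _ _ _ in sY optY *.
split; first by rewrite filter_uniq ?iota_uniq.
- by move=> v; rewrite mem_filter => /andP [].
- by rewrite size_filter; apply: leq_trans (count_memn_le _) sY.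
exists [set v : V | val v \in Y]; split.
- exact: leq_trans (card_ord_mem_le _ _) sY.
- by move=> v; rewrite inE mem_filter memnE mem_iota /= ltn_ord andbT.
- by apply: leq_trans (leq_addr _ _); rewrite leq_mul2l optY orbT.
Qed.

End Select.

(** * Reducing the clauses *)

Lemma size_seqs_upto r al : size (seqs_upto r al) <= (size al).+1 ^ r.
Proof.
elim: r => //= r IH.
have -> : size (flatten [seq [seq v :: Y | v <- al] | Y <- seqs_upto r al]) = size (seqs_upto r al) * size al.
  by elim: (seqs_upto r al) => //= Y s IHs; rewrite size_cat size_map IHs mulSn.
have h : 0 < (size al).+1 ^ r by rewrite expn_gt0.
by rewrite expnS; nia.
Qed.

Lemma count_types (T : eqType) (p : pred T) (U S : seq T) : uniq U -> {subset S <= U} ->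
  count p S = \sum_(x <- U) p x * count_mem x S.
Proof.
move=> uU; elim: S => [|x S IH] sub; first by rewrite big1 // => x _; rewrite muln0.
rewrite /= IH; last by move=> y yS; apply: sub; rewrite inE yS orbT.
under [in RHS]eq_bigr do rewrite mulnDr; rewrite big_split /=; congr (_ + _).
rewrite (bigD1_seq x) ?sub ?mem_head //= eqxx muln1 big1 ?addn0 // => y.
by rewrite eq_sym => /negbTE ->; rewrite muln0.
Qed.

Lemma map_nth_self (L : seq clause) : L = [seq nth [::] L j | j <- iota 0 (size L)].
Proof. by rewrite map_nth_iota0 // take_size. Qed.

Section Sample.
Variables (a m s : nat).
Hypothesis s0 : 0 < s.
Notation small := (small_clause a m).

(** The decision on a position looks only at earlier copies, so appending a clause leaves the
    earlier decisions unchanged. *)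
Lemma sample_rcons L x : sample a m s (rcons L x) =
  sample a m s L ++ (if small x && (s %| (count_mem x L).+1) then [:: x] else [::]).
Proof.
rewrite /sample size_rcons -[(size L).+1]addn1 iotaD filter_cat map_cat /= add0n.
have nthL j : j < size L -> nth [::] (rcons L x) j = nth [::] L j by move=> lt; rewrite nth_rcons lt.
congr cat.
  have -> : [seq j <- iota 0 (size L) | small (nth [::] (rcons L x) j) &&
      (s %| (count (fun i => nth [::] (rcons L x) i == nth [::] (rcons L x) j) (iota 0 j)).+1)] =
    [seq j <- iota 0 (size L) | small (nth [::] L j) &&
      (s %| (count (fun i => nth [::] L i == nth [::] L j) (iota 0 j)).+1)].
    apply: eq_in_filter => j; rewrite mem_iota add0n /= => lt; rewrite nthL //; congr (_ && (_ %| _.+1)).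
    by apply: eq_in_count => i; rewrite mem_iota add0n /= => li; rewrite nthL //; exact: ltn_trans lt.
  by apply/eq_in_map => j; rewrite mem_filter mem_iota add0n /= => /andP [_ lt]; rewrite nthL.
have nx : nth [::] (rcons L x) (size L) = x by rewrite nth_rcons ltnn eqxx.
rewrite nx; have -> : count (fun i => nth [::] (rcons L x) i == x) (iota 0 (size L)) = count_mem x L.
  rewrite [X in _ = count_mem x X](map_nth_self L) count_map.
  by apply: eq_in_count => i; rewrite mem_iota add0n /= => li; rewrite nthL.
by case: ifP => _ //=; rewrite nx.
Qed.

Lemma count_sample x L : count_mem x (sample a m s L) = small x * (count_mem x L %/ s).
Proof.
elim/last_ind: L => [|L y IH]; first by rewrite /= div0n muln0.
rewrite sample_rcons count_cat IH -cats1 count_cat /= addn0.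
have [->|ne] := eqVneq y x; last first.
  by rewrite addn0; case: ifP => _ //=; rewrite ?(negbTE ne) ?addn0.
by rewrite addn1 divnS // mulnDr [RHS]addnC; congr (_ + _); case: (small x) => //=; case: (_ %| _); rewrite /= ?eqxx.
Qed.

Lemma sample_sub L : {subset sample a m s L <= L}.
Proof.
by move=> x /mapP [j]; rewrite mem_filter mem_iota add0n => /andP [_ /= lt] ->; exact: mem_nth.
Qed.

Lemma count_sample_le p L : count p (sample a m s L) <= count p L.
Proof.
rewrite count_map -size_filter -filter_predI size_filter.
rewrite [X in _ <= count p X](map_nth_self L) count_map.
by apply: sub_count => j /= /andP [].
Qed.

Lemma sample_lower p L : s * count p (sample a m s L) <= count p L.
Proof.
rewrite (count_types p (undup_uniq L)) => [|x /sample_sub]; last by rewrite mem_undup.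
rewrite (count_types p (undup_uniq L) (S := L)) => [|x]; last by rewrite mem_undup.
rewrite big_distrr /=; apply: leq_sum => x _; rewrite count_sample.
rewrite mulnCA leq_mul2l; apply/orP; right.
by apply: leq_trans (leq_divM (count_mem x L) s); rewrite mulnC leq_mul2r; case: (small x); rewrite /= ?mul1n ?leqnn ?orbT.
Qed.

(** Rounding loses fewer than [s] copies of each distinct small clause; clauses that are not small
    are lost altogether. *)
Lemma sample_upper p L : count p L <= s * count p (sample a m s L) +
  s * size [seq c <- undup L | small c] + count (fun c => ~~ small c) L.
Proof.
rewrite (count_types p (undup_uniq L) (S := L)) => [|x]; last by rewrite mem_undup.
rewrite (count_types p (undup_uniq L)) => [|x /sample_sub]; last by rewrite mem_undup.
rewrite size_filter count_sum (count_types (fun c => ~~ small c) (undup_uniq L) (S := L)); last first.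
  by move=> x; rewrite mem_undup.
rewrite !big_distrr -!big_split /=; apply: leq_sum => x _; rewrite count_sample.
have := ltn_ceil (count_mem x L) s0; move: (count_mem x L %/ s) => q.
by case: (small x); case: (p x) => /=; rewrite ?mul0n ?muln0 ?mul1n ?muln1; nia.
Qed.
End Sample.

(** * Optimum of a clause list, and its behaviour under restriction and sampling *)

Definition ropt N (ls : seq clause) k := opt (@posv N ls) (@negv N ls) k.

Section Ropt.
Variables (N : nat) (ls : seq clause) (k : nat).
Hypothesis wf : forall (C : clause) (l : lit), C \in ls -> l \in C -> l.1 < N.

Lemma ropt_ge (A : seq nat) : size A <= k -> aval (mem A) ls <= ropt N ls k.
Proof.
move=> Ak; have e : worth (@posv N ls) (@negv N ls) [set v : 'I_N | val v \in A] = aval (mem A) ls.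
  by apply: worth_aval => // v; rewrite [RHS]inE.
rewrite -e; apply: worth_le_opt; exact: leq_trans (card_ord_mem_le _ _) Ak.
Qed.

Lemma ropt_attained : exists A : seq nat, size A <= k /\ aval (mem A) ls = ropt N ls k.
Proof.
have [Y Yk YO] := opt_attained (@posv N ls) (@negv N ls) k.
exists [seq val v | v <- enum Y]; rewrite size_map -cardE; split=> //.
rewrite /ropt -YO; apply/esym/worth_aval => // v.
by rewrite /= mem_map ?mem_enum //; exact: val_inj.
Qed.
End Ropt.

Section Reduce.
Variables (T : seq nat) (cls : seq clause).
Hypothesis uT : uniq T.
Notation m := (size T).
Notation rc := (reduced_clause T).
Notation L := (reduced T cls).

Lemma mem_reduced_clause C p s : ((p, s) \in rc C) = (p < m) && mem_lit C (nth 0 T p) s.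
Proof.
rewrite mem_cat; apply/orP/andP => [[]/mapP [q]|[pm Cp]].
- by rewrite mem_filter mem_iota add0n => /andP [Cq /= qm] [-> ->].
- by rewrite mem_filter mem_iota add0n => /andP [Cq /= qm] [-> ->].
case: s Cp => Cp; [left|right]; apply/mapP; exists p => //; by rewrite mem_filter Cp mem_iota.
Qed.

Lemma mem_L c : c \in L -> exists2 C, C \in cls & c = rc C /\ 0 < size c.
Proof.
by rewrite mem_filter => /andP [c0 /mapP [C]]; rewrite mem_filter => /andP [_ Cc] e; exists C.
Qed.

Lemma lit_L (c : clause) (l : lit) : c \in L -> l \in c -> l.1 < m.
Proof. by move=> /mem_L [C _ [-> _]]; case: l => p s; rewrite mem_reduced_clause => /andP []. Qed.

Lemma asat_reduced (A A' : pred nat) C : (forall v, A v -> v \in T) ->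
  (forall p, p < m -> A (nth 0 T p) = A' p) -> ~~ neg_outside T C -> asat A C = asat A' (rc C).
Proof.
move=> AT AA' /hasPn nC; apply/hasP/hasP => [[[v s] vC /= /eqP vs]|[[p s]]].
  have vT : v \in T.
    case: s vs vC => vs vC; first by apply: AT; rewrite vs.
    by have := nC _ vC; rewrite memnE /= negbK.
  have pm : index v T < m by rewrite index_mem.
  exists (index v T, s); first by rewrite mem_reduced_clause pm nth_index //; apply/mem_litP.
  by rewrite /= -AA' // nth_index // vs.
rewrite mem_reduced_clause => /andP [pm /mem_litP Cp] /= /eqP e.
by exists (nth 0 T p, s); rewrite //= AA' // e.
Qed.

Lemma aval_reduced (A A' : pred nat) : (forall v, A v -> v \in T) ->
  (forall p, p < m -> A (nth 0 T p) = A' p) ->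
  aval A cls = count (neg_outside T) cls + aval A' L.
Proof.
move=> AT AA'; rewrite /aval /reduced.
have -> : count (asat A') [seq c <- [seq rc C | C <- [seq C <- cls | ~~ neg_outside T C]] | 0 < size c] =
   count (asat A') [seq rc C | C <- [seq C <- cls | ~~ neg_outside T C]].
  rewrite -!size_filter -filter_predI; congr (size _); apply: eq_filter => c /=.
  by case: c => //= l c; rewrite andbT.
rewrite count_map; elim: cls => //= C s IH; rewrite IH.
case nC: (neg_outside T C) => /=.
  suff -> : asat A C by rewrite addnA.
  move: nC => /hasP [[v []] // vC /= vT]; apply/hasP; exists (v, false) => //=.
  by case Av: (A v) => //; rewrite memnE AT in vT.
by rewrite (@asat_reduced A A') ?nC // add0n addnCA.
Qed.

Lemma touches_reduced C p : touches (rc C) p = (p < m) && touches C (nth 0 T p).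
Proof.
rewrite !touchesE; apply/orP/andP => [[]/mem_litP|[pm /orP []Cp]].
- by rewrite mem_reduced_clause => /andP [-> ->].
- by rewrite mem_reduced_clause => /andP [-> ->]; rewrite orbT.
- by left; apply/mem_litP; rewrite mem_reduced_clause pm.
- by right; apply/mem_litP; rewrite mem_reduced_clause pm.
Qed.

Lemma Kfree_reduced a b : 0 < a -> 0 < b -> Kfree a b cls -> Kfree a b L.
Proof.
move=> a0 b0 K A uA sA.
have [/allP Am|/allPn [p pA pm]] := boolP (all (fun p => p < m) A); last first.
  rewrite (eq_in_count (a2 := pred0)) ?count_pred0 // => c /mem_L [C _ [-> _]].
  by apply/negbTE/allPn; exists p => //; rewrite touches_reduced (negbTE pm).
have uA' : uniq [seq nth 0 T p | p <- A].
  by rewrite map_inj_in_uniq // => p q /Am pm /Am qm /eqP; rewrite nth_uniq // => /eqP.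
apply: leq_ltn_trans (K _ uA' _); last by rewrite size_map.
rewrite /reduced count_filter count_map count_filter; apply: sub_count => C /=.
move=> /andP [/andP [/allP H _] _]; apply/allP => v /mapP [p pA ->].
by have := H p pA; rewrite touches_reduced => /andP [].
Qed.

(** A reduced clause is nonempty, so the empty set or one of the [m] singletons satisfies it; each
    of these [m.+1] solutions satisfies at most the optimum. *)
Lemma size_L_le k : 0 < k -> size L <= m.+1 * ropt m L k.
Proof.
move=> k0; have H := ropt_ge (N := m) (k := k) (ls := L) lit_L.
apply: (@leq_trans (aval (mem [::]) L + \sum_(p <- iota 0 m) aval (mem [:: p]) L)).
  rewrite /aval count_sum; under [X in _ + X]eq_bigr do rewrite count_sum.
  rewrite exchange_big -big_split /= -[size L]sum1_size.
  rewrite big_seq [X in _ <= X]big_seq; apply: leq_sum => c cL.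
  have [C _ [_ c0]] := mem_L cL; case: c c0 cL => // -[p s] c _ cL.
  have pm : p < m := lit_L cL (mem_head _ _).
  case: s cL => cL; last by rewrite /asat /= .
  rewrite (big_rem p) ?mem_iota //= /asat /= !inE eqxx /=; lia.
rewrite mulSn leq_add ?H //.
apply: (@leq_trans (\sum_(p <- iota 0 m) ropt m L k)); first by apply: leq_sum => p _; exact: H.
by rewrite big_const_seq iter_addn_0 count_predT size_iota mulnC.
Qed.

Section Quota.
Variables (a b E : nat).
Hypotheses (a0 : 0 < a) (b0 : 0 < b) (E1 : 1 < E) (K : Kfree a b cls).
Notation small := (small_clause a m).
Notation Mb := (clause_quota a b E m.+1).
Notation S := (sparsified a b E T cls).
Notation sc := (scale a b E T cls).

(** Each of these clauses contains one of at most [m.+1 ^ a] lists of [a] distinct variables, and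
    each such list lies in fewer than [b] clauses. *)
Lemma count_big : count (fun c => ~~ small c) L <= b * m.+1 ^ a.
Proof.
pose F := [seq A <- seqs_upto a (iota 0 m) | uniq A && (size A == a)].
apply: (@leq_trans (\sum_(A <- F) count (fun c => all (touches c) A) L)).
  rewrite count_sum; under [X in _ <= X]eq_bigr do rewrite count_sum.
  rewrite exchange_big /= big_seq [X in _ <= X]big_seq; apply: leq_sum => c cL.
  case sm: (small c) => //=; move/negbT: sm; rewrite -leqNgt => le; pose A := take a [seq p <- iota 0 m | touches c p].
  have AF : A \in F.
    have sA : size A = a by rewrite size_takel // size_filter.
    rewrite mem_filter seqs_uptoP sA eqxx leqnn andbT take_uniq ?filter_uniq ?iota_uniq //=.
    by apply/allP => p /mem_take; rewrite mem_filter => /andP [].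
  rewrite (big_rem A) //= (_ : all (touches c) A) ?add1n //.
  by apply/allP => p /mem_take; rewrite mem_filter => /andP [].
apply: (@leq_trans (\sum_(A <- F) b)).
  rewrite big_seq [X in _ <= X]big_seq; apply: leq_sum => A; rewrite mem_filter => /andP [/andP [uA /eqP sA] _].
  by apply: ltnW; apply: (Kfree_reduced a0 b0 K).
rewrite big_const_seq iter_addn_0 count_predT leq_mul2l; apply/orP; right.
rewrite size_filter; apply: leq_trans (count_size _ _) _.
by apply: leq_trans (size_seqs_upto _ _) _; rewrite size_iota.
Qed.

(** A small reduced clause lists fewer than [a] literals of either sign, without repetition. Coding
    [(p, s)] as [2 * p + s] makes it a word of length at most [2 * a] over [2 * m] letters. *)
Lemma size_small_types : size [seq c <- undup L | small c] <= (2 * m.+1) ^ (2 * a).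
Proof.
pose enc_l (l : lit) := l.1.*2 + l.2.
have inj : injective enc_l.
  move=> [p s] [q t]; rewrite /enc_l /= => e.
  have ep : p = q by case: s t e => [] [] /=; lia.
  by move: e; rewrite ep => /addnI; case: s t => [] [].
rewrite -(size_map (map enc_l)); apply: (@leq_trans (size (seqs_upto (2 * a) (iota 0 (2 * m))))).
  apply: uniq_leq_size.
    by rewrite map_inj_uniq ?filter_uniq ?undup_uniq //; exact: inj_map.
  move=> w /mapP [c]; rewrite mem_filter mem_undup => /andP [sm cL] ->.
  rewrite seqs_uptoP size_map; apply/andP; split.
    have [C _ [e _]] := mem_L cL.
    have le s : size [seq p <- iota 0 m | mem_lit C (nth 0 T p) s] < a.
      apply: leq_ltn_trans sm; rewrite size_filter -!size_filter; apply: uniq_leq_size.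
        by rewrite filter_uniq ?iota_uniq.
      move=> p; rewrite !mem_filter mem_iota add0n /= => /andP [Cp pm].
      by rewrite pm e touches_reduced pm touchesE andbT; case: s Cp => ->; rewrite ?orbT.
    rewrite e size_cat !size_map; have := le true; have := le false; lia.
  rewrite all_map; apply/allP => -[p s] lc /=; have := lit_L cL lc.
  by rewrite mem_iota /enc_l /=; case: s {lc}; lia.
apply: leq_trans (size_seqs_upto _ _) _; rewrite size_iota; apply: leq_expr; lia.
Qed.

Lemma quota_gt0 : 0 < Mb.
Proof. by rewrite /clause_quota !muln_gt0 expn_gt0 b0 (ltnW E1). Qed.

Lemma size_sparsified : size S < 2 * Mb.
Proof.
have Mb0 := quota_gt0; rewrite /sparsified; case: (leqP sc 1) => le.
  by rewrite -ltn_divLR.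
have s0 : 0 < sc by exact: ltnW.
have := sample_lower a m s0 predT L; rewrite !count_predT => le1.
have := ltn_ceil (size L) Mb0; rewrite -/sc => le2.
rewrite ltnNge; apply/negP => le3.
by have := leq_mul (leqnn sc) le3; nia.
Qed.

Lemma sparsified_sub : {subset S <= L}.
Proof. by move=> x; rewrite /sparsified; case: ifP => // _ /sample_sub. Qed.

Lemma Kfree_sparsified : Kfree a b S.
Proof.
rewrite /sparsified; case: ifP => _; first exact: Kfree_reduced a0 b0 K.
by move=> A uA sA; apply: leq_ltn_trans (count_sample_le _ _ _ _ _) _; apply: (Kfree_reduced a0 b0 K).
Qed.

(** The optimum is at least [size L / m.+1], and by the choice of the quota this dominates both the
    rounding losses and the discarded clauses. *)
Lemma sparsified_approx k : 0 < k -> exists2 s', 0 < s' & forall A : pred nat,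
  s' * aval A S <= aval A L /\ E * aval A L <= E * s' * aval A S + ropt m L k.
Proof.
move=> k0; rewrite /sparsified; case: (leqP sc 1) => le.
  by exists 1 => // A; rewrite mul1n muln1; split=> //; exact: leq_addr.
have s0 : 0 < sc by exact: ltnW.
exists sc => // A; split; first exact: sample_lower.
have up := sample_upper a m s0 (asat A) L; rewrite -!/(aval A _) in up.
have M1 := count_big; have M2 := size_small_types.
have le1 : sc * Mb <= m.+1 * ropt m L k.
  by apply: leq_trans (size_L_le k0); rewrite /scale leq_divM.
set O := ropt m L k in le1 *; set n1 := m.+1 in M1 M2 le1.
have n10 : 0 < n1 by [].
pose Q := (2 * n1) ^ (2 * a).
(* Each of the two losses, multiplied by [E], will be at most [sc * (E * b * Q)], a quarter of
   this. *)
have le2 : sc * (4 * E * b * Q) <= O.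
  rewrite -(leq_pmul2l n10); apply: leq_trans le1; rewrite /clause_quota addn1 expnS -/Q -/n1.
  by rewrite leq_eqVlt; apply/orP; left; apply/eqP; nia.
have le3 : n1 ^ a <= Q.
  apply: leq_trans (_ : _ <= (2 * n1) ^ a) _; first by apply: leq_expr; lia.
  by apply: leq_pexp2l; lia.
have le4 : E * (sc * size [seq c <- undup L | small c]) <= sc * (E * b * Q).
  rewrite mulnCA leq_mul2l -mulnA leq_mul2l; apply/orP; right; apply/orP; right.
  by apply: leq_trans M2 _; rewrite leq_pmull.
have le5 : E * count (fun c => ~~ small c) L <= sc * (E * b * Q).
  apply: (@leq_trans (E * (b * Q))); last by rewrite mulnA leq_pmull.
  by rewrite leq_mul2l; apply/orP; right; apply: leq_trans M1 _; rewrite leq_mul2l le3 orbT.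
have := leq_mul (leqnn E) up; rewrite !mulnDr mulnA => le6.
have e : sc * (4 * E * b * Q) = 4 * (sc * (E * b * Q)) by rewrite -!mulnA mulnCA.
lia.
Qed.

Notation fin := (final_clauses a b E T cls).
Notation c := (count (neg_outside T) cls).

Lemma lit_final (C : clause) (l : lit) : C \in fin -> l \in C -> l.1 < m.+1.
Proof.
rewrite /final_clauses; case: ifP => _; last by move=> /sparsified_sub CL lC; exact: leqW (lit_L CL lC).
by case: ifP => // _; rewrite inE => /eqP ->; rewrite inE => /eqP -> /=.
Qed.

(** The extra clause contains a single variable, so only [a = b = 1] could fail. It is added only if
    some original clause contains a literal, which is impossible in that case. *)
Lemma Kfree_final : Kfree a b fin.
Proof.
rewrite /final_clauses; case: ifP => _; last exact: Kfree_sparsified.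
case: ifP => [/hasP [C Cc /hasP [[v s] vC _]]|_] A uA sA /=; last by [].
case: A uA sA => [|p [|q A]] uA sA; first by move: a0; rewrite -sA.
- rewrite addn0 /= orbF andbT; case: (m == p) => //=.
  change (1 < b); rewrite ltn_neqAle b0 andbT; apply/negP => /eqP b1.
  have := K (A := [:: v]) isT sA; rewrite -b1 ltnS leqn0 -leqn0 leqNgt -has_count; case/negP.
  by apply/hasP; exists C => //=; rewrite andbT; apply/hasP; exists (v, s).
- rewrite addn0; case e: (all _ _) => //=; exfalso.
  move: e => /= /andP [t1 /andP [t2 _]]; rewrite /touches /= !orbF in t1 t2.
  by move: uA; rewrite /= inE -(eqP t1) -(eqP t2) eqxx.
Qed.

Lemma size_final : size fin <= 2 * Mb.
Proof.
rewrite /final_clauses; have := size_sparsified; have := quota_gt0; case: ifP => _; last by lia.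
by case: ifP => _ /=; lia.
Qed.

(** With [g] and [f] the values of [A] on the final and on the reduced list, this is [(1 - 1 / E) *
    g / O' <= (c + f) / (c + O)] free of divisions. The scale cancels between
    [(E - 1) * O <= E * s' * O'] and [s' * g <= f], and the constant [c] only helps because
    [g <= O']. *)
Lemma final_approx k (A : seq nat) : 0 < k -> size A <= k ->
  let O := ropt m L k in let O' := ropt m.+1 fin k in
  (O' = 0 -> c + O = 0) /\
  (E - 1) * (c + O) * aval (mem A) fin <= E * (c + aval (mem A) L) * O'.
Proof.
move=> k0 Ak O O'; have [s' s'0 H] := sparsified_approx k0.
have ge' (B : seq nat) : size B <= k -> aval (mem B) fin <= O' by apply: ropt_ge; exact: lit_final.
have gA := ge' A Ak.
have [B [Bk BO]] := ropt_attained (N := m) (ls := L) k lit_L.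
have [_ HB] := H (mem B); rewrite BO -/O in HB.
have [S0|S0] := eqVneq (size S) 0.
  (* For empty [S] the inequality [HB] reads [E * O <= O]. *)
  have O0 : O = 0 by move: HB; rewrite (size0nil S0) /aval /= muln0 add0n; nia.
  rewrite O0 addn0; split; last by apply: leq_mul => //; apply: leq_mul; lia.
  move=> O'0; apply/eqP; rewrite -leqn0 leqNgt -has_count; apply/negP => hc.
  have := ge' [::] (leq0n _); rewrite O'0 /final_clauses S0 /= hc.
  by [].
have fS : fin = S by rewrite /final_clauses (negbTE S0).
rewrite fS in ge' gA *.
have O'1 : 0 < O'.
  case eS : S S0 => [|d s] // _.
  have dS : d \in S by rewrite eS mem_head.
  have [C _ [_ d0]] := mem_L (sparsified_sub dS).
  case: d d0 dS eS => // -[p []] d _ dS eS.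
    apply: leq_trans (ge' [:: p] _) => //; rewrite /aval -has_count.
    by apply/hasP; exists ((p, true) :: d) => //; rewrite /asat /= inE eqxx.
  apply: leq_trans (ge' [::] _) => //; rewrite /aval -has_count.
  by apply/hasP; exists ((p, false) :: d) => //.
split; first by lia.
have [HA _] := H (mem A).
have gB := ge' B Bk.
set g := aval (mem A) S in gA HA *; set f := aval (mem A) L in HA *.
have le1 : (E - 1) * O <= E * s' * O'.
  have := leq_mul (leqnn (E * s')) gB; nia.
have le2 : (E - 1) * O * g <= E * f * O'.
  apply: leq_trans (leq_mul le1 (leqnn g)) _.
  by rewrite -!mulnA leq_mul2l [O' * g]mulnC mulnA leq_mul2r HA !orbT.
have le3 : (E - 1) * c * g <= E * c * O'.
  by apply: leq_mul => //; rewrite leq_mul2r leq_subr orbT.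
by rewrite !mulnDr !mulnDl leq_add.
Qed.

End Quota.
End Reduce.

(** * Assembly *)

Lemma raw_wf I (C : clause) (l : lit) : C \in (raw I).2 -> l \in C -> l.1 < nvars I.
Proof. by move=> /mapP [D _ ->] /mapP [[v s] _ ->] /=. Qed.

Lemma touches_raw (I : cnf) (v : 'I_(nvars I)) C :
  touches [seq (val l.1, l.2) | l <- C] (val v) = occurs v C.
Proof. by rewrite /touches has_map. Qed.

Lemma count_raw I (p : pred clause) :
  count p (raw I).2 = count (fun C => p [seq (val l.1, l.2) | l <- C]) (clauses I).
Proof. by rewrite count_map. Qed.

Lemma Kab_free_Kfree a b I : 0 < b -> Kab_free a b I -> Kfree a b (raw I).2.
Proof.
move=> b0 free A uA sA; rewrite ltnNge; apply/negP => le; apply: free.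
rewrite count_raw (count_card [::]) in le.
set B0 := [set j | _] in le.
have uB : uniq (take b (enum B0)) by rewrite take_uniq ?enum_uniq.
have sB : size (take b (enum B0)) = b by rewrite size_takel // -cardE.
have BB j : j \in take b (enum B0) -> all (touches [seq (val l.1, l.2) | l <- nth [::] (clauses I) j]) A.
  by move=> /mem_take; rewrite mem_enum inE.
have An : {subset A <= iota 0 (nvars I)}.
  case: (take b (enum B0)) sB BB => [e|j s _ /(_ j (mem_head _ _)) /allP H] v vA; first by rewrite -e in b0.
  have /hasP [l] := H v vA; rewrite mem_iota => /mapP [[u s'] _ ->] /eqP /= <-.
  by rewrite /= ltn_ord.
exists [set v | val v \in A], [set j in take b (enum B0)]; split; last split.
- by rewrite card_ord_mem.
- by rewrite cardsE (card_uniqP uB).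
move=> v j; rewrite !inE => vA /BB /allP /(_ _ vA).
by rewrite touches_raw.
Qed.

Lemma Kfree_Kab_free a b I : Kfree a b (raw I).2 -> Kab_free a b I.
Proof.
move=> K [A [B [sA [sB AB]]]].
have := K [seq val v | v <- enum A]; rewrite map_inj_uniq ?enum_uniq; last exact: val_inj.
rewrite size_map -cardE => /(_ isT sA); rewrite count_raw (count_card [::]) -sB ltnNge => /negP; apply.
apply: subset_leq_card; apply/subsetP => j jB; rewrite inE; apply/allP => x /mapP [v].
by rewrite mem_enum => vA ->; rewrite touches_raw AB.
Qed.

Lemma sat_val_aval I (A : pred nat) (Y : {set 'I_(nvars I)}) :
  (forall v : 'I_(nvars I), A (val v) = (v \in Y)) -> sat_val Y = aval A (raw I).2.
Proof.
move=> AY; rewrite /sat_val /aval count_raw; apply: eq_count => C.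
by rewrite /asat has_map /clause_sat; apply: eq_has => l /=; rewrite AY.
Qed.

Definition indices n (Y : {set 'I_n}) : seq nat := [seq val v | v <- enum Y].

Lemma mem_indices n (Y : {set 'I_n}) v : (val v \in indices Y) = (v \in Y).
Proof. by rewrite mem_map ?mem_enum //; exact: val_inj. Qed.

Lemma size_indices n (Y : {set 'I_n}) : size (indices Y) = #|Y|.
Proof. by rewrite size_map -cardE. Qed.

Lemma OPT_ropt I k : OPT I k = ropt (nvars I) (raw I).2 k.
Proof.
apply: eq_bigr => Y _; rewrite (@sat_val_aval I (mem (indices Y))) => [|v]; last exact: mem_indices.
by symmetry; apply: worth_aval; [exact: raw_wf|exact: mem_indices].
Qed.

Lemma nth_enc_set n (Y : {set 'I_n}) p : nth false (enc_set Y) p = (p \in indices Y).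
Proof.
have [pn|pn] := ltnP p n.
  rewrite (nth_map (Ordinal pn)) ?size_enum_ord // -[p in RHS]/(val (Ordinal pn)) mem_indices.
  by rewrite (_ : nth _ _ p = Ordinal pn) //; apply: val_inj; rewrite /= nth_enum_ord.
rewrite nth_default; last by rewrite size_map size_enum_ord.
by apply/esym/negbTE/negP => /mapP [v _ e]; move: pn; rewrite e leqNgt ltn_ord.
Qed.

Section Assembly.
Variables (a b E K0 : nat).
Hypotheses (a0 : 0 < a) (b0 : 0 < b) (E4 : 4 < E).

Notation vars I k := (select a b E K0 (nvars I) (raw I).2 k).
Notation fin I k := (final_clauses a b E (vars I k) (raw I).2).

Lemma vars_uniq I k : uniq (vars I k).
Proof. by rewrite /select; case: ifP => _; rewrite filter_uniq ?iota_uniq. Qed.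

Lemma kernel_wf I k : raw (fA a b E K0 I k) = kernel_of a b E K0 (raw I, k).
Proof. by apply: raw_cnf_of => C l; exact: lit_final. Qed.

Lemma valid_kernel I k : valid_input a b I k -> valid_input a b (fA a b E K0 I k) k.
Proof.
move=> [free k0]; split=> //; apply: Kfree_Kab_free; rewrite kernel_wf.
have K := Kab_free_Kfree b0 free; have u := vars_uniq I k.
by apply: Kfree_final.
Qed.

Lemma mem_fB I k (Y : {set 'I_(nvars (fA a b E K0 I k))}) (v : 'I_(nvars I)) :
  (v \in fB Y) = (val v \in [seq nth 0 (vars I k) p | p <- indices Y & p < size (vars I k)]).
Proof.
rewrite inE /lift_of (nth_map 0) ?size_iota // nth_iota // add0n.
apply/hasP/mapP => [[p]|[p]].
  rewrite mem_iota add0n nth_enc_set /= => pm /andP [/eqP <- pY].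
  by exists p => //; rewrite mem_filter pm.
rewrite mem_filter => /andP [pm pY] e; exists p; first by rewrite mem_iota.
by rewrite nth_enc_set pY andbT -e.
Qed.

(* [X] is the optimum of the original instance over the selected variables; the last
   inequality avoids dividing by the optimum of the kernel, which may be 0. *)
Lemma kernel_opt I k (Y : {set 'I_(nvars (fA a b E K0 I k))}) : valid_input a b I k -> #|Y| <= k ->
  exists X, [/\ #|fB Y| <= k, E * OPT I k <= E * X + 4 * OPT I k, OPT (fA a b E K0 I k) k = 0 -> X = 0 &
    (E - 1) * X * sat_val Y <= E * sat_val (fB Y) * OPT (fA a b E K0 I k) k].
Proof.
move=> [free k0] Yk; set T := vars I k; set cls := (raw I).2.
have K := Kab_free_Kfree b0 free.
have E1 : 1 < E by lia.
have uT : uniq T := vars_uniq I k.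
pose O := ropt (size T) (reduced T cls) k; pose c := count (neg_outside T) cls.
have O'E : OPT (fA a b E K0 I k) k = ropt (size T).+1 (fin I k) k by rewrite OPT_ropt kernel_wf.
have sI : size (indices Y) <= k by rewrite size_indices.
have [O'0 H] := final_approx uT a0 b0 E1 K k0 sI.
rewrite -/c -/O -O'E in O'0 H.
have eY : sat_val Y = aval (mem (indices Y)) (fin I k).
  by rewrite (@sat_val_aval _ (mem (indices Y))) ?kernel_wf // => v; exact: mem_indices.
pose lifted := [seq nth 0 T p | p <- indices Y & p < size T].
have eB : sat_val (fB Y) = c + aval (mem (indices Y)) (reduced T cls).
  rewrite (@sat_val_aval _ (mem lifted)) => [|v]; last by rewrite mem_fB.
  apply: aval_reduced => // [v /mapP [p]|p pT].
    by rewrite mem_filter => /andP [pT _] ->; exact: mem_nth.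
  apply/mapP/idP => [[q]|pY]; last by exists p => //; rewrite mem_filter pT.
  by rewrite mem_filter => /andP [qT qY] /eqP; rewrite nth_uniq // => /eqP ->.
exists (c + O); split.
- have -> : fB Y = [set v : 'I_(nvars I) | val v \in lifted] by apply/setP => v; rewrite mem_fB inE.
  apply: leq_trans (card_ord_mem_le _ _) _; rewrite size_map size_filter.
  exact: leq_trans (count_size _ _) sI.
- have [_ _ _ [Z [Zk ZT ZO]]] := select_spec K0 (@raw_wf I) a0 b0 k0 E1 K.
  rewrite OPT_ropt /ropt; apply: leq_trans ZO _; rewrite leq_add2r leq_mul2l; apply/orP; right.
  (* The good solution inside [T], renamed to positions, competes for the optimum of the reduced
     list. *)
  pose Zi := [seq index v T | v <- indices Z].
  have ZA : forall v, mem (indices Z) v -> v \in T.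
    by move=> v /mapP [z]; rewrite mem_enum => zZ ->; exact: ZT.
  have ZE : forall p, p < size T -> mem (indices Z) (nth 0 T p) = mem Zi p.
    move=> p pT; apply/idP/mapP => [pZ|[v vZ ->]].
      by exists (nth 0 T p) => //; rewrite index_uniq.
    by rewrite nth_index //; exact: ZA.
  rewrite (worth_aval (@raw_wf I) (A := mem (indices Z))); last exact: mem_indices.
  rewrite (aval_reduced _ ZA ZE) leq_add2l; apply: ropt_ge; first exact: lit_L.
  by rewrite size_map size_indices.
- exact: O'0.
by rewrite eY eB.
Qed.

(** With [B = b * k * E * E] each of the three groups is bounded by [a * (7 * B) ^ b], as
    [6 * B + 1 <= 7 * B]. Two spare copies of this absorb the 1 in [pos_quota] and the fresh
    variable, and five copies fit into [a * (5 * 7 * B) ^ b]. *)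
Lemma kernel_nvars I k : K0 = 140 * a * b * E * E -> valid_input a b I k ->
  nvars (fA a b E K0 I k) <= a * (35 * b * k * E * E) ^ b /\
  (k < K0 -> nvars (fA a b E K0 I k) <= k.+1).
Proof.
move=> eK [free k0].
have K := Kab_free_Kfree b0 free; have E1 : 1 < E by lia.
have [_ _ sT _] := select_spec K0 (@raw_wf I) a0 b0 k0 E1 K.
have -> : nvars (fA a b E K0 I k) = (size (vars I k)).+1 by [].
have powb x : x <= x ^ b by case: (b) b0 => // b' _; case: x => // x; rewrite expnS leq_pmulr ?expn_gt0.
split; last by move=> lt; move: sT; rewrite (leqNgt K0 k) lt.
pose B := b * k * E * E.
have B0 : 0 < B by rewrite /B !muln_gt0 b0 k0; lia.
apply: leq_ltn_trans sT _; case: ifP => _; last first.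
  have le : k < a * (35 * b * k * E * E).
    have -> : 35 * b * k * E * E = 35 * B by rewrite /B; nia.
    have : k <= B by rewrite /B -!mulnA mulnCA leq_pmulr // !muln_gt0 b0; lia.
    by move: B0; nia.
  by apply: leq_trans le _; rewrite leq_mul2l powb orbT.
have -> : 35 * b * k * E * E = 5 * (7 * B) by rewrite /B; nia.
rewrite /pos_quota /core_quota /opt_bound -/B.
have le1 : a * (b * (k * E)) ^ b <= a * (7 * B) ^ b.
  by rewrite leq_mul2l leq_expr ?orbT // /B; nia.
have le2 : a * B ^ b <= a * (7 * B) ^ b by rewrite leq_mul2l leq_expr ?orbT //; lia.
have le3 : a * (6 * B + 1) ^ b <= a * (7 * B) ^ b by rewrite leq_mul2l leq_expr ?orbT //; lia.
have le4 : 7 <= a * (7 * B) ^ b.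
  have p7 : 7 <= 7 * B by lia.
  by apply: leq_trans p7 _; apply: leq_trans (powb _) _; rewrite leq_pmull.
have le5 : 5 * (a * (7 * B) ^ b) <= a * (5 * (7 * B)) ^ b.
  by rewrite [(5 * _) ^ b]expnMn mulnCA leq_mul2l leq_mul2r powb !orbT.
lia.
Qed.

Lemma kernel_clauses I k : valid_input a b I k ->
  size (clauses (fA a b E K0 I k)) <= 4 * E * b * (2 * nvars (fA a b E K0 I k)) ^ (2 * a + 1).
Proof.
move=> [free k0]; have K := Kab_free_Kfree b0 free; have E1 : 1 < E by lia.
have -> : size (clauses (fA a b E K0 I k)) = size (fin I k).
  have e J : size (clauses J) = size (raw J).2 by rewrite size_map.
  by rewrite e kernel_wf.
apply: leq_trans (size_final _ _ _ _ _) _ => //; first exact: vars_uniq.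
change (2 * (2 * E * b * (2 * nvars (fA a b E K0 I k)) ^ (2 * a + 1)) <=
  4 * E * b * (2 * nvars (fA a b E K0 I k)) ^ (2 * a + 1)).
by rewrite !mulnA leqnn.
Qed.
End Assembly.

(** * Translation of the integer bounds to real numbers *)

Section Bounds.
Local Open Scope R_scope.

Lemma leq_INR m n : (m <= n)%N -> INR m <= INR n.
Proof. by move=> le; apply: le_INR; apply/leP. Qed.

Lemma INR_muln m n : INR (m * n)%N = INR m * INR n.
Proof. exact: mult_INR. Qed.

Lemma INR_expn m n : INR (m ^ n)%N = INR m ^ n.
Proof. by elim: n => //= n IH; rewrite expnS INR_muln IH. Qed.

Lemma pow_muln x m n : x ^ (m * n)%N = (x ^ m) ^ n.
Proof. by rewrite -pow_mult. Qed.

(** Selection costs [4 / E] and sampling [1 / E], and [(1 - 4 / E) * (1 - 1 / E) >= 1 - 5 / E >= 1 -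
    eps]. *)
Lemma ratio_bound eps beta (E opt X g F O' : nat) :
  5 <= eps * INR E -> 0 < eps < 1 / 2 -> (4 < E)%N ->
  (E * opt <= E * X + 4 * opt)%N -> (O' = 0%N -> X = 0%N) ->
  ((E - 1) * X * g <= E * F * O')%N -> beta * INR O' <= INR g ->
  (1 - eps) * beta * INR opt <= INR F.
Proof.
move=> Eeps eps01 E4 H1 H2 H3 H4.
have F0 := pos_INR F; have o0 := pos_INR opt; have X0 := pos_INR X.
have E5 : 5 <= INR E by have := leq_INR E4; rewrite /=; lra.
have [beta0|beta0] := Rle_or_lt beta 0.
  apply: Rle_trans F0; have : 0 <= (1 - eps) * - beta * INR opt; last by lra.
  by apply: Rmult_le_pos => //; apply: Rmult_le_pos; lra.
have {}H1 := leq_INR H1; rewrite plus_INR !INR_muln in H1.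
have e4 : INR 4 = 4 by rewrite /=; lra.
rewrite e4 in H1.
(* A kernel optimum of 0 permits every [beta]; then [X = 0], and [E > 4] forces the original optimum
   to be 0. *)
case: (posnP O') => [O'0|O'p].
  have X00 := H2 O'0; rewrite X00 /= Rmult_0_r Rplus_0_l in H1.
  have -> : INR opt = 0 by nra.
  by rewrite Rmult_0_r.
have O'1 : 0 < INR O' by apply: lt_0_INR; apply/ltP.
have {}H3 := leq_INR H3; rewrite !INR_muln minus_INR in H3; last by apply/leP; lia.
rewrite /= in H3.
have le1 : (INR E - 1) * INR X * beta <= INR E * INR F.
  apply: (Rmult_le_reg_r (INR O')) => //; apply: Rle_trans H3.
  rewrite Rmult_assoc; apply: Rmult_le_compat_l => //.
  by apply: Rmult_le_pos => //; lra.
have le2 : (INR E - 4) * INR opt <= INR E * INR X by lra.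
have le3 : (INR E - 4) * INR opt * ((INR E - 1) * beta) <= INR E * INR X * ((INR E - 1) * beta).
  by apply: Rmult_le_compat_r le2; apply: Rmult_le_pos; lra.
have le4 : INR E * INR X * ((INR E - 1) * beta) <= INR E * (INR E * INR F).
  rewrite (_ : _ * _ * _ = INR E * ((INR E - 1) * INR X * beta)); last by ring.
  by apply: Rmult_le_compat_l le1; lra.
have le5 : INR E * INR E * (1 - eps) <= (INR E - 4) * (INR E - 1) by nra.
have ob : 0 <= INR opt * beta by apply: Rmult_le_pos => //; lra.
have le6 := Rmult_le_compat_r _ _ _ ob le5.
apply: (Rmult_le_reg_l (INR E * INR E)); first by nra.
by lra.
Qed.

(** [1260 = 35 * 36], where 36 comes from [E * E <= 36 / eps ^ 2]. *)
Lemma nvars_bound (n a b k E : nat) eps :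
  (n <= a * (35 * b * k * E * E) ^ b)%N -> (0 < b)%N -> 0 < eps < 1 / 2 -> INR E <= 6 / eps ->
  INR n <= INR a * (1260 * INR b) ^ (2 * b) * INR k ^ b / eps ^ (3 * b).
Proof.
move=> le b0 eps01 Ee.
have eps0 : 0 < eps by lra.
have a0 := pos_INR a; have k0 := pos_INR k; have E0 := pos_INR E.
have b1 : 1 <= INR b by have := leq_INR b0.
have {}le := leq_INR le; rewrite INR_muln INR_expn !INR_muln in le.
have e35 : INR 35 = 35 by rewrite INR_IZR_INZ.
rewrite e35 in le; apply: Rle_trans le _.
have -> : INR a * (1260 * INR b) ^ (2 * b) * INR k ^ b / eps ^ (3 * b) =
   INR a * ((1260 * INR b) ^ 2 * INR k * (/ eps) ^ 3) ^ b.
  rewrite (Rpow_mult_distr (_ * INR k)) (Rpow_mult_distr (_ ^ 2)) -!pow_muln pow_inv.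
  by rewrite /Rdiv !Rmult_assoc.
apply: Rmult_le_compat_l => //; apply: pow_incr; split.
  by repeat apply: Rmult_le_pos => //; lra.
have ie : 1 <= / eps by rewrite -Rinv_1; apply: Rinv_le_contravar; lra.
have ie0 : 0 < / eps by lra.
have EE : INR E * INR E <= 36 * (/ eps * / eps).
  rewrite /Rdiv in Ee; apply: Rle_trans (Rmult_le_compat _ _ _ _ E0 E0 Ee Ee) _; lra.
have bk : 0 <= INR b * INR k by apply: Rmult_le_pos; lra.
apply: (@Rle_trans _ (35 * (INR b * INR k) * (36 * (/ eps * / eps)))).
  rewrite (_ : 35 * INR b * INR k * INR E * INR E = 35 * (INR b * INR k) * (INR E * INR E)); last by ring.
  by apply: Rmult_le_compat_l => //; lra.
have t : 0 <= / eps * / eps by apply: Rmult_le_pos; lra.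
have bkt : 0 <= INR b * INR k * (/ eps * / eps) by apply: Rmult_le_pos.
rewrite (_ : (1260 * INR b) ^ 2 * INR k * (/ eps) ^ 3 =
  1260 * (INR b * INR k * (/ eps * / eps)) * (1260 * INR b * / eps)); last by ring.
have : 1 <= 1260 * INR b * / eps by nra.
by move=> h; nra.
Qed.

Lemma pow_le_exp x m n : 1 <= x -> (m <= n)%N -> x ^ m <= x ^ n.
Proof. by move=> x1 le; apply: Rle_pow => //; apply/leP. Qed.

Lemma le_2_pow n : INR n <= 2 ^ n.
Proof. by rewrite -[2]/(INR 2) -INR_expn; apply: leq_INR; apply: ltnW; apply: ltn_expl. Qed.

(** Each factor is bounded by a power of [x = k / eps >= 2]: 4 by [x ^ 2], [E] by [x ^ 4], [b] by
    [x ^ b] and [2 * n] by [x ^ 3]. The exponents add up to [6 * a + b + 9 <= 16 * a * b], with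
    equality for [a = b = 1]. *)
Lemma clauses_bound_small (N n a b k E : nat) eps :
  (N <= 4 * E * b * (2 * n) ^ (2 * a + 1))%N -> (n <= k.+1)%N -> (0 < k)%N -> (0 < a)%N -> (0 < b)%N ->
  0 < eps < 1 / 2 -> INR E <= 6 / eps -> INR N <= (INR k / eps) ^ (16 * a * b).
Proof.
move=> le nk k0 a0 b0 eps01 Ee; set x := INR k / eps.
have k1 : 1 <= INR k by have := leq_INR k0.
have ie : 2 <= / eps.
  by rewrite -[2]Rinv_inv; apply: Rinv_le_contravar; lra.
have x2 : 2 <= x by rewrite /x /Rdiv; nra.
have kx : INR k <= x by rewrite /x /Rdiv; nra.
have ex : / eps <= x by rewrite /x /Rdiv; nra.
have Ex : INR E <= x ^ 4.
  apply: Rle_trans Ee _; rewrite /Rdiv /=; have : 8 <= x * (x * x) by nra.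
  by move=> h; nra.
have bx : INR b <= x ^ b by apply: Rle_trans (le_2_pow b) _; apply: pow_incr; lra.
have nx : INR (2 * n)%N <= x ^ 3.
  have h : INR (2 * n)%N <= 4 * INR k.
    have : (2 * n <= 4 * k)%N by lia.
    by move=> /leq_INR; rewrite !INR_muln; rewrite (_ : INR 4 = 4) //=; lra.
  have x4 : 4 <= x * x by nra.
  by apply: Rle_trans h _; rewrite /=; nra.
have {}le := leq_INR le; rewrite !INR_muln INR_expn in le.
have e4 : INR 4 = 4 by rewrite INR_IZR_INZ.
rewrite e4 in le; apply: Rle_trans le _.
have n0 := pos_INR (2 * n)%N; have E0 := pos_INR E; have b00 := pos_INR b.
apply: (@Rle_trans _ (x ^ 2 * x ^ 4 * x ^ b * (x ^ 3) ^ (2 * a + 1))).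
  apply: Rmult_le_compat; [|by apply: pow_le| |by apply: pow_incr].
    by repeat apply: Rmult_le_pos => //; lra.
  apply: Rmult_le_compat => //; first by apply: Rmult_le_pos => //; lra.
  by apply: Rmult_le_compat => //; [lra|rewrite /=; nra].
rewrite -pow_muln -!pow_add; apply: pow_le_exp; first by lra.
rewrite -!plusE; nia.
Qed.

(** Above the threshold [2 * a], [4 * E * b] and [35 * b * E * E] are all at most [k], so every
    factor becomes a power of [k], with total exponent [(2 * b + 1) * (2 * a + 1) + 1]. *)
Lemma clauses_bound_large (N n a b k E : nat) eps :
  (N <= 4 * E * b * (2 * n) ^ (2 * a + 1))%N -> (n <= a * (35 * b * k * E * E) ^ b)%N ->
  (140 * a * b * E * E <= k)%N -> (0 < a)%N -> (0 < b)%N -> (0 < E)%N ->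
  0 < eps < 1 / 2 -> INR N <= (INR k / eps) ^ (16 * a * b).
Proof.
move=> le nk Kk a0 b0 E0 eps01; set x := INR k / eps.
have abEE : (0 < a * b * E * E)%N by rewrite !muln_gt0 a0 b0 E0.
have k0 : (0 < k)%N by lia.
have k1 : 1 <= INR k by have := leq_INR k0.
have ie : 2 <= / eps.
  by rewrite -[2]Rinv_inv; apply: Rinv_le_contravar; lra.
have kx : INR k <= x by rewrite /x /Rdiv; nra.
have h1 : (35 * b * E * E <= k)%N by apply: leq_trans Kk; nia.
have bEE : (0 < b * E * E)%N by rewrite !muln_gt0 b0 E0.
have h2 : (2 * a <= k)%N by apply: leq_trans Kk; nia.
have h3 : (4 * E * b <= k)%N by apply: leq_trans Kk; nia.
have h4 : (2 * n <= k ^ (2 * b + 1))%N.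
  apply: (@leq_trans (k * (k * k) ^ b)%N); last by rewrite addn1 expnS expnMn -expnD addnn mul2n.
  apply: (@leq_trans (2 * a * (35 * b * k * E * E) ^ b)%N); first by rewrite -mulnA leq_mul2l nk orbT.
  apply: leq_mul => //; apply: leq_expr.
  by rewrite (_ : 35 * b * k * E * E = 35 * b * E * E * k)%N ?leq_mul2r ?h1 ?orbT //; nia.
have h5 : (N <= k ^ (16 * a * b))%N.
  apply: leq_trans le _; apply: (@leq_trans (k * (k ^ (2 * b + 1)) ^ (2 * a + 1))%N).
    by apply: leq_mul => //; exact: leq_expr.
  by rewrite -expnM -expnS; apply: leq_pexp2l => //; nia.
apply: Rle_trans (leq_INR h5) _; rewrite INR_expn; apply: pow_incr; lra.
Qed.

End Bounds.

Theorem theorem1p1 :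
  exists (C1 C2 : R) (C3 : nat),
  forall (a b : nat) (eps : R),
    0 < a -> 0 < b -> (0 < eps < 1 / 2)%Re ->
    exists (fA : cnf -> nat -> cnf)
           (fB : forall (I : cnf) (k : nat),
                   {set 'I_(nvars (fA I k))} -> {set 'I_(nvars I)}),
      @pp_APPA a b (1 - eps) fA fB /\
      forall (I : cnf) (k : nat), valid_input a b I k ->
        (INR (nvars (fA I k)) <=
           C1 * INR k * ln (INR k) / eps
           + INR a * (C2 * INR b) ^ (2 * b) * INR k ^ b / eps ^ (3 * b))%Re /\
        (INR (size (clauses (fA I k))) <= (INR k / eps) ^ (C3 * a * b))%Re.
Proof.
(* 1260 comes from [nvars_bound], and 16 is the exponent needed in [clauses_bound_small]. *)
exists 0%Re, 1260%Re, 16 => a b eps a0 b0 eps01.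
have [E [E4 Elo Ehi]] : exists E : nat, [/\ 4 < E, (5 <= eps * INR E)%Re & (INR E <= 6 / eps)%Re].
  have [up1 up2] := archimed (5 / eps).
  have e10 : (10 < 5 / eps)%Re.
    by apply: (Rmult_lt_reg_r eps); [lra|rewrite /Rdiv Rmult_assoc Rinv_l; lra].
  have z0 : (0 <= up (5 / eps))%Z by apply: le_IZR; lra.
  have [E upE] := IZN _ z0.
  have eE : INR E = IZR (up (5 / eps)) by rewrite upE INR_IZR_INZ.
  exists E; rewrite eE; split.
  - by apply/ltP; apply: INR_lt; rewrite eE /=; lra.
  - have : (eps * (5 / eps) <= eps * IZR (up (5 / eps)))%Re by apply: Rmult_le_compat_l; lra.
    by rewrite (_ : (eps * (5 / eps) = 5)%Re) //; field; lra.
  - have : (IZR (up (5 / eps)) <= 5 / eps + 1)%Re by lra.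
    have : (1 <= / eps)%Re by rewrite -Rinv_1; apply: Rinv_le_contravar; lra.
    by rewrite /Rdiv; lra.
pose K0 := 140 * a * b * E * E.
exists (fA a b E K0), (@fB a b E K0); split.
  split; first by apply: (@fA_poly a b E K0 (valid_input a b)) => I k _; exact: kernel_wf.
  split; first by apply: (@fB_poly a b E K0 (valid_input a b)) => I k _; exact: kernel_wf.
  split; first by move=> I k; exact: valid_kernel.
  move=> I k beta Y valid [Yk Yb].
  have [X [Bk H1 H2 H3]] := kernel_opt a0 b0 E4 valid Yk.
  by split=> //; exact: ratio_bound Elo eps01 E4 H1 H2 H3 Yb.
move=> I k valid; have [_ k0] := valid.
have [nv nvs] := kernel_nvars a0 b0 E4 (erefl K0) valid.
have nc := kernel_clauses K0 a0 b0 E4 valid.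
split.
  rewrite /Rdiv !Rmult_0_l Rplus_0_l; exact: nvars_bound nv b0 eps01 Ehi.
have [lt|ge] := ltnP k K0.
  exact: clauses_bound_small nc (nvs lt) k0 a0 b0 eps01 Ehi.
apply: clauses_bound_large nc nv ge a0 b0 _ eps01; exact: ltn_trans E4.
Qed.
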